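(* For terms $\Gamma\vdash e_1,e_2:\tau$ of the Gaussian language, $[\![e_1]\!]=[\![e_2]\!]$ in $\mathrm{Cond}(\mathrm{Gauss})$ if and only if $e_1$ and $e_2$ are contextually equivalent.
   Context: Gaussian language. Types $\tau::=\mathsf R\mid\mathsf I\mid\tau\ast\tau$. Terms $e::=x\mid e+e\mid\alpha\cdot e\mid\underline\beta\mid(e,e)\mid()\mid\mathrm{let}\ x=e\ \mathrm{in}\ e\mid\mathrm{let}\ (x,y)=e\ \mathrm{in}\ e\mid\mathsf{normal}()\mid e=:=e$ ($\alpha,\beta\in\mathbb R$), with the evident typing: $+$, $\alpha\cdot$, $\underline\beta$, $\mathsf{normal}()$ have type $\mathsf R$; $s=:=t:\mathsf I$ for $s,t:\mathsf R$. Operational semantics: configurations are $\bot$ or pairs $(e,\psi)$ with $\psi$ a Gaussian distribution (mean vector, positive semidefinite covariance) on $\mathbb R^r$ and $z_1:\mathsf R,\dots,z_r:\mathsf R\vdash e$. Values $v::=x\mid(v,v)\mid v+v\mid\alpha\cdot v\mid\underline\beta\mid()$; redexes $\mathsf{normal}()$, $v=:=w$, $\mathrm{let}\ x=v\ \mathrm{in}\ e$, $\mathrm{let}\ (x,y)=v\ \mathrm{in}\ e$; call-by-value evaluation contexts $C$ (left-to-right in pairs, sums, $=:=$; under $\alpha\cdot$; in the bound term of lets). Rules: $(\mathsf{normal}(),\psi)\rhd(z_{r+1},\psi\otimes\mathcal N(0,1))$; let rules substitute values; for $v=:=w$, write the affine function $v-w$ of the latent variables as $ux+b$; if $X\sim\psi$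 and $-b$ lies in the support of $uX$, then $(v=:=w,\psi)\rhd((),\psi')$ with $\psi'$ the conditional distribution of $X$ given $uX=-b$ (mean $\mu+\frac{-b-u\mu}{\sigma}\Sigma u^T$, covariance $\Sigma-\frac1\sigma\Sigma u^Tu\Sigma$ with $\sigma=u\Sigma u^T>0$, or $\psi'=\psi$ if $\sigma=0$), otherwise $\rhd\bot$; reduction lifts through evaluation contexts, and $\bot$ propagates. Every closed program from $(e,())$ reaches either a unique value configuration $(v,\psi)$ or $\bot$; its observable outcome is the pushforward $v_*\psi$ or failure. Contextual equivalence $e_1\approx e_2$: for all closed contexts $K[-]$, $K[e_1]$ fails iff $K[e_2]$ fails, and if both reach values $(v_i,\psi_i)$ then $(v_1)_*\psi_1=(v_2)_*\psi_2$. Denotational semantics: $\mathrm{Gauss}$ is the Markov category with objects $n\in\mathbb N$, morphisms $(A,b,\Sigma):m\to n$ ($x\mapsto Ax+b+\mathcal N(0,\Sigma)$), composition $(A,b,\Sigma)(C,d,\Xi)=(AC,Ad+b,A\Xi A^T+\Sigma)$, block-diagonal tensor, copy $x\mapsto(x,x)$. For a Markov category $\mathcal C$ with conditionals and precise supports, $\mathrm{Cond}(\mathcal C)$ has morphisms $X\leadsto Y$ the triples $(K,f,o)$, $f:X\to Y\otimes K$, $o:I\to K$ deterministic, composed by $(K',f',o')\bullet(K,f,o)=(K'\otimes K,(f'\otimes\mathrm{id}_K)f,o'\otimes o)$ and tensored componentwise, quotiented by $F\approx G$ iff for all $A$ and all states $\Psi:I\leadsto A\otimes X$ the inference problems $(\mathrm{Id}_A\otimes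 F)\bullet\Psi$ and $(\mathrm{Id}_A\otimes G)\bullet\Psi$ either both fail or both succeed with equal posterior, where a state $(K,\psi,o)$ succeeds iff $o$ lies in the support of the marginal $\psi_K$ and then has posterior $\psi|_K\,o$ ($\psi|_K$ a conditional). In $\mathrm{Gauss}$, a point $o$ is in the support of $\mathcal N(b,\Sigma)$ iff $o\in b+\mathrm{col}(\Sigma)$. $\mathcal C$ embeds by $J(f)=(I,f,\mathrm{id})$. Interpret $[\![\mathsf R]\!]=1$, $[\![\mathsf I]\!]=0$, $[\![\tau\ast\tau']\!]=[\![\tau]\!]+[\![\tau']\!]$, contexts likewise, and terms $\Gamma\vdash e:\tau$ as morphisms $[\![\Gamma]\!]\leadsto[\![\tau]\!]$ compositionally: variables as projections, pairs as tensor after copying the context, $\mathrm{let}\ x=e\ \mathrm{in}\ t$ as $[\![t]\!]\bullet(\mathrm{Id}\otimes[\![e]\!])\bullet J(\mathrm{copy})$, $+$, $\alpha\cdot$, $\underline\beta$, $\mathsf{normal}()$ as $J$ of the affine/Gaussian maps $(1\ 1)$, $\alpha$, constant $\beta$, $\mathcal N(0,1)$, and $s=:=t$ as the conditioning effect $(1,\mathrm{id}_1,0):1\leadsto0$ applied to $[\![s]\!]-[\![t]\!]$. *)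

(* Defs.v *)
From HB Require Import structures.
From mathcomp Require Import all_boot all_order all_algebra.
From mathcomp Require Import reals.
Set Implicit Arguments. Unset Strict Implicit. Unset Printing Implicit Defensive.
Import Order.TTheory GRing.Theory Num.Theory.
Local Open Scope ring_scope.

Inductive ty := TR | TI | TPair of ty & ty.

Fixpoint dimt (t : ty) : nat :=
  match t with TR => 1%N | TI => 0%N | TPair a b => (dimt a + dimt b)%N end.

(* typing contexts: head of the list = most recently bound variable *)
Definition tctx := seq (nat * ty).

Fixpoint lookup (G : tctx) (x : nat) : option ty :=
  match G with
  | [::] => None
  | (y, t) :: G' => if x == y then Some t else lookup G' x
  end.

(* [[Gamma]] : the context x1:t1,...,xn:tn (xn most recent) is t1 * ... * tn *)
Fixpoint dimc (G : tctx) : nat :=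
  match G with [::] => 0%N | (_, t) :: G' => (dimc G' + dimt t)%N end.

Section Gaussian.
Variable R : realType.

(* Terms.  [Var x] are the ordinary (named) variables; [Lat i] is the
   latent variable z_{i+1} of a configuration (never in source terms). *)
Inductive term :=
| Var of nat
| Lat of nat
| Plus of term & term
| Scale of R & term
| Const of R
| Pair of term & term
| Unt
| Let of nat & term & term
| LetP of nat & nat & term & term
| Normal
| CondE of term & term.

Inductive has_type : tctx -> term -> ty -> Prop :=
| T_Var G x t : lookup G x = Some t -> has_type G (Var x) t
| T_Plus G e1 e2 : has_type G e1 TR -> has_type G e2 TR -> has_type G (Plus e1 e2) TR
| T_Scale G a e : has_type G e TR -> has_type G (Scale a e) TR
| T_Const G b : has_type G (Const b) TR
| T_Pair G e1 e2 t1 t2 :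
    has_type G e1 t1 -> has_type G e2 t2 -> has_type G (Pair e1 e2) (TPair t1 t2)
| T_Unit G : has_type G Unt TI
| T_Let G x e e' t1 t2 :
    has_type G e t1 -> has_type ((x, t1) :: G) e' t2 -> has_type G (Let x e e') t2
| T_LetP G x y e e' t1 t2 t3 :
    has_type G e (TPair t1 t2) -> has_type ((y, t2) :: (x, t1) :: G) e' t3 ->
    has_type G (LetP x y e e') t3
| T_Normal G : has_type G Normal TR
| T_Cond G s t : has_type G s TR -> has_type G t TR -> has_type G (CondE s t) TI.

(* Support of a Gaussian N(mu, S): o in mu + col(S)                    *)
Definition in_support n (o mu : 'cV[R]_n) (S : 'M[R]_n) :=
  exists w : 'cV[R]_n, o - mu = S *m w.

Definition psd n (S : 'M[R]_n) :=
  S^T = S /\ forall x : 'cV[R]_n, 0 <= (x^T *m S *m x) 0 0.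

(* a Gaussian distribution on R^r, given by mean and covariance *)
Record gstate := GState { gd : nat; gmu : 'cV[R]_gd; gSig : 'M[R]_gd }.

Definition gempty : gstate := @GState 0%N 0 0.

(* psi (x) N(0,1) *)
Definition gextend (p : gstate) : gstate :=
  @GState (gd p + 1)%N (col_mx (gmu p) 0) (block_mx (gSig p) 0 0 1%:M).

Fixpoint is_value (v : term) : bool :=
  match v with
  | Var _ | Lat _ | Const _ | Unt => true
  | Pair a b | Plus a b => is_value a && is_value b
  | Scale _ a => is_value a
  | _ => false
  end.

(* a value of type R as an affine function u z + b of the latent vars *)
Fixpoint aff (r : nat) (v : term) : 'rV[R]_r * R :=
  match v with
  | Lat i => (\row_(j < r) (if (j : nat) == i then 1 else 0), 0)
  | Plus a b => ((aff r a).1 + (aff r b).1, (aff r a).2 + (aff r b).2)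
  | Scale c a => (c *: (aff r a).1, c * (aff r a).2)
  | Const b => (0, b)
  | _ => (0, 0)
  end.

(* v - w = u z + b *)
Definition condU (p : gstate) (v w : term) : 'rV[R]_(gd p) :=
  (aff (gd p) v).1 - (aff (gd p) w).1.
Definition condB (p : gstate) (v w : term) : R :=
  (aff (gd p) v).2 - (aff (gd p) w).2.

(* -b lies in the support of u X, X ~ p *)
Definition cond_ok (p : gstate) (v w : term) :=
  let u := condU p v w in
  in_support ((- condB p v w)%:M : 'cV[R]_1) (u *m gmu p) (u *m gSig p *m u^T).

(* conditional distribution of X given u X = -b *)
Definition cond_post (p : gstate) (v w : term) : gstate :=
  let u := condU p v w in
  let b := condB p v w in
  let sig := (u *m gSig p *m u^T) 0 0 in
  if sig == 0 then p else
  @GState (gd p)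
    (gmu p + ((- b - (u *m gmu p) 0 0) / sig) *: (gSig p *m u^T))
    (gSig p - sig^-1 *: (gSig p *m u^T *m u *m gSig p)).

(* substitution of a value (closed w.r.t. named variables in every
   reachable configuration, so no capture can occur) *)
Fixpoint subst (x : nat) (v : term) (e : term) : term :=
  match e with
  | Var y => if y == x then v else e
  | Lat _ | Const _ | Unt | Normal => e
  | Plus a b => Plus (subst x v a) (subst x v b)
  | Scale c a => Scale c (subst x v a)
  | Pair a b => Pair (subst x v a) (subst x v b)
  | Let y a b => Let y (subst x v a) (if y == x then b else subst x v b)
  | LetP y z a b =>
      LetP y z (subst x v a) (if (y == x) || (z == x) then b else subst x v b)
  | CondE a b => CondE (subst x v a) (subst x v b)
  end.

(* None is the failure configuration bottom *)
Definition lift (C : term -> term) (o : option (term * gstate)) :=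
  match o with Some (e, p) => Some (C e, p) | None => None end.

Inductive step : term -> gstate -> option (term * gstate) -> Prop :=
| S_Normal p : step Normal p (Some (Lat (gd p), gextend p))
| S_Let x v e p : is_value v -> step (Let x v e) p (Some (subst x v e, p))
| S_LetP x y v w e p : is_value v -> is_value w ->
    step (LetP x y (Pair v w) e) p (Some (subst x v (subst y w e), p))
| S_CondOK v w p : is_value v -> is_value w -> cond_ok p v w ->
    step (CondE v w) p (Some (Unt, cond_post p v w))
| S_CondFail v w p : is_value v -> is_value w -> ~ cond_ok p v w ->
    step (CondE v w) p None
| C_PlusL e1 e2 p o : step e1 p o -> step (Plus e1 e2) p (lift (fun e => Plus e e2) o)
| C_PlusR v e2 p o : is_value v -> step e2 p o -> step (Plus v e2) p (lift (Plus v) o)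
| C_Scale a e p o : step e p o -> step (Scale a e) p (lift (Scale a) o)
| C_PairL e1 e2 p o : step e1 p o -> step (Pair e1 e2) p (lift (fun e => Pair e e2) o)
| C_PairR v e2 p o : is_value v -> step e2 p o -> step (Pair v e2) p (lift (Pair v) o)
| C_CondL e1 e2 p o : step e1 p o -> step (CondE e1 e2) p (lift (fun e => CondE e e2) o)
| C_CondR v e2 p o : is_value v -> step e2 p o -> step (CondE v e2) p (lift (CondE v) o)
| C_Let x e t p o : step e p o -> step (Let x e t) p (lift (fun e' => Let x e' t) o)
| C_LetP x y e t p o : step e p o -> step (LetP x y e t) p (lift (fun e' => LetP x y e' t) o).

Inductive steps : term -> gstate -> option (term * gstate) -> Prop :=
| St_refl e p : steps e p (Some (e, p))
| St_bot e p : step e p None -> steps e p None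
| St_step e p e' p' o : step e p (Some (e', p')) -> steps e' p' o -> steps e p o.

Definition fails (e : term) := steps e gempty None.
Definition runs (e v : term) (p : gstate) := steps e gempty (Some (v, p)) /\ is_value v.

Fixpoint comps (v : term) : seq term :=
  match v with Pair a b => comps a ++ comps b | Unt => [::] | _ => [:: v] end.

(* v_* psi, a Gaussian on R^k, given by its mean and covariance *)
Definition pushforward (v : term) (p : gstate) : seq R * seq (seq R) :=
  let L := [seq aff (gd p) c | c <- comps v] in
  ([seq (l.1 *m gmu p) 0 0 + l.2 | l <- L],
   [seq [seq (l.1 *m gSig p *m l'.1^T) 0 0 | l' <- L] | l <- L]).

Inductive ctx :=
| Hole
| CPlusL of ctx & term | CPlusR of term & ctx
| CScale of R & ctx
| CPairL of ctx & term | CPairR of term & ctx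
| CLet1 of nat & ctx & term | CLet2 of nat & term & ctx
| CLetP1 of nat & nat & ctx & term | CLetP2 of nat & nat & term & ctx
| CCondL of ctx & term | CCondR of term & ctx.

Fixpoint plug (K : ctx) (e : term) : term :=
  match K with
  | Hole => e
  | CPlusL K a => Plus (plug K e) a
  | CPlusR a K => Plus a (plug K e)
  | CScale c K => Scale c (plug K e)
  | CPairL K a => Pair (plug K e) a
  | CPairR a K => Pair a (plug K e)
  | CLet1 x K a => Let x (plug K e) a
  | CLet2 x a K => Let x a (plug K e)
  | CLetP1 x y K a => LetP x y (plug K e) a
  | CLetP2 x y a K => LetP x y a (plug K e)
  | CCondL K a => CondE (plug K e) a
  | CCondR a K => CondE a (plug K e)
  end.

Definition ctx_typed (K : ctx) (G : tctx) (t t' : ty) :=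
  forall e, has_type G e t -> has_type [::] (plug K e) t'.

Definition ctx_equiv (G : tctx) (t : ty) (e1 e2 : term) :=
  forall (K : ctx) (t' : ty), ctx_typed K G t t' ->
    (fails (plug K e1) <-> fails (plug K e2)) /\
    (forall v1 p1 v2 p2, runs (plug K e1) v1 p1 -> runs (plug K e2) v2 p2 ->
       pushforward v1 p1 = pushforward v2 p2).

Record gmor (m n : nat) := GMor { gA : 'M[R]_(n, m); gb : 'cV[R]_n; gS : 'M[R]_n }.

Definition gcomp m n p (g : gmor n p) (f : gmor m n) : gmor m p :=
  GMor (gA g *m gA f) (gA g *m gb f + gb g) (gA g *m gS f *m (gA g)^T + gS g).

Definition gtens m1 n1 m2 n2 (f : gmor m1 n1) (g : gmor m2 n2) : gmor (m1 + m2) (n1 + n2) :=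
  GMor (block_mx (gA f) 0 0 (gA g)) (col_mx (gb f) (gb g)) (block_mx (gS f) 0 0 (gS g)).

Definition gdet m n (M : 'M[R]_(n, m)) : gmor m n := GMor M 0 0.
Definition gid n : gmor n n := gdet (1%:M : 'M[R]_n).
Definition gcopy n : gmor n (n + n) := gdet (col_mx (1%:M : 'M[R]_n) 1%:M).
Definition gcast m n n' (e : n = n') (f : gmor m n) : gmor m n' :=
  GMor (castmx (e, erefl m) (gA f)) (castmx (e, erefl 1%N) (gb f)) (castmx (e, e) (gS f)).
Definition dstate k (o : 'cV[R]_k) : gmor 0 k := GMor 0 o 0.

(* Cond(Gauss): (K, f : X -> Y (x) K, o : I -> K deterministic),
   o represented by the point o in R^K *)
Record cmor (m n : nat) := CMor { ck : nat; cf : gmor m (n + ck); co : 'cV[R]_ck }.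

Definition J m n (f : gmor m n) : cmor m n :=
  @CMor m n 0%N (gcast (esym (addn0 n)) f) 0.

Definition cid n : cmor n n := J (gid n).

Definition ccomp m n p (G : cmor n p) (F : cmor m n) : cmor m p :=
  @CMor m p (ck G + ck F)%N
    (gcast (esym (addnA p (ck G) (ck F))) (gcomp (gtens (cf G) (gid (ck F))) (cf F)))
    (col_mx (co G) (co F)).

(* symmetry (Y1 (x) K1) (x) (Y2 (x) K2) -> (Y1 (x) Y2) (x) (K1 (x) K2) *)
Definition shuffle n1 k1 n2 k2 : 'M[R]_((n1 + n2) + (k1 + k2), (n1 + k1) + (n2 + k2)) :=
  col_mx (block_mx (usubmx (1%:M : 'M[R]_(n1 + k1))) 0 0 (usubmx (1%:M : 'M[R]_(n2 + k2))))
         (block_mx (dsubmx (1%:M : 'M[R]_(n1 + k1))) 0 0 (dsubmx (1%:M : 'M[R]_(n2 + k2)))).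

Definition ctens m1 n1 m2 n2 (F : cmor m1 n1) (G : cmor m2 n2) : cmor (m1 + m2) (n1 + n2) :=
  @CMor (m1 + m2) (n1 + n2) (ck F + ck G)%N
    (gcomp (gdet (shuffle n1 (ck F) n2 (ck G))) (gtens (cf F) (cf G)))
    (col_mx (co F) (co G)).

(* associator (identity in Gauss) *)
Definition ccast m n n' (e : n = n') (F : cmor m n) : cmor m n' :=
  ccomp (J (gcast e (gid n))) F.

Definition cpair m n1 n2 (F : cmor m n1) (G : cmor m n2) : cmor m (n1 + n2) :=
  ccomp (ctens F G) (J (gcopy m)).

Definition ceff : cmor 1 0 := @CMor 1 0 1 (gid 1) 0.

Definition marginalK n k (psi : gmor 0 (n + k)) : gmor 0 k :=
  gcomp (gdet (row_mx (0 : 'M[R]_(k, n)) (1%:M : 'M[R]_k))) psi.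

Definition is_conditional n k (psi : gmor 0 (n + k)) (c : gmor k n) :=
  psd (gS c) /\
  psi = gcomp (gtens c (gid k)) (gcomp (gcopy k) (marginalK psi)).

Definition succeeds n (S : cmor 0 n) :=
  in_support (co S) (gb (marginalK (cf S))) (gS (marginalK (cf S))).

Definition posterior n (S : cmor 0 n) (phi : gmor 0 n) :=
  succeeds S /\
  exists c, is_conditional (cf S) c /\ phi = gcomp c (dstate (co S)).

(* the equivalence relation quotienting Cond(Gauss) *)
Definition cond_equiv m n (F G : cmor m n) :=
  forall (a : nat) (Psi : cmor 0 (a + m)), psd (gS (cf Psi)) ->
    let P1 := ccomp (ctens (cid a) F) Psi in
    let P2 := ccomp (ctens (cid a) G) Psi in
    (succeeds P1 <-> succeeds P2) /\
    (forall phi1 phi2, posterior P1 phi1 -> posterior P2 phi2 -> phi1 = phi2).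

Fixpoint proj (G : tctx) (x : nat) : option {t : ty & 'M[R]_(dimt t, dimc G)} :=
  match G return option {t : ty & 'M[R]_(dimt t, dimc G)} with
  | [::] => None
  | (y, t) :: G' =>
      if x == y then Some (existT _ t (row_mx 0 (1%:M : 'M[R]_(dimt t))))
      else match proj G' x with
           | Some (existT t' M) => Some (existT _ t' (row_mx M 0))
           | None => None
           end
  end.

Definition sub_row : 'M[R]_(1, 1 + 1) := row_mx 1 (-1).
Definition add_row : 'M[R]_(1, 1 + 1) := row_mx 1 1.

Fixpoint den (G : tctx) (e : term) {struct e} : option {t : ty & cmor (dimc G) (dimt t)} :=
  match e with
  | Var x =>
      match proj G x with
      | Some (existT t M) => Some (existT _ t (J (gdet M)))
      | None => None
      end
  | Lat _ => None
  | Plus e1 e2 =>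
      match den G e1, den G e2 with
      | Some (existT TR F1), Some (existT TR F2) =>
          Some (existT _ TR (ccomp (J (gdet add_row)) (cpair F1 F2)))
      | _, _ => None
      end
  | Scale a e1 =>
      match den G e1 with
      | Some (existT TR F1) => Some (existT _ TR (ccomp (J (gdet (a%:M : 'M[R]_1))) F1))
      | _ => None
      end
  | Const b => Some (existT _ TR (J (GMor (0 : 'M[R]_(1, dimc G)) (b%:M) 0)))
  | Pair e1 e2 =>
      match den G e1, den G e2 with
      | Some (existT t1 F1), Some (existT t2 F2) =>
          Some (existT _ (TPair t1 t2) (cpair F1 F2))
      | _, _ => None
      end
  | Unt => Some (existT _ TI (J (GMor (0 : 'M[R]_(0, dimc G)) 0 0)))
  | Let x e1 e2 =>
      match den G e1 with
      | Some (existT t1 F1) =>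
          match den ((x, t1) :: G) e2 with
          | Some (existT t2 F2) =>
              Some (existT _ t2
                (ccomp F2 (ccomp (ctens (cid (dimc G)) F1) (J (gcopy (dimc G))))))
          | None => None
          end
      | None => None
      end
  | LetP x y e1 e2 =>
      match den G e1 with
      | Some (existT (TPair t1 t2) F1) =>
          match den ((y, t2) :: (x, t1) :: G) e2 with
          | Some (existT t3 F2) =>
              Some (existT _ t3
                (ccomp F2 (ccast (addnA (dimc G) (dimt t1) (dimt t2))
                   (ccomp (ctens (cid (dimc G)) F1) (J (gcopy (dimc G)))))))
          | None => None
          end
      | _ => None
      end
  | Normal => Some (existT _ TR (J (GMor (0 : 'M[R]_(1, dimc G)) 0 1%:M)))
  | CondE s t =>
      match den G s, den G t with
      | Some (existT TR F1), Some (existT TR F2) =>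
          Some (existT _ TI (ccomp ceff (ccomp (J (gdet sub_row)) (cpair F1 F2))))
      | _, _ => None
      end
  end.

End Gaussian.

(* Main.v *)
Require Import Defs.
From mathcomp Require Import all_boot all_order all_algebra reals.
From mathcomp Require Import ring lra.

(** Random variables are affine forms in an infinite supply of latent variables,
    encoded as polynomials (the constant coefficient is the constant term, the
    coefficient of ['X^i.+1] that of the latent [z_(i+1)]); a Gaussian law is a mean
    functional and a covariance form on them.  Conditioning on a list of variables
    being zero depends only on their span: it succeeds iff every variable of the span
    with zero variance has zero mean, and it replaces each variable by the residual of
    its projection onto the span.  Hence conditioning step by step, as programs do,
    agrees with conditioning once on the joint observation, as in Cond(Gauss).

    A program can therefore be evaluated without conditioning, collecting the observed
    variables.  Its value and observations are the affine map of its denotation applied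
    to the environment, plus a linear map of fresh latents realizing the noise
    covariance.  If the denotations of two terms are equal, then the terms send
    environments with equal joint laws (together with any frame) to failure or to
    results with equal joint laws, and this relation is a congruence.  Conversely, an
    inference problem with prior [Psi] is posed by a context which samples [Psi] through
    a Cholesky factor of its covariance, performs its observations, binds the variables
    of [G] and returns the frame paired with the hole. *)

Set Implicit Arguments. Unset Strict Implicit. Unset Printing Implicit Defensive.
Import Order.TTheory GRing.Theory Num.Theory.
Local Open Scope ring_scope.

(** * Gaussian laws and conditioning *)

Section Laws.
Variable R : realType.
Local Notation V := {poly R}.

(** Covariances may be singular, and then neither the projection onto the observed span nor the
    conditional in the definition of a posterior is unique. Consistency removes the ambiguity: two
    choices differ by a variable of the span with zero variance, which has zero mean by consistency
    and zero covariance with everything by Cauchy-Schwarz. Another obstacle is that equal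
    denotations may come with different numbers of latents and different factors of the same noise
    covariance. So only laws can be compared across two runs, never the variables themselves. The
    frame in this comparison plays the part of [A] in [cond_equiv]: it keeps an intermediate result
    correlated with the environment that is still in use. Finally, [ctx_typed] does not determine
    the type at which a context binds a variable that [G] declares at [TI], so a value found at type
    [TI] need not be the unit. Typed values are therefore parametrised by the demand made at [TI]:
    being the unit for reduction, nothing for equivalence. *)

Record law := Law {
  lm : V -> R;
  lc : V -> V -> R;
  lm_lin : forall a x y, lm (a *: x + y) = a * lm x + lm y;
  lm1 : lm 1 = 1;
  lc_lin : forall a x y z, lc (a *: x + y) z = a * lc x z + lc y z;
  lcC : forall x y, lc x y = lc y x;
  lc_ge0 : forall x, 0 <= lc x x;
  lc1 : forall x, lc 1 x = 0 }.

Implicit Types (l : law) (x y z k : V) (ks : seq V) (S : V -> Prop).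

Lemma lmD l x y : lm l (x + y) = lm l x + lm l y.
Proof. by rewrite -[x in LHS]scale1r lm_lin mul1r. Qed.
Lemma lm0 l : lm l 0 = 0.
Proof. by apply: (@addrI _ (lm l 0)); rewrite -lmD !addr0. Qed.
Lemma lmZ l a x : lm l (a *: x) = a * lm l x.
Proof. by rewrite -[_ *: _]addr0 lm_lin lm0 addr0. Qed.
Lemma lmB l x y : lm l (x - y) = lm l x - lm l y.
Proof. by rewrite lmD -scaleN1r lmZ mulN1r. Qed.
Lemma lmC l a : lm l a%:P = a.
Proof. by rewrite -[a%:P]mulr1 mul_polyC lmZ lm1 mulr1. Qed.
Lemma lm_sum l (I : Type) (r : seq I) (P : pred I) (F : I -> V) :
  lm l (\sum_(i <- r | P i) F i) = \sum_(i <- r | P i) lm l (F i).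
Proof. by apply: (big_morph (lm l) (lmD l) (lm0 l)). Qed.

Lemma lcDl l x y z : lc l (x + y) z = lc l x z + lc l y z.
Proof. by rewrite -[x in LHS]scale1r lc_lin mul1r. Qed.
Lemma lc0l l z : lc l 0 z = 0.
Proof. by apply: (@addrI _ (lc l 0 z)); rewrite -lcDl !addr0. Qed.
Lemma lcZl l a x z : lc l (a *: x) z = a * lc l x z.
Proof. by rewrite -[_ *: _]addr0 lc_lin lc0l addr0. Qed.
Lemma lcBl l x y z : lc l (x - y) z = lc l x z - lc l y z.
Proof. by rewrite lcDl -scaleN1r lcZl mulN1r. Qed.
Lemma lcDr l x y z : lc l z (x + y) = lc l z x + lc l z y.
Proof. by rewrite lcC lcDl !(lcC _ z). Qed.
Lemma lc0r l z : lc l z 0 = 0.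
Proof. by rewrite lcC lc0l. Qed.
Lemma lcZr l a x z : lc l z (a *: x) = a * lc l z x.
Proof. by rewrite lcC lcZl lcC. Qed.
Lemma lcBr l x y z : lc l z (x - y) = lc l z x - lc l z y.
Proof. by rewrite lcC lcBl !(lcC _ z). Qed.
Lemma lcCl l a z : lc l a%:P z = 0.
Proof. by rewrite -[a%:P]mulr1 mul_polyC lcZl lc1 mulr0. Qed.
Lemma lcCr l a z : lc l z a%:P = 0.
Proof. by rewrite lcC lcCl. Qed.
Lemma lc_suml l (I : Type) (r : seq I) (P : pred I) (F : I -> V) z :
  lc l (\sum_(i <- r | P i) F i) z = \sum_(i <- r | P i) lc l (F i) z.
Proof. by apply: (big_morph (lc l ^~ z)); [move=> x y; rewrite lcDl | rewrite lc0l]. Qed.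
(** Degenerate Cauchy-Schwarz: the variance of [y + t *: x] is affine in [t] and never negative, so
    its slope vanishes. *)
Lemma lc_null l x : lc l x x = 0 -> forall y, lc l x y = 0.
Proof.
move=> x0 y; apply/eqP; apply/negPn/negP => nz.
have q t : 0 <= lc l y y + t * lc l x y *+ 2.
  have := lc_ge0 l (y + t *: x).
  by rewrite lcDl !lcDr !lcZl !lcZr x0 (lcC _ y x); lra.
(* This value of [t] would make the variance equal to -1. *)
have := q (- (lc l y y + 1) / (lc l x y *+ 2)).
have -> : - (lc l y y + 1) / (lc l x y *+ 2) * lc l x y *+ 2 = - (lc l y y + 1).
  by field; rewrite nz.
by lra.
Qed.

(** The Gaussian conditioning formulas for the event [k = 0]; an observed value other than 0 sits in
    the constant term of [k]. *)
Definition clm l k x := lm l x - lm l k * lc l x k / lc l k k.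
Definition clc l k x y := lc l x y - lc l x k * lc l y k / lc l k k.

Lemma clc_ge0 l k x : 0 <= clc l k x x.
Proof.
rewrite /clc; have [k0|k0] := eqVneq (lc l k k) 0.
  by rewrite k0 invr0 mulr0 subr0 lc_ge0.
(* The conditioned variance is the variance of the residual of [x] after regression on [k]. *)
have := lc_ge0 l (x - (lc l x k / lc l k k) *: k).
rewrite !(lcBl, lcBr, lcZl, lcZr) (lcC _ k x).
by congr (0 <= _); field.
Qed.

(* When [lc l k k = 0], division by zero makes [lcond l k] agree with [l]. *)
Definition lcond l k : law.
refine (@Law (clm l k) (clc l k) _ _ _ _ (clc_ge0 l k) _).
- by move=> a x y; rewrite /clm lm_lin lc_lin; ring.
- by rewrite /clm lc1 lm1 mulr0 mul0r subr0.
- by move=> a x y z; rewrite /clc !lc_lin; ring.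
- by move=> x y; rewrite /clc (lcC _ x y); ring.
- by move=> x; rewrite /clc !lc1 !mul0r subr0.
Defined.

(** Zero variance with nonzero mean says that [k] is almost surely a nonzero constant, the only way
    in which a single observation is unsatisfiable. *)
Definition lcond1 l k : option law :=
  if (lc l k k == 0) && (lm l k != 0) then None else Some (lcond l k).

Fixpoint condl l ks : option law :=
  if ks is k :: ks' then
    if lcond1 l k is Some l' then condl l' ks' else None
  else Some l.

Lemma condl_cat l ks1 ks2 :
  condl l (ks1 ++ ks2) = if condl l ks1 is Some l' then condl l' ks2 else None.
Proof. by elim: ks1 l => //= k ks1 IH l; case: (lcond1 l k). Qed.

(** The recursion removes the head of the list just as [condl] does, so both unfold together. *)
Fixpoint lspan ks x : Prop :=
  if ks is k :: ks' then exists a, lspan ks' (x - a *: k) else x = 0.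

Lemma lspan0 ks : lspan ks 0.
Proof. by elim: ks => //= k ks IH; exists 0; rewrite scale0r subr0. Qed.
Lemma lspanD ks x y : lspan ks x -> lspan ks y -> lspan ks (x + y).
Proof.
elim: ks x y => /= [x y -> ->|k ks IH x y [a xa] [b yb]]; first by rewrite addr0.
by exists (a + b); rewrite scalerDl opprD addrACA; apply: IH.
Qed.
Lemma lspanZ ks c x : lspan ks x -> lspan ks (c *: x).
Proof.
elim: ks x => /= [x ->|k ks IH x [a xa]]; first by rewrite scaler0.
by exists (c * a); rewrite -scalerA -scalerBr; apply: IH.
Qed.
Lemma lspanB ks x y : lspan ks x -> lspan ks y -> lspan ks (x - y).
Proof. by move=> sx sy; rewrite -scaleN1r; apply/lspanD/lspanZ. Qed.
Lemma mem_lspan ks x : x \in ks -> lspan ks x.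
Proof.
elim: ks => //= k ks IH; rewrite inE => /orP[/eqP->|/IH xs].
  by exists 1; rewrite scale1r subrr; apply: lspan0.
by exists 0; rewrite scale0r subr0.
Qed.
Lemma lspan_min ks (S : V -> Prop) : S 0 -> (forall x y, S x -> S y -> S (x + y)) ->
  (forall a x, S x -> S (a *: x)) -> {in ks, forall k, S k} ->
  forall x, lspan ks x -> S x.
Proof.
move=> S0 SD SZ; elim: ks => /= [_ x -> //|k ks IH Sk x [a xa]].
rewrite -[x](subrK (a *: k)); apply: SD; last first.
  by apply/SZ/Sk; rewrite inE eqxx.
by apply: IH => // y yks; apply: Sk; rewrite inE yks orbT.
Qed.
Lemma lspan_sub ks ks' : {subset ks <= ks'} -> forall x, lspan ks x -> lspan ks' x.
Proof.
move=> sub; apply: lspan_min; [exact: lspan0 | exact: lspanD | exact: lspanZ |].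
by move=> k /sub /mem_lspan.
Qed.

(** Support membership in dual form: a Gaussian vector can vanish iff each of its linear
    combinations that is almost surely constant is zero. *)
Definition consistent l S := forall s, S s -> lc l s s = 0 -> lm l s = 0.
(* [l'] is [l] conditioned on the subspace [S] being zero: the posterior of [x]
   is the law of the residual of its orthogonal projection onto [S]. *)
Definition is_cond l S l' := forall x, exists p,
  [/\ S p, forall s, S s -> lc l (x - p) s = 0, lm l' x = lm l (x - p) &
      forall y, lc l' x y = lc l (x - p) y].

(** Independence of the chosen projection: the difference of two projections lies in the span and is
    orthogonal to it, hence to itself, so it has zero variance and, by consistency, zero mean. *)
Lemma is_cond_proj l ks l' x p : consistent l (lspan ks) -> is_cond l (lspan ks) l' ->
  lspan ks p -> (forall s, lspan ks s -> lc l (x - p) s = 0) ->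
  lm l' x = lm l (x - p) /\ forall y, lc l' x y = lc l (x - p) y.
Proof.
move=> cons cnd sp op; have [q [sq oq -> qc]] := cnd x.
have sd : lspan ks (p - q) by apply: lspanB.
have dE : p - q = (x - q) - (x - p) by rewrite opprB [RHS]addrC addrA subrK.
have d0 : lc l (p - q) (p - q) = 0 by rewrite {1}dE lcBl oq // op // subr0.
have e : x - q = (x - p) + (p - q) by rewrite addrA subrK.
split; first by rewrite e lmD (cons _ sd d0) addr0.
by move=> y; rewrite qc e lcDl (lc_null d0) addr0.
Qed.

(** One Gram-Schmidt step: under [lcond l k] each variable behaves as its residual [x - p x], and
    [k] itself becomes negligible, so the span of [ks] there carries the same information as the
    span of [k :: ks] before. *)
Lemma lcond1P l k ks :
  if lcond1 l k is Some l' then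
    (consistent l (lspan (k :: ks)) <-> consistent l' (lspan ks)) /\
    forall l2, is_cond l' (lspan ks) l2 -> is_cond l (lspan (k :: ks)) l2
  else ~ consistent l (lspan (k :: ks)).
Proof.
rewrite /lcond1; case: ifP => [/andP[/eqP k0 /eqP mk] cons|H].
  by apply: mk; apply: cons => //; apply: mem_lspan; rewrite inE eqxx.
set l' := lcond l k; pose p x := (lc l x k / lc l k k) *: k.
have lmk : lc l k k = 0 -> lm l k = 0.
  by move=> k0; move: H; rewrite k0 eqxx /= => /negbFE /eqP.
have kp x : lc l (x - p x) k = 0.
  rewrite /p lcBl lcZl; have [k0|k0] := eqVneq (lc l k k) 0.
    by rewrite k0 lcC (lc_null k0) mulr0 subr0.
  by field.
have c'E x y : lc l' x y = lc l (x - p x) y.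
  by rewrite /l' /= /clc /p lcBl lcZl (lcC _ k y); ring.
have c'E2 x y : lc l' x y = lc l (x - p x) (y - p y).
  by rewrite c'E lcBr [lc l (x - p x) (p y)]lcZr kp mulr0 subr0.
have m'E x : lm l' x = lm l (x - p x).
  by rewrite /l' /= /clm /p lmB lmZ; ring.
have pD x y : p (x + y) = p x + p y by rewrite /p lcDl mulrDl scalerDl.
have pZ a x : p (a *: x) = a *: p x by rewrite /p lcZl -mulrA scalerA.
have k'0 x : lc l' k x = 0.
  by rewrite lcC c'E kp.
have mk'0 : lm l' k = 0.
  rewrite m'E /p; have [k0|k0] := eqVneq (lc l k k) 0.
    by rewrite lmB lmZ lmk // mulr0 subr0.
  by rewrite divff // scale1r subrr lm0.
split.
  split=> cons s.
    move=> ss s0; rewrite m'E; apply: cons; last by rewrite -c'E2.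
    by exists (- (lc l s k / lc l k k)); rewrite /p scaleNr opprK subrK.
  move=> /= [a]; set t := s - _ => st s0.
  have sE : s = t + a *: k by rewrite /t subrK.
  have sk : lc l s k = 0 by rewrite (lc_null s0).
  have ps : p s = 0 by rewrite /p sk mul0r scale0r.
  have ms : lm l s = lm l' s by rewrite m'E ps subr0.
  have cs : lc l' s s = 0 by rewrite c'E ps subr0.
  rewrite ms sE lmD lmZ mk'0 mulr0 addr0; apply: cons => //.
  by rewrite /t lcBl lcZl k'0 mulr0 subr0 lcBr lcZr (lcC _ s k) k'0 mulr0 subr0 cs.
move=> l2 c2 x; have [q [sq oq mq cq]] := c2 x.
(* Projection onto [ks] in the conditioned law, followed by the projection of the remainder onto
   [k]. *)
pose Q := q + p (x - q).
have e : x - Q = (x - q) - p (x - q) by rewrite /Q opprD addrA.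
exists Q; split.
- by exists (lc l (x - q) k / lc l k k); rewrite /Q addrK.
- move=> s [a sa]; rewrite e -c'E -(subrK (a *: k) s) lcDr oq // lcZr lcC k'0.
  by rewrite mulr0 addr0.
- by rewrite e mq m'E.
- by move=> y; rewrite e cq c'E.
Qed.

Lemma condlP l ks :
  if condl l ks is Some l' then
    consistent l (lspan ks) /\ is_cond l (lspan ks) l'
  else ~ consistent l (lspan ks).
Proof.
elim: ks l => [l /=|k ks IH l].
  split=> [s -> _|x]; first exact: lm0.
  by exists 0; rewrite subr0; split=> // s ->; rewrite lc0r.
have /= := lcond1P l k ks; case: (lcond1 l k) => // l' [E S].
have := IH l'; case: (condl l' ks) => [l2 [c s]|nc].
  by split; [apply/E | apply: S].
by move/E.
Qed.

End Laws.

(** * Gaussian vectors and inference problems *)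

Section ColSeq.
Variable T : pzRingType.

(** Forgetting the dimension makes reassociations and [castmx] invisible, so that equalities of
    vectors reduce to [catA]. *)
Definition colseq n (U : 'cV[T]_n) : seq T := [seq U i 0 | i <- enum 'I_n].

Lemma size_colseq n (U : 'cV[T]_n) : size (colseq U) = n.
Proof. by rewrite size_map size_enum_ord. Qed.

Lemma nth_colseq n (U : 'cV[T]_n) (i : 'I_n) : nth 0 (colseq U) i = U i 0.
Proof. by rewrite (nth_map i) ?size_enum_ord // nth_ord_enum. Qed.

Lemma colseq_col_mx m n (U : 'cV[T]_m) (W : 'cV[T]_n) :
  colseq (col_mx U W) = colseq U ++ colseq W.
Proof.
apply: (@eq_from_nth _ 0) => [|i]; first by rewrite size_cat !size_colseq.
rewrite size_colseq => lti; rewrite (nth_colseq _ (Ordinal lti)) nth_cat size_colseq.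
rewrite mxE; case: split_ordP => j /(congr1 (@nat_of_ord _)) /= ->.
  by rewrite ltn_ord nth_colseq.
by rewrite ltnNge leq_addr /= addKn nth_colseq.
Qed.

Lemma colseq0 (U : 'cV[T]_0) : colseq U = [::].
Proof. by apply: size0nil; rewrite size_colseq. Qed.

Lemma colseq1 (U : 'cV[T]_1) : colseq U = [:: U 0 0].
Proof. by rewrite /colseq enum_ordSl (size0nil (size_enum_ord 0)) /=; congr [:: U _ _]; apply/val_inj. Qed.

Lemma colseq_cast m n (e : m = n) (U : 'cV[T]_m) : colseq (castmx (e, erefl) U) = colseq U.
Proof. by case: n / e; rewrite castmx_id. Qed.

Lemma colseqP n (U W : 'cV[T]_n) : colseq U = colseq W -> U = W.
Proof. by move=> e; apply/colP => i; rewrite -!nth_colseq e. Qed.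

Lemma mem_colseq n (U : 'cV[T]_n) i : U i 0 \in colseq U.
Proof. by apply: map_f; rewrite mem_enum. Qed.

Lemma colseq_inP n (U : 'cV[T]_n) x : x \in colseq U -> exists i, x = U i 0.
Proof. by case/mapP => i _ ->; exists i. Qed.

End ColSeq.

Section GaussianVectors.
Variable R : realType.
Local Notation V := {poly R}.
Local Notation pm := (map_mx (@polyC R)).
Implicit Types l : law R.

Lemma pmM m n p (A : 'M[R]_(m, n)) (B : 'M[R]_(n, p)) : pm (A *m B) = pm A *m pm B.
Proof. exact: map_mxM. Qed.
Lemma pmD m n (A B : 'M[R]_(m, n)) : pm (A + B) = pm A + pm B.
Proof. exact: map_mxD. Qed.
Lemma pm0 m n : pm (0 : 'M[R]_(m, n)) = 0.
Proof. exact: map_mx0. Qed.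
Lemma pm1 n : pm (1%:M : 'M[R]_n) = 1%:M.
Proof. exact: map_mx1. Qed.

Definition Mm l n (U : 'cV[V]_n) : 'cV[R]_n := map_mx (lm l) U.
Definition Cm l n k (U : 'cV[V]_n) (W : 'cV[V]_k) : 'M[R]_(n, k) :=
  \matrix_(i, j) lc l (U i 0) (W j 0).

Lemma MmD l n (U W : 'cV[V]_n) : Mm l (U + W) = Mm l U + Mm l W.
Proof. by apply/colP => i; rewrite !mxE lmD. Qed.
Lemma MmB l n (U W : 'cV[V]_n) : Mm l (U - W) = Mm l U - Mm l W.
Proof. by apply/colP => i; rewrite !mxE lmB. Qed.
Lemma MmC l n (b : 'cV[R]_n) : Mm l (pm b) = b.
Proof. by apply/colP => i; rewrite !mxE lmC. Qed.
Lemma Mm_mul l n k (A : 'M[R]_(n, k)) (U : 'cV[V]_k) : Mm l (pm A *m U) = A *m Mm l U.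
Proof.
apply/colP => i; rewrite !mxE lm_sum; apply: eq_bigr => j _.
by rewrite !mxE mul_polyC lmZ.
Qed.
Lemma Mm_col l n k (U : 'cV[V]_n) (W : 'cV[V]_k) :
  Mm l (col_mx U W) = col_mx (Mm l U) (Mm l W).
Proof. by rewrite /Mm map_col_mx. Qed.

Lemma Cm_tr l n k (U : 'cV[V]_n) (W : 'cV[V]_k) : (Cm l U W)^T = Cm l W U.
Proof. by apply/matrixP => i j; rewrite !mxE lcC. Qed.
Lemma CmDl l n k (U U' : 'cV[V]_n) (W : 'cV[V]_k) :
  Cm l (U + U') W = Cm l U W + Cm l U' W.
Proof. by apply/matrixP => i j; rewrite !mxE lcDl. Qed.
Lemma CmDr l n k (U U' : 'cV[V]_n) (W : 'cV[V]_k) :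
  Cm l W (U + U') = Cm l W U + Cm l W U'.
Proof. by apply/matrixP => i j; rewrite !mxE lcDr. Qed.
Lemma CmCl l n k (b : 'cV[R]_n) (W : 'cV[V]_k) : Cm l (pm b) W = 0.
Proof. by apply/matrixP => i j; rewrite !mxE lcCl. Qed.
Lemma CmCr l n k (b : 'cV[R]_n) (W : 'cV[V]_k) : Cm l W (pm b) = 0.
Proof. by apply/matrixP => i j; rewrite !mxE lcCr. Qed.
Lemma Cm_mull l n k p (A : 'M[R]_(n, k)) (U : 'cV[V]_k) (W : 'cV[V]_p) :
  Cm l (pm A *m U) W = A *m Cm l U W.
Proof.
apply/matrixP => i j; rewrite !mxE lc_suml; apply: eq_bigr => q _.
by rewrite !mxE mul_polyC lcZl.
Qed.
Lemma Cm_mulr l n k p (A : 'M[R]_(n, k)) (U : 'cV[V]_k) (W : 'cV[V]_p) :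
  Cm l W (pm A *m U) = Cm l W U *m A^T.
Proof. by rewrite -Cm_tr Cm_mull trmx_mul Cm_tr. Qed.
Lemma CmBCl l n k (U : 'cV[V]_n) (b : 'cV[R]_n) (W : 'cV[V]_k) :
  Cm l (U - pm b) W = Cm l U W.
Proof. by apply/matrixP => i j; rewrite !mxE lcBl lcCl subr0. Qed.
Lemma CmBCr l n k (U : 'cV[V]_n) (b : 'cV[R]_n) (W : 'cV[V]_k) :
  Cm l W (U - pm b) = Cm l W U.
Proof. by rewrite -Cm_tr CmBCl Cm_tr. Qed.
Lemma Cm_col l n1 n2 k1 k2 (U1 : 'cV[V]_n1) (U2 : 'cV[V]_n2) (W1 : 'cV[V]_k1) (W2 : 'cV[V]_k2) :
  Cm l (col_mx U1 U2) (col_mx W1 W2) =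
  block_mx (Cm l U1 W1) (Cm l U1 W2) (Cm l U2 W1) (Cm l U2 W2).
Proof.
apply/matrixP => i j; rewrite !mxE.
by case: split_ordP => i' _; rewrite mxE; case: split_ordP => j' _; rewrite mxE.
Qed.

Lemma Cm_psd l n (U : 'cV[V]_n) : psd (Cm l U U).
Proof.
split=> [|x]; first exact: Cm_tr.
rewrite -[x in _ *m x]trmxK -mulmxA -Cm_mulr -Cm_mull mxE.
exact: lc_ge0.
Qed.

Lemma lspan_colseq n (U : 'cV[V]_n) x :
  lspan (colseq U) x <-> exists w : 'rV[R]_n, x = (pm w *m U) 0 0.
Proof.
split=> [|[w ->]].
  move: x; apply: lspan_min => [|y z [w ->] [w' ->]|a y [w ->]|y /colseq_inP[i ->]].
  - by exists 0; rewrite map_mx0 mul0mx mxE.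
  - by exists (w + w'); rewrite map_mxD mulmxDl [RHS]mxE.
  - by exists (a *: w); rewrite map_mxZ -scalemxAl [RHS]mxE mul_polyC.
  - by exists (delta_mx 0 i); rewrite map_delta_mx -rowE mxE.
rewrite mxE; apply: (big_ind (lspan (colseq U))); [exact: lspan0 | exact: lspanD |].
by move=> i _; rewrite mxE mul_polyC; apply/lspanZ/mem_lspan/mem_colseq.
Qed.

Definition realizes l n (f : gmor R 0 n) (U : 'cV[V]_n) :=
  gb f = Mm l U /\ gS f = Cm l U U.

Lemma gmor0_eq n (f g : gmor R 0 n) : gb f = gb g -> gS f = gS g -> f = g.
Proof.
case: f g => [A b S] [A' b' S'] /= -> ->.
by rewrite [A]thinmx0 [A']thinmx0.
Qed.

Lemma realizes_fun l n (f g : gmor R 0 n) U : realizes l f U -> realizes l g U -> f = g.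
Proof. by move=> [m c] [m' c']; apply: gmor0_eq; rewrite ?m ?m' ?c ?c'. Qed.

(** The noise of [g] becomes explicit: [N *m Z] has covariance [N *m N^T] and, being uncorrelated
    with [U], adds no cross terms. *)
Lemma realizes_comp l m n s (g : gmor R m n) (f : gmor R 0 m) U (N : 'M[R]_(n, s)) (Z : 'cV[V]_s) :
  gS g = N *m N^T -> Mm l Z = 0 -> Cm l Z Z = 1%:M -> Cm l Z U = 0 -> realizes l f U ->
  realizes l (gcomp g f) (pm (gA g) *m U + pm (gb g) + pm N *m Z).
Proof.
move=> SN mZ cZ cZU [mU cU].
have cUZ : Cm l U Z = 0 by rewrite -Cm_tr cZU trmx0.
split=> /=.
  by rewrite !MmD !Mm_mul MmC mZ mulmx0 addr0 mU.
rewrite !(CmDl, CmDr, Cm_mull, Cm_mulr, CmCl, CmCr) cZ cZU cUZ -cU SN mulmxA.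
by rewrite !(mul0mx, mulmx0, addr0, add0r, mul1mx).
Qed.

Lemma realizes_marginalK l n k (f : gmor R 0 (n + k)) Y K :
  realizes l f (col_mx Y K) -> realizes l (marginalK f) K.
Proof.
move=> [m c]; split; rewrite /= addr0 ?m ?c ?Mm_col ?Cm_col.
  by rewrite mul_row_col mul0mx mul1mx add0r.
rewrite tr_row_mx trmx0 trmx1 mul_row_block mul_row_col.
by rewrite !mul0mx !mul1mx !mulmx0 mulmx1 !add0r.
Qed.

(** Block by block comparison of mean and covariance. The off-diagonal block is the normal equation,
    so [gA c] is a regression matrix of [Y] on [K]. *)
Lemma is_conditionalP l n k (f : gmor R 0 (n + k)) Y K (c : gmor R k n) :
  realizes l f (col_mx Y K) ->
  is_conditional f c <->
  [/\ psd (gS c), gA c *m Mm l K + gb c = Mm l Y, gA c *m Cm l K K = Cm l Y K &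
      gA c *m Cm l K K *m (gA c)^T + gS c = Cm l Y Y].
Proof.
move=> rf; have [mK cK] := realizes_marginalK rf; have [mf cf] := rf.
set g := gcomp (gtens c (gid R k)) (gcomp (gcopy R k) (marginalK f)).
have gbE : gb g = col_mx (gA c *m Mm l K + gb c) (Mm l K).
  rewrite /g /gcomp /gtens /gcopy /gdet; cbn [gb gA gS gid gdet].
  rewrite -mK addr0 [col_mx 1%:M _ *m _]mul_col_mx mul1mx mul_block_col !mul0mx mul1mx add0r addr0.
  by rewrite add_col_mx addr0.
have gSE : gS g = block_mx (gA c *m Cm l K K *m (gA c)^T + gS c) (gA c *m Cm l K K)
                           (Cm l K K *m (gA c)^T) (Cm l K K).
  rewrite /g /gcomp /gtens /gcopy /gdet; cbn [gb gA gS gid gdet].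
  rewrite -cK addr0 [col_mx 1%:M _ *m _]mul_col_mx mul1mx tr_col_mx trmx1 mul_col_row !mulmx1.
  rewrite tr_block_mx !trmx0 trmx1 !mulmx_block !mul0mx !mulmx0 !mul1mx !mulmx1.
  by rewrite !addr0 !add0r add_block_mx !addr0.
split=> [[pc fg]|[pc m2 c2 s2]].
  have := mf; rewrite fg -/g gbE Mm_col => /eq_col_mx[mY _].
  have := cf; rewrite fg -/g gSE Cm_col => /eq_block_mx[sY sYK _ _].
  by split.
split=> //; rewrite -/g; apply: gmor0_eq; first by rewrite gbE mf Mm_col m2.
rewrite gSE cf Cm_col.
have -> : Cm l K K *m (gA c)^T = Cm l K Y.
  by rewrite -[RHS]Cm_tr -c2 trmx_mul Cm_tr.
by rewrite s2 c2.
Qed.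

(** The argument of [lc_null] for a matrix, applied to each basis vector [e]: the form at
    [e + t *: w] is affine in [t]. *)
Lemma psd_kernel n (S : 'M[R]_n) (w : 'cV[R]_n) : psd S -> (w^T *m S *m w) 0 0 = 0 -> S *m w = 0.
Proof.
move=> [sS pS] w0; apply/colP => i; rewrite [RHS]mxE.
pose e : 'cV[R]_n := delta_mx i 0.
set s := (S *m w) i 0.
have sE : (e^T *m S *m w) 0 0 = s by rewrite -mulmxA trmx_delta -rowE mxE.
have sE' : (w^T *m S *m e) 0 0 = s.
  have -> : w^T *m S *m e = (e^T *m S *m w)^T by rewrite !trmx_mul trmxK sS mulmxA.
  by rewrite mxE.
apply/eqP/negPn/negP => nz.
set d := (e^T *m S *m e) 0 0.
have q t : 0 <= d + t * s *+ 2.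
  have := pS (e + t *: w).
  have -> : (e + t *: w)^T *m S *m (e + t *: w) =
      e^T *m S *m e + t *: (e^T *m S *m w) + t *: (w^T *m S *m e) + t *: (t *: (w^T *m S *m w)).
    have -> : (e + t *: w)^T = e^T + t *: w^T by rewrite linearD linearZ.
    rewrite !(mulmxDl, mulmxDr) -!scalemxAl -!scalemxAr.
    by rewrite !addrA (addrAC _ (t *: (w^T *m S *m e))).
  have E (a b : 'M[R]_1) : (a + b) 0 0 = a 0 0 + b 0 0 by rewrite mxE.
  have F a (b : 'M[R]_1) : (a *: b) 0 0 = a * b 0 0 by rewrite mxE.
  by rewrite !(E, F) w0 sE sE' -/d; lra.
have := q (- (d + 1) / (s *+ 2)).
have -> : - (d + 1) / (s *+ 2) * s *+ 2 = - (d + 1) by field; rewrite nz.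
by lra.
Qed.

(** * Success and posterior of a single inference problem *)

Section Inference.
Variables (l : law R) (n : nat) (P : cmor R 0 n).
Variables (Y : 'cV[V]_n) (K : 'cV[V]_(ck P)) (ks : seq V).
Hypothesis rP : realizes l (cf P) (col_mx Y K).
Hypothesis ksE : forall x, lspan ks x <-> lspan (colseq (K - pm (co P))) x.

Lemma in_lspanP x : lspan ks x <-> exists w : 'rV[R]_(ck P), x = (pm w *m (K - pm (co P))) 0 0.
Proof. by rewrite ksE lspan_colseq. Qed.

(** Image and kernel of a symmetric matrix are orthogonal complements, and by [psd_kernel] the
    kernel of the covariance of [K] consists of the combinations of zero variance. *)
Lemma succeeds_consistent : succeeds P <-> consistent l (lspan ks).
Proof.
have [mK cK] := realizes_marginalK rP; rewrite /succeeds /in_support mK cK.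
have psdK := Cm_psd l K.
split=> [[w ow] x /in_lspanP[v ->] vv|cons].
  have {vv}v0 : Cm l K K *m v^T = 0.
    apply: psd_kernel => //; rewrite trmxK -mulmxA.
    have : Cm l (pm v *m (K - pm (co P))) (pm v *m (K - pm (co P))) 0 0 = 0 by rewrite mxE.
    by rewrite Cm_mull Cm_mulr CmBCl CmBCr mulmxA.
  have -> : lm l ((pm v *m (K - pm (co P))) 0 0) = (v *m (Mm l K - co P)) 0 0.
    by rewrite -[co P in RHS](MmC l) -MmB -Mm_mul [in RHS]mxE.
  rewrite -opprB ow mulmxN mxE -[v]trmxK -[Cm l K K]trmxK Cm_tr.
  by rewrite mulmxA -trmx_mul v0 trmx0 mul0mx mxE oppr0.
suff sub : ((co P - Mm l K)^T <= Cm l K K)%MS.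
  have [D oD] := submxP sub; exists D^T.
  by rewrite -[LHS]trmxK oD trmx_mul Cm_tr.
(* Membership in the image is tested against the columns of the cokernel, each of which is a
   combination of zero variance. *)
rewrite submxE; apply/eqP/rowP => j; rewrite [RHS]mxE.
set w := col j (cokermx (Cm l K K)).
have Kw : Cm l K K *m w = 0 by rewrite /w colE mulmxA mulmx_coker mul0mx.
have := cons ((pm w^T *m (K - pm (co P))) 0 0).
have -> : lm l ((pm w^T *m (K - pm (co P))) 0 0) = (w^T *m (Mm l K - co P)) 0 0.
  by rewrite -[co P in RHS](MmC l) -MmB -Mm_mul [in RHS]mxE.
have -> : lc l ((pm w^T *m (K - pm (co P))) 0 0) ((pm w^T *m (K - pm (co P))) 0 0) = 0.
  have -> : lc l ((pm w^T *m (K - pm (co P))) 0 0) ((pm w^T *m (K - pm (co P))) 0 0)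
    = Cm l (pm w^T *m (K - pm (co P))) (pm w^T *m (K - pm (co P))) 0 0 by rewrite [RHS]mxE.
  by rewrite Cm_mull Cm_mulr CmBCl CmBCr trmxK Kw mulmx0 mxE.
have -> : ((co P - Mm l K)^T *m cokermx (Cm l K K)) 0 j = - (w^T *m (Mm l K - co P)) 0 0.
  have -> : ((co P - Mm l K)^T *m cokermx (Cm l K K)) 0 j = ((co P - Mm l K)^T *m w) 0 0.
    by rewrite [LHS]mxE [RHS]mxE; apply: eq_bigr => i _; rewrite [w i 0]mxE.
  rewrite -[(_ - _)^T *m w]trmxK trmx_mul trmxK [LHS]mxE -opprB mulmxN.
  by rewrite [LHS]mxE.
by move=> ->; rewrite ?oppr0 //; apply/in_lspanP; exists w^T.
Qed.

Variable l' : law R.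
Hypothesis cl' : is_cond l (lspan ks) l'.

(** By the normal equation, [p] below is an orthogonal projection of [Y] onto the observed span
    whatever the conditional, so [is_cond_proj] applies. In particular the posterior is unique. *)
Lemma posterior_realizes phi : posterior P phi -> realizes l' phi Y.
Proof.
move=> [/succeeds_consistent cons [c [/(is_conditionalP _ rP)[_ mc ac sc] ->]]].
pose p := pm (gA c) *m (K - pm (co P)).
have pj i : lm l' (Y i 0) = lm l (Y i 0 - p i 0) /\
            forall y, lc l' (Y i 0) y = lc l (Y i 0 - p i 0) y.
  apply: (is_cond_proj cons cl').
    apply/in_lspanP; exists (row i (gA c)).
    by rewrite /p map_row -row_mul [RHS]mxE.
  move=> s /in_lspanP[w ->].
  transitivity (Cm l (Y - p) (pm w *m (K - pm (co P))) i 0); first by rewrite !mxE.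
  rewrite Cm_mulr CmBCr.
  have -> : Cm l (Y - p) K = 0.
    have -> : Y - p = Y + pm (- gA c) *m (K - pm (co P)).
      by rewrite /p map_mxN mulNmx.
    by rewrite CmDl Cm_mull CmBCl mulNmx ac subrr.
  by rewrite mul0mx mxE.
split; rewrite /gcomp /=.
  apply/colP => i; rewrite [RHS]mxE (pj i).1.
  transitivity (Mm l (Y - p) i 0); last by rewrite !mxE.
  rewrite MmB Mm_mul MmB MmC mulmxBr -mc; congr (fun_of_matrix _ i 0).
  by rewrite opprB [RHS]addrC addrA subrK.
rewrite mulmx0 mul0mx add0r; apply/matrixP => i j; rewrite [RHS]mxE (pj i).2.
transitivity (Cm l (Y - p) Y i j); last by rewrite !mxE.
have -> : Y - p = Y + pm (- gA c) *m (K - pm (co P)).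
  by rewrite /p map_mxN mulNmx.
rewrite CmDl Cm_mull CmBCl mulNmx -sc -[Cm l K Y]Cm_tr -ac trmx_mul Cm_tr mulmxA.
by rewrite addrC addKr.
Qed.

(** The projections provided by [is_cond] have coefficients, and these are the rows of a regression
    matrix. *)
Lemma posterior_exists : consistent l (lspan ks) -> exists phi, posterior P phi.
Proof.
move=> cons.
have ex (i : 'I_n) : exists w : 'rV[R]_(ck P),
    (forall s, lspan ks s -> lc l (Y i 0 - (pm w *m (K - pm (co P))) 0 0) s = 0) /\
    forall y, lc l' (Y i 0) y = lc l (Y i 0 - (pm w *m (K - pm (co P))) 0 0) y.
  by have [p [/in_lspanP[w ->] o _ c]] := cl' (Y i 0); exists w.
have [w wP] := fin_all_exists ex.
pose A : 'M[R]_(n, ck P) := \matrix_i w i.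
have AE i : (pm (w i) *m (K - pm (co P))) 0 0 = (pm A *m (K - pm (co P))) i 0.
  rewrite -[in LHS](rowK w i) map_row -row_mul [LHS]mxE.
  by [].
have orth : Cm l Y K = A *m Cm l K K.
  apply/eqP; rewrite -subr_eq0; apply/eqP/matrixP => i j; rewrite [RHS]mxE.
  have := (wP i).1 ((K - pm (co P)) j 0); rewrite AE => <-; last first.
    by apply/ksE/mem_lspan/mem_colseq.
  transitivity (Cm l (Y + pm (- A) *m (K - pm (co P))) (K - pm (co P)) i j).
    by rewrite CmDl Cm_mull CmBCl !CmBCr mulNmx.
  by rewrite map_mxN mulNmx !mxE.
(* The offset restores the mean of [Y], and the noise is the residual covariance, which is that of
   [l']. *)
pose c := GMor A (Mm l Y - A *m Mm l K) (Cm l' Y Y).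
exists (gcomp c (dstate (co P))); split; first exact/succeeds_consistent.
exists c; split=> //; apply/(is_conditionalP _ rP); split=> /=.
- exact: Cm_psd.
- by rewrite addrC subrK.
- by rewrite orth.
apply/matrixP => i j; rewrite mxE [Cm l' Y Y i j]mxE (wP i).2 AE.
have -> : lc l (Y i 0 - (pm A *m (K - pm (co P))) i 0) (Y j 0) =
  Cm l (Y + pm (- A) *m (K - pm (co P))) Y i j.
  by rewrite map_mxN mulNmx !mxE.
rewrite CmDl Cm_mull CmBCl mulNmx -orth -[Cm l K Y]Cm_tr.
rewrite [in (Cm l Y K)^T]orth trmx_mul Cm_tr mulmxA -orth.
by rewrite [(Cm l Y Y - _) i j]mxE [(- (_ *m _)) i j]mxE addrC subrK.
Qed.

End Inference.
End GaussianVectors.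

(** * Morphisms of Cond(Gauss) as symbolic affine maps *)

Section Symbolic.
Variable R : realType.
Local Notation V := {poly R}.
Local Notation pm := (map_mx (@polyC R)).

Definition lats r s : 'cV[V]_s := \col_i 'X^((r + i).+1).

Lemma lats_cat r s1 s2 : lats r (s1 + s2) = col_mx (lats r s1) (lats (r + s1) s2).
Proof.
apply/colP => i; rewrite !mxE; case: split_ordP => j ->; rewrite mxE //=.
by rewrite addnA.
Qed.

Definition gapp m n s (f : gmor R m n) (N : 'M[R]_(n, s)) (X : 'cV[V]_m) (Z : 'cV[V]_s) :=
  pm (gA f) *m X + pm (gb f) + pm N *m Z.

Lemma gapp_cast m n n' s (e : n = n') (f : gmor R m n) (N : 'M_(n, s)) X Z :
  gapp (gcast e f) (castmx (e, erefl) N) X Z = castmx (e, erefl) (gapp f N X Z).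
Proof. by case: n' / e; rewrite /gapp /gcast /= !castmx_id. Qed.

Lemma gS_cast m n n' s (e : n = n') (f : gmor R m n) (N : 'M_(n, s)) :
  gS f = N *m N^T -> gS (gcast e f) = castmx (e, erefl) N *m (castmx (e, erefl) N)^T.
Proof. by case: n' / e; rewrite /gcast /= !castmx_id. Qed.

(* [F] applied to [X], with fresh latents [r, ..., r + s - 1] as its noise, yields the
   output [Y], and its observations hold iff the random variables [ks] vanish. *)
Definition creal m n (F : cmor R m n) r s (X : 'cV[V]_m) (Y : 'cV[V]_n) (ks : seq V) :=
  exists N K, [/\ gS (cf F) = N *m N^T, gapp (cf F) N X (lats r s) = col_mx Y K &
                  perm_eq ks (colseq (K - pm (co F)))].

(** Composition lists the observations of the later morphism first, evaluation those of the earlier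
    one; hence the permutation in [creal]. The two blocks of latents are consecutive. *)
Lemma creal_comp m n p (F : cmor R m n) (G : cmor R n p) r r1 s1 s2 X Y W k1 k2 :
  r1 = (r + s1)%N ->
  creal F r s1 X Y k1 -> creal G r1 s2 Y W k2 ->
  creal (ccomp G F) r (s1 + s2) X W (k1 ++ k2).
Proof.
move=> -> [N1 [K1 [S1 a1 p1]]] [N2 [K2 [S2 a2 p2]]].
set B := block_mx (gA (cf G)) 0 0 (1%:M : 'M[R]_(ck F)).
pose N := row_mx (B *m N1) (col_mx N2 0).
exists (castmx (esym (addnA p (ck G) (ck F)), erefl) N), (col_mx K2 K1); split.
- apply: gS_cast => /=; rewrite -/B /N tr_row_mx mul_row_col trmx_mul S1 !mulmxA.
  by rewrite S2 [(col_mx N2 0)^T]tr_col_mx trmx0 mul_col_row !(mul0mx, mulmx0).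
- rewrite gapp_cast; apply: colseqP; rewrite colseq_cast !colseq_col_mx catA.
  rewrite -!colseq_col_mx; congr colseq.
  rewrite /gapp /= -/B /N lats_cat map_row_mx mul_row_col !pmM pmD pmM ?mulmxDl.
  rewrite [pm (col_mx N2 0)]map_col_mx [pm (col_mx (gb _) 0)]map_col_mx.
  rewrite [col_mx (pm N2) _ *m _]mul_col_mx !pm0 mul0mx.
  have -> : pm B *m pm (gA (cf F)) *m X + (pm B *m pm (gb (cf F)) + col_mx (pm (gb (cf G))) 0)
     + (pm B *m pm N1 *m lats r s1 + col_mx (pm N2 *m lats (r + s1) s2) 0) =
     pm B *m gapp (cf F) N1 X (lats r s1) +
     col_mx (pm (gb (cf G)) + pm N2 *m lats (r + s1) s2) 0.
    rewrite /gapp !mulmxDr -!mulmxA -[in RHS](addr0 0) -add_col_mx !addrA; congr (_ + _).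
    by rewrite -!addrA; congr (_ + (_ + _)); rewrite addrC.
  rewrite a1 /B map_block_mx pm1 !pm0 mul_block_col !mul0mx mul1mx add0r addr0.
  by rewrite add_col_mx addr0 addrA -/(gapp _ _ _ _) a2.
- rewrite /= map_col_mx opp_col_mx add_col_mx colseq_col_mx perm_catC.
  exact: perm_cat.
Qed.

Lemma shuffleE n1 k1 n2 k2 (a : 'cV[V]_n1) (b : 'cV[V]_k1) (c : 'cV[V]_n2) (d : 'cV[V]_k2) :
  pm (shuffle R n1 k1 n2 k2) *m col_mx (col_mx a b) (col_mx c d) =
  col_mx (col_mx a c) (col_mx b d).
Proof.
rewrite /shuffle map_col_mx !map_block_mx !map_usubmx !map_dsubmx !pm1 !pm0.
rewrite mul_col_mx !mul_block_col !mul0mx !addr0 !add0r.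
by rewrite !mul_usub_mx !mul_dsub_mx !mul1mx !col_mxKu !col_mxKd.
Qed.

Lemma creal_tens m1 n1 m2 n2 (F : cmor R m1 n1) (G : cmor R m2 n2) r r1 s1 s2 X1 X2 Y1 Y2 k1 k2 :
  r1 = (r + s1)%N ->
  creal F r s1 X1 Y1 k1 -> creal G r1 s2 X2 Y2 k2 ->
  creal (ctens F G) r (s1 + s2) (col_mx X1 X2) (col_mx Y1 Y2) (k1 ++ k2).
Proof.
move=> -> [N1 [K1 [S1 a1 p1]]] [N2 [K2 [S2 a2 p2]]].
pose N := block_mx N1 0 0 N2.
exists (shuffle R n1 (ck F) n2 (ck G) *m N), (col_mx K1 K2); split.
- rewrite /= addr0 trmx_mul !mulmxA; congr (_ *m _); rewrite -mulmxA; congr (_ *m _).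
  by rewrite /N tr_block_mx !trmx0 mulmx_block !(mul0mx, mulmx0) addr0 !add0r S1 S2.
- rewrite /gapp /= lats_cat addr0 !pmM -!mulmxA -!mulmxDr -shuffleE; congr (_ *m _).
  rewrite /N !map_block_mx !pm0 !mul_block_col !mul0mx map_col_mx !add_col_mx.
  by rewrite !addr0 !add0r -a1 -a2.
- by rewrite /= map_col_mx opp_col_mx add_col_mx colseq_col_mx perm_cat.
Qed.

Lemma creal_J m n s (f : gmor R m n) (N : 'M_(n, s)) r X :
  gS f = N *m N^T -> creal (J f) r s X (gapp f N X (lats r s)) [::].
Proof.
move=> SN; exists (castmx (esym (addn0 n), erefl) N), 0; split.
- exact: gS_cast.
- rewrite gapp_cast; apply: colseqP.
  by rewrite colseq_cast colseq_col_mx colseq0 cats0.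
- by rewrite colseq0.
Qed.

Lemma creal_det m n (M : 'M[R]_(n, m)) r X : creal (J (gdet M)) r 0 X (pm M *m X) [::].
Proof.
have -> : pm M *m X = gapp (gdet M) (0 : 'M_(n, 0)) X (lats r 0).
  by rewrite /gapp /= !pm0 mul0mx !addr0.
by apply: creal_J; rewrite mul0mx.
Qed.

Lemma creal_id n r (X : 'cV[V]_n) : creal (cid R n) r 0 X X [::].
Proof. by rewrite -[X in creal _ _ _ _ X _]mul1mx -pm1; apply: creal_det. Qed.

Lemma creal_copy n r (X : 'cV[V]_n) : creal (J (gcopy R n)) r 0 X (col_mx X X) [::].
Proof.
have -> : col_mx X X = pm (col_mx 1%:M 1%:M) *m X.
  by rewrite map_col_mx !pm1 mul_col_mx !mul1mx.
exact: creal_det.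
Qed.

Lemma creal_cpair m n1 n2 (F : cmor R m n1) (G : cmor R m n2) r r1 s1 s2 X Y1 Y2 k1 k2 :
  r1 = (r + s1)%N ->
  creal F r s1 X Y1 k1 -> creal G r1 s2 X Y2 k2 ->
  creal (cpair F G) r (s1 + s2) X (col_mx Y1 Y2) (k1 ++ k2).
Proof.
move=> e cF cG; apply: (creal_comp (k1 := [::]) (esym (addn0 r)) (creal_copy r X)).
exact: (creal_tens e cF cG).
Qed.

Lemma creal_ccast m n n' (e : n = n') (F : cmor R m n) r s X Y k :
  creal F r s X Y k -> creal (ccast e F) r s X (castmx (e, erefl) Y) k.
Proof.
move=> cF; rewrite -[s]addn0 -[k]cats0; apply: (creal_comp erefl cF).
case: n' / e; rewrite castmx_id.
have -> : gcast erefl (gid R n) = gid R n by rewrite /gcast /= !castmx_id.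
exact: creal_id.
Qed.

Lemma creal_eff r (X : 'cV[V]_1) : creal (ceff R) r 0 X 0 (colseq X).
Proof.
exists 0, X; split; first by rewrite mul0mx.
  rewrite /gapp /= pm1 mul1mx !pm0 mul0mx !addr0.
  by apply: colseqP; rewrite colseq_col_mx colseq0.
by rewrite pm0 subr0.
Qed.

End Symbolic.

(** * Symbolic evaluation and adequacy *)

Section Symbolic_evaluation.
Variable R : realType.
Local Notation V := {poly R}.
Local Notation pm := (map_mx (@polyC R)).
Local Notation term := (term R).
Implicit Types (e v w : term) (G : tctx) (t : ty) (r s : nat).

(* The random variable denoted by a value: the latent [z_(i+1)] is ['X^i.+1]. *)
Fixpoint paff v : V :=
  match v with
  | Lat i => 'X^(i.+1)
  | Plus a b => paff a + paff b
  | Scale c a => c *: paff a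
  | Const b => b%:P
  | _ => 0
  end.

Fixpoint rval r v : bool :=
  match v with
  | Lat i => (i < r)%N
  | Plus a b => rval r a && rval r b
  | Scale _ a => rval r a
  | Const _ => true
  | _ => false
  end.

(** For a law with [fresh l r] this is independence from the latents still to be drawn; the constant
    coefficient is left free. *)
Definition old r (x : V) := forall i, (r <= i)%N -> x`_(i.+1) = 0.

Lemma oldD r x y : old r x -> old r y -> old r (x + y).
Proof. by move=> ox oy i ri; rewrite coefD ox ?oy ?addr0. Qed.
Lemma oldZ r a x : old r x -> old r (a *: x).
Proof. by move=> ox i ri; rewrite coefZ ox ?mulr0. Qed.
Lemma oldB r x y : old r x -> old r y -> old r (x - y).
Proof. by move=> ox oy; rewrite -scaleN1r; apply/oldD/oldZ. Qed.
Lemma old_le r r' x : (r <= r')%N -> old r x -> old r' x.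
Proof. by move=> le ox i ri; apply: ox; apply: leq_trans ri. Qed.

Lemma paff_old r v : rval r v -> old r (paff v).
Proof.
elim: v => //= [i ir j rj|a IHa b IHb /andP[/IHa oa /IHb]|c a IH /IH|b _ j _].
- by rewrite coefXn eqSS gtn_eqF ?(leq_trans ir rj).
- exact: oldD.
- exact: oldZ.
- by rewrite coefC.
Qed.

Lemma rval_le r r' v : (r <= r')%N -> rval r v -> rval r' v.
Proof.
move=> le; elim: v => //= [i ir|a IHa b IHb /andP[/IHa-> /IHb->]] //.
exact: leq_trans le.
Qed.

Definition pfst v := if v is Pair a _ then a else Unt R.
Definition psnd v := if v is Pair _ b then b else Unt R.

Section Typed_values.
Variable Q : term -> Prop.

(** Pairs are described through the total projections [pfst] and [psnd], which [ev] and [vflat] use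
    as well, so components need not be named. *)
Fixpoint wt r t v : Prop :=
  match t with
  | TR => rval r v
  | TI => Q v
  | TPair a b => v = Pair (pfst v) (psnd v) /\ wt r a (pfst v) /\ wt r b (psnd v)
  end.

Fixpoint wte r G (rho : seq (nat * term)) : Prop :=
  match G, rho with
  | [::], [::] => True
  | (x, t) :: G', (y, v) :: rho' => [/\ x = y, wt r t v & wte r G' rho']
  | _, _ => False
  end.

Lemma wt_le r r' t v : (r <= r')%N -> wt r t v -> wt r' t v.
Proof.
move=> le; elim: t v => //= [v|a IHa b IHb v [-> [/IHa ? /IHb]]] //.
exact: rval_le.
Qed.

Lemma wte_le r r' G rho : (r <= r')%N -> wte r G rho -> wte r' G rho.
Proof.
move=> le; elim: G rho => [|[x t] G IH] [|[y v] rho] //= [-> h /IH].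
by split=> //; apply: wt_le h.
Qed.

End Typed_values.

Fixpoint elook (rho : seq (nat * term)) (x : nat) : term :=
  match rho with
  | [::] => Unt R
  | (y, v) :: rho' => if x == y then v else elook rho' x
  end.

(* Big-step evaluation with [r] latents already in use, collecting the observed
   equations (as random variables that must vanish) instead of conditioning on them.
   Returns the value, the equations in order, and the new number of latents. *)
Fixpoint ev (rho : seq (nat * term)) e r : term * seq V * nat :=
  match e with
  | Var x => (elook rho x, [::], r)
  | Lat i => (Lat R i, [::], r)
  | Const b => (Const b, [::], r)
  | Unt => (Unt R, [::], r)
  | Normal => (Lat R r, [::], r.+1)
  | Scale c a => let: (v, k, r1) := ev rho a r in (Scale c v, k, r1)
  | Plus a b =>
      let: (v, k, r1) := ev rho a r in let: (w, k', r2) := ev rho b r1 in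
      (Plus v w, k ++ k', r2)
  | Pair a b =>
      let: (v, k, r1) := ev rho a r in let: (w, k', r2) := ev rho b r1 in
      (Pair v w, k ++ k', r2)
  | CondE a b =>
      let: (v, k, r1) := ev rho a r in let: (w, k', r2) := ev rho b r1 in
      (Unt R, k ++ k' ++ [:: paff v - paff w], r2)
  | Let x a b =>
      let: (v, k, r1) := ev rho a r in let: (w, k', r2) := ev ((x, v) :: rho) b r1 in
      (w, k ++ k', r2)
  | LetP x y a b =>
      let: (v, k, r1) := ev rho a r in
      let: (w, k', r2) := ev ((y, psnd v) :: (x, pfst v) :: rho) b r1 in
      (w, k ++ k', r2)
  end.

Fixpoint vflat t v : 'cV[V]_(dimt t) :=
  match t return 'cV[V]_(dimt t) with
  | TR => const_mx (paff v)
  | TI => 0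
  | TPair a b => col_mx (vflat a (pfst v)) (vflat b (psnd v))
  end.

(** Recursion on [G] alone, with defaults for a short environment, makes the dimension [dimc G] hold
    by computation. *)
Fixpoint eflat G (rho : seq (nat * term)) : 'cV[V]_(dimc G) :=
  match G return 'cV[V]_(dimc G) with
  | [::] => 0
  | (_, t) :: G' => col_mx (eflat G' (behead rho)) (vflat t (head (0%N, Unt R) rho).2)
  end.

Lemma old_vflat Q r t v : wt Q r t v -> forall i, old r (vflat t v i 0).
Proof.
elim: t v => /= [v rv i|v _ []//|a IHa b IHb v [_ [wa wb]] i].
  by rewrite mxE; apply: paff_old.
by rewrite mxE; case: split => j; [apply: IHa | apply: IHb].
Qed.

Lemma old_eflat Q r G rho : wte Q r G rho -> forall i, old r (eflat G rho i 0).
Proof.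
elim: G rho => [|[x t] G IH] [|[y v] rho] //= => [_ []//|[_ wv wr] i].
rewrite mxE; case: split => j; first exact: IH.
exact: old_vflat wv _.
Qed.

Lemma projP G x t : lookup G x = Some t ->
  exists2 M, proj R G x = Some (existT _ t M) &
    forall Q r rho, wte Q r G rho ->
      pm M *m eflat G rho = vflat t (elook rho x) /\ wt Q r t (elook rho x).
Proof.
elim: G => //= -[y s] G IH; case: (eqVneq x y) => [-> [->]|xy /IH[M -> MP]].
  exists (row_mx 0 1%:M) => // Q r [|[z v] rho] //= [<- wv wr].
  by rewrite eqxx map_row_mx pm0 pm1 mul_row_col mul0mx mul1mx add0r.
exists (row_mx M 0) => // Q r [|[z v] rho] //= [<- wv wr].
rewrite (negPf xy) map_row_mx pm0 mul_row_col mul0mx addr0.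
exact: MP wr.
Qed.

(** Quantifying over [Q] lets one induction serve both demands at type [TI]; [Q (Unt R)] covers the
    units that evaluation itself creates. *)
Definition denotes G e t (F : cmor R (dimc G) (dimt t)) :=
  forall (Q : term -> Prop) rho r, Q (Unt R) -> wte Q r G rho ->
  exists v ks s, [/\ ev rho e r = (v, ks, (r + s)%N), wt Q (r + s) t v,
    forall k, k \in ks -> old (r + s) k &
    creal F r s (eflat G rho) (vflat t v) ks].

(** Evaluation allocates latents from left to right, so each subterm owns a contiguous block and the
    [creal] lemmas mirror the clauses of [den]. *)
Lemma adequacy G e t : has_type G e t ->
  exists2 F, den G e = Some (existT _ t F) & denotes e F.
Proof.
elim=> {G e t}.
- move=> G x t /projP[M e MP]; rewrite /= e.
  eexists; first reflexivity.
  move=> Q rho r QU wr; have [eX wx] := MP Q r rho wr.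
  exists (elook rho x), [::], 0%N; rewrite addn0; split=> //.
  by rewrite -eX; apply: creal_det.
- move=> G e1 e2 _ [F1 d1 IH1] _ [F2 d2 IH2] /=; rewrite d1 d2.
  eexists; first reflexivity.
  move=> Q rho r QU wr /=.
  have [v1 [k1 [s1 [-> w1 o1 c1]]]] := IH1 Q rho r QU wr.
  have [v2 [k2 [s2 [-> w2 o2 c2]]]] := IH2 Q rho (r + s1)%N QU (wte_le (leq_addr _ _) wr).
  exists (Plus v1 v2), (k1 ++ k2), (s1 + s2)%N; rewrite !addnA /=; split=> //.
  + by rewrite (rval_le _ w1) ?leq_addr.
  + move=> k; rewrite mem_cat => /orP[/o1|/o2 //].
    by apply: old_le; rewrite leq_addr.
  + rewrite -[(s1 + s2)%N]addn0 -[k1 ++ k2]cats0.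
    have -> : const_mx (paff v1 + paff v2) =
       pm (add_row R) *m col_mx (const_mx (paff v1)) (const_mx (paff v2)) :> 'cV[V]_1.
      rewrite /add_row map_row_mx mul_row_col !pm1 !mul1mx.
      by apply/colP => i; rewrite !mxE.
    apply: (creal_comp erefl (creal_cpair erefl c1 c2)).
    exact: creal_det.
- move=> G a e _ [F d IH] /=; rewrite d.
  eexists; first reflexivity.
  move=> Q rho r QU wr /=.
  have [v [k [s [-> w o c]]]] := IH Q rho r QU wr.
  exists (Scale a v), k, s; split=> //.
  rewrite -[s]addn0 -[k]cats0 /=.
  have -> : const_mx (a *: paff v) = pm (a%:M) *m const_mx (paff v) :> 'cV[V]_1.
    rewrite map_scalar_mx mul_scalar_mx /=; apply/colP => i.
    by rewrite !mxE mul_polyC.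
  by apply: (creal_comp erefl c); apply: creal_det.
- move=> G b; eexists; first reflexivity.
  move=> Q rho r QU wr; exists (Const b), [::], 0%N; rewrite addn0; split=> //.
  have -> : vflat TR (Const b) = gapp (GMor (0 : 'M[R]_(1, dimc G)) b%:M 0) (0 : 'M_(1, 0)) (eflat G rho) (lats R r 0).
    rewrite /gapp /= !pm0 !mul0mx addr0 add0r map_scalar_mx.
    by apply/colP => i; rewrite !mxE ord1 eqxx mulr1n.
  by apply: creal_J; rewrite mul0mx.
- move=> G e1 e2 t1 t2 _ [F1 d1 IH1] _ [F2 d2 IH2] /=; rewrite d1 d2.
  eexists; first reflexivity.
  move=> Q rho r QU wr /=.
  have [v1 [k1 [s1 [-> w1 o1 c1]]]] := IH1 Q rho r QU wr.
  have [v2 [k2 [s2 [-> w2 o2 c2]]]] := IH2 Q rho (r + s1)%N QU (wte_le (leq_addr _ _) wr).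
  exists (Pair v1 v2), (k1 ++ k2), (s1 + s2)%N; rewrite !addnA /=; split=> //.
  + by split=> //; split=> //; apply: wt_le w1; rewrite leq_addr.
  + move=> k; rewrite mem_cat => /orP[/o1|/o2 //].
    by apply: old_le; rewrite leq_addr.
  + exact: (creal_cpair erefl c1 c2).
- move=> G; eexists; first reflexivity.
  move=> Q rho r QU wr; exists (Unt R), [::], 0%N; rewrite addn0; split=> //.
  have -> : vflat TI (Unt R) = gapp (GMor (0 : 'M[R]_(0, dimc G)) 0 0) (0 : 'M_(0, 0)) (eflat G rho) (lats R r 0).
    by apply/colP => -[].
  by apply: creal_J; rewrite mul0mx.
- move=> G x e1 e2 t1 t2 _ [F1 d1 IH1] _ [F2 d2 IH2] /=; rewrite d1 d2.
  eexists; first reflexivity.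
  move=> Q rho r QU wr /=.
  have [v1 [k1 [s1 [-> w1 o1 c1]]]] := IH1 Q rho r QU wr.
  have wr1 : wte Q (r + s1) ((x, t1) :: G) ((x, v1) :: rho).
    by split=> //; apply: wte_le wr; rewrite leq_addr.
  have [v2 [k2 [s2 [-> w2 o2 c2]]]] := IH2 Q _ (r + s1)%N QU wr1.
  exists v2, (k1 ++ k2), (s1 + s2)%N; rewrite !addnA /=; split=> //.
  + move=> k; rewrite mem_cat => /orP[/o1|/o2 //].
    by apply: old_le; rewrite leq_addr.
  + apply: (creal_comp erefl _ c2).
    (* Copy and identity contribute no latents and no observations; their empty shares are made
       visible to match the composite. *)
    rewrite -[k1]cats0 -[k1 ++ _]cat0s -[s1]add0n -[s1]add0n.
    apply: (creal_comp (k1 := [::]) (esym (addn0 r)) (creal_copy r _)).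
    rewrite cats0 -[k1]cat0s.
    exact: (creal_tens (esym (addn0 r)) (creal_id r _) c1).
- move=> G x y e1 e2 t1 t2 t3 _ [F1 d1 IH1] _ [F2 d2 IH2] /=; rewrite d1 d2.
  eexists; first reflexivity.
  move=> Q rho r QU wr /=.
  have [v1 [k1 [s1 [-> w1 o1 c1]]]] := IH1 Q rho r QU wr.
  case: (w1) => v1E [wa wb].
  have wr1 : wte Q (r + s1) ((y, t2) :: (x, t1) :: G) ((y, psnd v1) :: (x, pfst v1) :: rho).
    by split=> //; split=> //; apply: wte_le wr; rewrite leq_addr.
  have [v2 [k2 [s2 [-> w2 o2 c2]]]] := IH2 Q _ (r + s1)%N QU wr1.
  exists v2, (k1 ++ k2), (s1 + s2)%N; rewrite !addnA /=; split=> //.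
  + move=> k; rewrite mem_cat => /orP[/o1|/o2 //].
    by apply: old_le; rewrite leq_addr.
  + apply: (creal_comp erefl _ c2).
    have -> : eflat ((y, t2) :: (x, t1) :: G) ((y, psnd v1) :: (x, pfst v1) :: rho) =
      castmx (addnA (dimc G) (dimt t1) (dimt t2), erefl) (col_mx (eflat G rho) (vflat (TPair t1 t2) v1)).
      by apply: colseqP; rewrite colseq_cast /= !colseq_col_mx catA.
    apply: creal_ccast.
    rewrite -[k1]cat0s -[s1]add0n.
    apply: (creal_comp (k1 := [::]) (esym (addn0 r)) (creal_copy r _)).
    rewrite -[k1]cat0s.
    exact: (creal_tens (esym (addn0 r)) (creal_id r _) c1).
- move=> G; eexists; first reflexivity.
  move=> Q rho r QU wr; exists (Lat R r), [::], 1%N; rewrite addn1; split=> //=.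
  have -> : const_mx 'X^(r.+1) = gapp (GMor (0 : 'M[R]_(1, dimc G)) 0 1%:M) (1%:M : 'M_(1, 1)) (eflat G rho) (lats R r 1).
    rewrite /gapp /= !pm0 !mul0mx pm1 mul1mx !add0r.
    by apply/colP => i; rewrite !mxE ord1 addn0.
  by apply: creal_J; rewrite mul1mx trmx1.
- move=> G e1 e2 _ [F1 d1 IH1] _ [F2 d2 IH2] /=; rewrite d1 d2.
  eexists; first reflexivity.
  move=> Q rho r QU wr /=.
  have [v1 [k1 [s1 [-> w1 o1 c1]]]] := IH1 Q rho r QU wr.
  have [v2 [k2 [s2 [-> w2 o2 c2]]]] := IH2 Q rho (r + s1)%N QU (wte_le (leq_addr _ _) wr).
  exists (Unt R), (k1 ++ k2 ++ [:: paff v1 - paff v2]), (s1 + s2)%N; rewrite !addnA /=; split=> //.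
  + move=> k; rewrite !mem_cat inE => /or3P[/o1|/o2 //|/eqP->].
      by apply: old_le; rewrite leq_addr.
    apply: oldB; apply: paff_old => //; apply: rval_le w1; exact: leq_addr.
  + rewrite catA -[(s1 + s2)%N]addn0 -[(s1 + s2)%N]addn0 -[k1 ++ k2]cats0.
    have -> : [:: paff v1 - paff v2] =
       colseq (pm (sub_row R) *m col_mx (const_mx (paff v1)) (const_mx (paff v2)) : 'cV[V]_1).
      rewrite colseq1 /sub_row map_row_mx mul_row_col pm1 mul1mx map_mxN pm1 mulNmx mul1mx.
      by rewrite !mxE.
    apply: (creal_comp erefl (creal_comp erefl (creal_cpair erefl c1 c2) (creal_det _ _ _))).
    exact: creal_eff.
Qed.

End Symbolic_evaluation.

(** * Fresh latents and the standard law *)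

Section Fresh.
Variable R : realType.
Local Notation V := {poly R}.
Local Notation pm := (map_mx (@polyC R)).
Implicit Types l : law R.

(** Reading off a coefficient encodes at once unit variance, mutual independence, and independence
    from the latents below [r]. *)
Definition fresh l r := forall i, (r <= i)%N ->
  lm l 'X^(i.+1) = 0 /\ forall x : V, lc l 'X^(i.+1) x = x`_(i.+1).

Lemma fresh_le l r r' : (r <= r')%N -> fresh l r -> fresh l r'.
Proof. by move=> le f i ri; apply: f; apply: leq_trans ri. Qed.

(** An old observation is uncorrelated with fresh latents, so conditioning leaves them standard
    normal and independent. *)
Lemma fresh_lcond l r k : old r k -> fresh l r -> fresh (lcond l k) r.
Proof.
move=> ok f i ri; have [m c] := f i ri.
split=> [|x] /=; rewrite /clm /clc ?m ?c ok //; first by rewrite mulr0 mul0r subr0.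
by rewrite !mul0r subr0.
Qed.

Lemma fresh_condl l r ks l' : (forall k, k \in ks -> old r k) ->
  condl l ks = Some l' -> fresh l r -> fresh l' r.
Proof.
elim: ks l => /= [l _ [->] //|k ks IH l ok].
rewrite /lcond1; case: ifP => // _ E f.
apply: (IH _ _ E) => [k' k'in|]; first by apply: ok; rewrite inE k'in orbT.
by apply: fresh_lcond => //; apply: ok; rewrite inE eqxx.
Qed.

Lemma Mm_lats l r s : fresh l r -> Mm l (lats R r s) = 0.
Proof. by move=> f; apply/colP => i; rewrite !mxE (f _ _).1 ?leq_addr. Qed.

Lemma Cm_lats l r s n (U : 'cV[V]_n) : fresh l r ->
  (forall i, old r (U i 0)) -> Cm l (lats R r s) U = 0.
Proof.
by move=> f o; apply/matrixP => i j; rewrite !mxE (f _ _).2 ?leq_addr // o ?leq_addr.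
Qed.

Lemma Cm_lats2 l r s : fresh l r -> Cm l (lats R r s) (lats R r s) = 1%:M.
Proof.
move=> f; apply/matrixP => i j; rewrite !mxE (f _ _).2 ?leq_addr // coefXn eqSS.
by rewrite eqn_add2l.
Qed.

Lemma realizes_cast l n n' (e : n = n') (f : gmor R 0 n) U :
  realizes l f U -> realizes l (gcast e f) (castmx (e, erefl) U).
Proof. by case: n' / e => -[m c]; split; rewrite /= !castmx_id. Qed.

Lemma realizes_ccomp l a m n (F : cmor R m n) (Psi : cmor R 0 (a + m))
    (r s : nat) (A : 'cV[V]_a) (X : 'cV[V]_m) (K : 'cV[V]_(ck Psi)) (Y : 'cV[V]_n) ks :
  fresh l r -> (forall i, old r (A i 0)) -> (forall i, old r (X i 0)) ->
  (forall i, old r (K i 0)) ->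
  realizes l (cf Psi) (col_mx (col_mx A X) K) -> creal F r s X Y ks ->
  let P := ccomp (ctens (cid R a) F) Psi in
  exists2 K', realizes l (cf P) (col_mx (col_mx A Y) K') &
    perm_eq (ks ++ colseq (K - pm (co Psi))) (colseq (K' - pm (co P))).
Proof.
move=> fr oA oX oK rP cF P.
have [N [KG [SN aG pG]]] := creal_tens (esym (addn0 r)) (creal_id r A) cF.
set G := ctens (cid R a) F in SN aG pG P *.
pose k := ck Psi.
exists (col_mx KG K); last first.
  by rewrite /P /= map_col_mx opp_col_mx add_col_mx colseq_col_mx perm_cat.
have -> : col_mx (col_mx A Y) (col_mx KG K) =
  castmx (esym (addnA (a + n) (ck G) k), erefl)
    (pm (gA (gtens (cf G) (gid R k))) *m col_mx (col_mx A X) K +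
     pm (gb (gtens (cf G) (gid R k))) + pm (col_mx N (0 : 'M_(k, 0 + s))) *m lats R r s).
  apply: colseqP; rewrite colseq_cast !colseq_col_mx catA -!colseq_col_mx; congr colseq.
  rewrite -aG /gapp /gtens; cbn [gA gb gid gdet].
  rewrite map_block_mx !map_col_mx pm1 !pm0 mul_block_col mul_col_mx !mul0mx mul1mx.
  by rewrite !add_col_mx !addr0 !add0r.
apply/realizes_cast/realizes_comp => //.
- rewrite tr_col_mx trmx0 mul_col_row !(mul0mx, mulmx0) /=.
  by congr block_mx; exact: SN.
- exact: Mm_lats.
- exact: Cm_lats2.
apply: Cm_lats => // i; rewrite mxE; case: split => j; last exact: oK.
by rewrite mxE; case: split => j'; [exact: oA | exact: oX].
Qed.

(** The list [ks'] is free up to permutation because a program performs the observations of the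
    prior first, whereas the composite lists those of [F] first. *)
Lemma inference l a m n (F : cmor R m n) (Psi : cmor R 0 (a + m))
    (r s : nat) (A : 'cV[V]_a) (X : 'cV[V]_m) (K : 'cV[V]_(ck Psi)) (Y : 'cV[V]_n) ks ks' :
  fresh l r -> (forall i, old r (A i 0)) -> (forall i, old r (X i 0)) ->
  (forall i, old r (K i 0)) ->
  realizes l (cf Psi) (col_mx (col_mx A X) K) -> creal F r s X Y ks ->
  perm_eq ks' (ks ++ colseq (K - pm (co Psi))) ->
  let P := ccomp (ctens (cid R a) F) Psi in
  if condl l ks' is Some l' then
    succeeds P /\ exists2 phi, posterior P phi &
      forall phi', posterior P phi' -> realizes l' phi' (col_mx A Y)
  else ~ succeeds P.
Proof.
move=> fr oA oX oK rP cF pk P.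
have [K' rK pK] := realizes_ccomp fr oA oX oK rP cF.
have sE x : lspan ks' x <-> lspan (colseq (K' - pm (co P))) x.
  have /perm_mem e : perm_eq ks' (colseq (K' - pm (co P))) by rewrite (permPl pk).
  by split; apply: lspan_sub => y; rewrite e.
have := condlP l ks'; case: (condl l ks') => [l' [cons cnd]|ncons].
  split; first exact/(succeeds_consistent rK sE).
  have [phi pphi] := posterior_exists rK sE cnd cons.
  by exists phi => // phi' /(posterior_realizes rK sE cnd).
by move=> /(succeeds_consistent rK sE).
Qed.

End Fresh.

(** * Independent standard normals and the Cholesky factorization *)

Section Standard.
Variable R : realType.
Local Notation V := {poly R}.

Definition scov n (x y : V) : R := \sum_(i < n) x`_i.+1 * y`_i.+1.

(** Any bound beyond the size of one argument gives the same sum, so forms of different degrees are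
    compared at a common bound. *)
Lemma scov_size n (x y : V) : (size x <= n)%N -> scov n x y = scov (size x) x y.
Proof.
move=> /subnKC <-; elim: (n - size x)%N => [|d IH]; first by rewrite addn0.
rewrite addnS /scov big_ord_recr /= -/(scov _ _ _) IH nth_default ?mul0r ?addr0 //.
by rewrite leqW ?leq_addr.
Qed.

Lemma scovC n (x y : V) : scov n x y = scov n y x.
Proof. by apply: eq_bigr => i _; rewrite mulrC. Qed.

Lemma scov_max (x y : V) : scov (size x) x y = scov (maxn (size x) (size y)) x y.
Proof. by rewrite scov_size ?leq_maxl. Qed.

Definition stdlaw : law R.
refine (@Law R (fun x => x`_0) (fun x y => scov (size x) x y) _ _ _ _ _ _).
- by move=> a x y; rewrite coefD coefZ.
- by rewrite coef1.
- move=> a x y z; pose n := maxn (size (a *: x + y)) (maxn (size x) (size y)).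
  rewrite -!(@scov_size n) ?leq_max ?leqnn ?orbT //.
  rewrite /scov big_distrr -big_split /=; apply: eq_bigr => i _.
  by rewrite coefD coefZ; ring.
- by move=> x y; rewrite !scov_max scovC maxnC.
- by move=> x; apply: sumr_ge0 => i _; rewrite -expr2 sqr_ge0.
- by move=> x; rewrite /scov big1 // => i _; rewrite coef1 mul0r.
Defined.

Lemma fresh_stdlaw : fresh stdlaw 0.
Proof.
move=> i _; split=> [|x] /=; first by rewrite coefXn.
have lti : (i < size ('X^(i.+1) : V))%N by rewrite size_polyXn ltnW.
rewrite /scov (bigD1 (Ordinal lti)) //= coefXn eqxx mul1r big1 ?addr0 // => j ji.
rewrite coefXn eqSS; case: eqP => [e|]; last by rewrite mul0r.
by case/eqP: ji; apply: val_inj.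
Qed.

(** Elimination of the first row and column, with singular matrices allowed: a zero pivot forces the
    rest of its column to vanish, and otherwise the Schur complement is again positive
    semidefinite. *)
Lemma cholesky n (S : 'M[R]_n) : psd S -> exists L : 'M_n, S = L *m L^T.
Proof.
elim: n S => [S _|n IH S [sS pS]]; first by exists 0; apply/matrixP => -[].
move: S sS pS; rewrite -[n.+1]/(1 + n)%N => S sS pS.
set a := ulsubmx S 0 0; set w := dlsubmx S; set T := drsubmx S.
have SE : S = block_mx a%:M w^T w T.
  by rewrite -[LHS]submxK -mx11_scalar trmx_dlsub sS.
have q (c : R) (y : 'cV_n) :
    0 <= c ^+ 2 * a + c * (w^T *m y) 0 0 *+ 2 + (y^T *m T *m y) 0 0.
  have := pS (col_mx c%:M y); rewrite SE tr_col_mx tr_scalar_mx mul_row_block mul_row_col.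
  have -> : y^T *m w = w^T *m y.
    by rewrite -[LHS]trmxK trmx_mul trmxK [w^T *m y]mx11_scalar tr_scalar_mx.
  rewrite mul_mx_scalar !mul_scalar_mx mulmxDl -scalemxAl.
  have D (A B : 'M[R]_1) : (A + B) 0 0 = A 0 0 + B 0 0 by rewrite mxE.
  have Z b (A : 'M[R]_1) : (b *: A) 0 0 = b * A 0 0 by rewrite mxE.
  by rewrite !(D, Z) [a%:M 0 0]mxE eqxx mulr1n; congr (0 <= _); ring.
have sT : T^T = T by rewrite /T trmx_drsub sS.
have a0 : 0 <= a.
  by have := q 1 0; rewrite !mulmx0 mxE mulr0 mul0rn !addr0 expr1n mul1r.
have [az|an] := eqVneq a 0.
  have w0 : w = 0.
    apply/colP => i; rewrite [RHS]mxE; apply/eqP/negPn/negP => nz.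
    pose y : 'cV[R]_n := delta_mx i 0.
    have e : (w^T *m y) 0 0 = w i 0 by rewrite /y -colE !mxE.
    (* With a zero pivot the form is affine in [c]; this [c] would give it the value -1. *)
    have := q (- ((y^T *m T *m y) 0 0 + 1) / (w i 0 *+ 2)) y; rewrite e az mulr0 add0r.
    have -> : - ((y^T *m T *m y) 0 0 + 1) / (w i 0 *+ 2) * w i 0 *+ 2
       = - ((y^T *m T *m y) 0 0 + 1) by field; rewrite nz.
    by lra.
  have [|L TE] := IH T.
    by split=> // y; have := q 0 y; rewrite az mulr0 !mul0r mul0rn !add0r.
  exists (block_mx 0 0 0 L).
  rewrite tr_block_mx !trmx0 mulmx_block !(mul0mx, mulmx0) !addr0 add0r -TE.
  by rewrite SE az w0 trmx0 raddf0.
have ap : 0 < a by rewrite lt0r an.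
have [|L TE] := IH (T - a^-1 *: (w *m w^T)).
  split; first by rewrite linearB /= linearZ /= trmx_mul trmxK sT.
  (* The minimizer in [c], at which the form of [S] equals that of the Schur complement. *)
  move=> y; have := q (- (w^T *m y) 0 0 / a) y.
  have -> : (y^T *m (T - a^-1 *: (w *m w^T)) *m y) 0 0 =
            (y^T *m T *m y) 0 0 - a^-1 * (w^T *m y) 0 0 ^+ 2.
    rewrite mulmxBr mulmxBl [LHS]mxE [X in _ + X]mxE; congr (_ - _).
    rewrite -scalemxAr -scalemxAl [LHS]mxE; congr (_ * _).
    have -> : y^T *m (w *m w^T) *m y = (y^T *m w) *m (w^T *m y) by rewrite !mulmxA.
    rewrite -[y^T *m w]trmxK trmx_mul trmxK.
    set c := (w^T *m y) 0 0; have -> : w^T *m y = c%:M by exact: mx11_scalar.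
    by rewrite tr_scalar_mx -scalar_mxM mxE eqxx mulr1n expr2.
  by congr (0 <= _); field.
pose s := Num.sqrt a.
have ss : s * s = a by rewrite -expr2 sqr_sqrtr.
have s0 : s != 0 by rewrite sqrtr_eq0 -ltNge.
exists (block_mx s%:M 0 (s^-1 *: w) L).
rewrite tr_block_mx trmx0 tr_scalar_mx linearZ /= mulmx_block !(mul0mx, mulmx0) !addr0.
rewrite -TE -scalar_mxM ss mul_scalar_mx mul_mx_scalar !scalerA mulfV // !scale1r.
rewrite -scalemxAl -scalemxAr scalerA -invfM ss addrC subrK.
exact: SE.
Qed.

End Standard.

(** * Configurations and their laws *)

Section Operational.
Variable R : realType.
Local Notation term := (term R).
Implicit Types (e v w : term) (G : tctx) (t : ty) (r s : nat) (p : gstate R) (l : law R).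

(* The law [l] is that of the latents of [p], followed by an infinite supply of
   independent standard normal latents; so it is not affected by sampling. *)
Definition rep p l :=
  [/\ forall i : 'I_(gd p), lm l 'X^(i.+1) = gmu p i 0,
      forall i j : 'I_(gd p), lc l 'X^(i.+1) 'X^(j.+1) = gSig p i j &
      fresh l (gd p)].

Lemma rep_empty : rep (gempty R) (stdlaw R).
Proof. by split=> [[]|[]|] //; apply: fresh_stdlaw. Qed.

Lemma rep_extend p l : rep p l -> rep (gextend p) l.
Proof.
move=> [m c f]; split=> /= [i|i j|]; last by apply: fresh_le f; rewrite leq_addr.
  rewrite mxE; case: split_ordP => j -> /=; first exact: m.
  by rewrite (f _ _).1 ?leq_addr // mxE.
rewrite !mxE; case: split_ordP => i' -> /=; rewrite mxE; case: split_ordP => j' -> /=.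
- exact: c.
- by rewrite lcC (f _ _).2 ?leq_addr // coefXn eqSS gtn_eqF ?mxE // ltn_addr.
- by rewrite (f _ _).2 ?leq_addr // coefXn eqSS gtn_eqF ?mxE // ltn_addr.
- by rewrite (f _ _).2 ?leq_addr // coefXn eqSS eqn_add2l mxE; rewrite !ord1.
Qed.

Lemma aff_mean p l v : rep p l -> rval (gd p) v ->
  lm l (paff v) = ((aff (gd p) v).1 *m gmu p) 0 0 + (aff (gd p) v).2.
Proof.
move=> [m c f]; elim: v => //= [i ir|a IHa b IHb /andP[ra rb]|a v IH ra|b _].
- rewrite addr0 mxE (bigD1 (Ordinal ir)) //= big1 => [|j ji].
    by rewrite mxE /= eqxx mul1r addr0 -m.
  by rewrite mxE ifN ?mul0r.
- by rewrite lmD IHa // IHb // mulmxDl [(_ *m _ + _) 0 0]mxE; ring.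
- by rewrite lmZ IH // -scalemxAl [(_ *: (_ *m _) : 'M_1) 0 0]mxE; ring.
- by rewrite lmC mul0mx mxE add0r.
Qed.

(** Half of [aff_cov]: covariance is bilinear, and its two arguments are expanded one after the
    other. *)
Lemma aff_cov_lat p l v (j : 'I_(gd p)) : rep p l -> rval (gd p) v ->
  lc l (paff v) 'X^(j.+1) = ((aff (gd p) v).1 *m gSig p) 0 j.
Proof.
move=> [m c f]; elim: v => //= [i ir|a IHa b IHb /andP[ra rb]|a v IH ra|b _].
- rewrite mxE (bigD1 (Ordinal ir)) //= big1 => [|k ki].
    by rewrite mxE /= eqxx mul1r addr0 -c.
  by rewrite mxE ifN ?mul0r.
- by rewrite lcDl IHa // IHb // mulmxDl [RHS]mxE.
- by rewrite lcZl IH // -scalemxAl [RHS]mxE.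
- by rewrite lcCl mul0mx mxE.
Qed.

Lemma aff_cov p l v w : rep p l -> rval (gd p) v -> rval (gd p) w ->
  lc l (paff v) (paff w) = ((aff (gd p) v).1 *m gSig p *m (aff (gd p) w).1^T) 0 0.
Proof.
move=> rp rv.
have cj j := aff_cov_lat j rp rv.
move: cj; set M := _ *m gSig p; move: M => M cj.
elim: w => //= [i ir|a IHa b IHb /andP[ra rb]|a w IH ra|b _].
- rewrite (cj (Ordinal ir)) mxE (bigD1 (Ordinal ir)) //= big1 => [|j ji].
    by rewrite !mxE /= eqxx mulr1 addr0.
  by rewrite !mxE ifN ?mulr0.
- by rewrite lcDr IHa // IHb // linearD mulmxDr [RHS]mxE.
- by rewrite lcZr IH // linearZ /= -scalemxAr [RHS]mxE.
- by rewrite lcCr trmx0 mulmx0 mxE.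
Qed.

Lemma mxBE m n (A B : 'M[R]_(m, n)) i j : (A - B) i j = A i j - B i j.
Proof. by rewrite !mxE. Qed.

Lemma mxZE m n a (A : 'M[R]_(m, n)) i j : (a *: A) i j = a * A i j.
Proof. by rewrite !mxE. Qed.

Section Conditioning.
Variables (p : gstate R) (l : law R) (v w : term).
Hypotheses (rp : rep p l) (rv : rval (gd p) v) (rw : rval (gd p) w).
Let k := paff v - paff w.

Lemma cond_mean : lm l k = (condU p v w *m gmu p) 0 0 + condB p v w.
Proof.
rewrite /k lmB (aff_mean rp rv) (aff_mean rp rw) /condU /condB mulmxBl.
by rewrite mxBE; ring.
Qed.

Lemma cond_cov_lat (j : 'I_(gd p)) : lc l k 'X^(j.+1) = (condU p v w *m gSig p) 0 j.
Proof.
rewrite /k lcBl (aff_cov_lat j rp rv) (aff_cov_lat j rp rw) /condU mulmxBl.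
by rewrite mxBE.
Qed.

Lemma cond_cov : lc l k k = (condU p v w *m gSig p *m (condU p v w)^T) 0 0.
Proof.
rewrite /k !(lcBl, lcBr) !(aff_cov rp) // /condU linearB /= !(mulmxBl, mulmxBr).
by rewrite !mxBE; ring.
Qed.

(** In dimension one the column space is everything unless the variance is zero, and then support
    membership says that [k] has zero mean. *)
Lemma cond_okE : cond_ok p v w <-> lcond1 l k = Some (lcond l k).
Proof.
rewrite /cond_ok /in_support /lcond1.
set u := condU p v w; set b := condB p v w.
transitivity (exists a, - b - (u *m gmu p) 0 0 = lc l k k * a).
  split=> [[a /matrixP/(_ 0 0)]|[a e]].
    rewrite !mxE eqxx mulr1n => e; exists (a 0 0); rewrite cond_cov -/u.
    by rewrite [LHS]e big_ord1.
  exists (const_mx a); apply/matrixP => i j; rewrite !ord1.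
  have aE : (const_mx a : 'M[R]_1) 0 0 = a by rewrite mxE.
  rewrite [RHS]mxE big_ord1 -cond_cov aE -e.
  by rewrite mxBE; congr (_ - _); rewrite mxE eqxx mulr1n.
have mE : - b - (u *m gmu p) 0 0 = - lm l k by rewrite cond_mean -/u -/b; ring.
rewrite mE; have [k0|k0] /= := eqVneq (lc l k k) 0.
  split=> [[a]|].
    by rewrite k0 mul0r => /eqP; rewrite oppr_eq0 => /eqP ->; rewrite eqxx.
  by case: eqP => // -> _; exists 0; rewrite oppr0 mulr0.
by split=> // _; exists (- lm l k / lc l k k); rewrite mulrC divfK.
Qed.

Lemma gd_cond_post : gd (cond_post p v w) = gd p.
Proof. by rewrite /cond_post; case: ifP. Qed.

Lemma rep_cond : rep (cond_post p v w) (lcond l k).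
Proof.
have ok : old (gd p) k by apply: oldB; apply: paff_old.
have cX (j : 'I_(gd p)) : lc l 'X^(j.+1) k = (gSig p *m (condU p v w)^T) j 0.
  have sS : (gSig p)^T = gSig p.
    by case: rp => _ c _; apply/matrixP => i i'; rewrite mxE -!c lcC.
  by rewrite lcC cond_cov_lat -{2}sS -trmx_mul [RHS]mxE.
case: (rp) => m c f.
rewrite /cond_post -cond_cov; case: eqVneq => k0.
  split; last exact: fresh_lcond.
    by move=> i; rewrite /= /clm k0 invr0 mulr0 subr0 m.
  by move=> i j; rewrite /= /clc k0 invr0 mulr0 subr0 c.
split; last exact: fresh_lcond.
  move=> i; rewrite /= /clm m cX cond_mean !mxE; ring.
move=> i j; rewrite /= /clc c !cX.
rewrite mxBE mxZE -[_ *m condU p v w *m _]mulmxA [(_ *m (_ *m _)) i j]mxE big_ord1.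
by rewrite -cond_cov_lat lcC cX; ring.
Qed.

End Conditioning.

End Operational.

(** * Reduction against symbolic evaluation *)

Section Reduction.
Variable R : realType.
Local Notation V := {poly R}.
Local Notation term := (term R).
Implicit Types (e v w : term) (G : tctx) (t : ty) (r s : nat) (p : gstate R) (l : law R).
Implicit Types (sg : nat -> option term).

Definition drop1 (x : nat) sg : nat -> option term := fun z => if z == x then None else sg z.

(** Evaluation carries a whole environment, reduction substitutes one variable at a time;
    simultaneous substitution links the two. *)
Fixpoint psub sg e : term :=
  match e with
  | Var x => if sg x is Some v then v else Var R x
  | Lat _ | Const _ | Unt | Normal => e
  | Plus a b => Plus (psub sg a) (psub sg b)
  | Scale c a => Scale c (psub sg a)
  | Pair a b => Pair (psub sg a) (psub sg b)
  | Let y a b => Let y (psub sg a) (psub (drop1 y sg) b)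
  | LetP y z a b => LetP y z (psub sg a) (psub (drop1 y (drop1 z sg)) b)
  | CondE a b => CondE (psub sg a) (psub sg b)
  end.

Lemma psub_ext sg sg' e : sg =1 sg' -> psub sg e = psub sg' e.
Proof.
elim: e sg sg' => //=.
- by move=> x sg sg' ->.
- by move=> a IHa b IHb sg sg' E; rewrite (IHa _ _ E) (IHb _ _ E).
- by move=> c a IHa sg sg' E; rewrite (IHa _ _ E).
- by move=> a IHa b IHb sg sg' E; rewrite (IHa _ _ E) (IHb _ _ E).
- move=> y a IHa b IHb sg sg' E; rewrite (IHa _ _ E); congr Let; apply: IHb => z.
  by rewrite /drop1 E.
- move=> y z a IHa b IHb sg sg' E; rewrite (IHa _ _ E); congr LetP; apply: IHb => u.
  by rewrite /drop1 E.
- by move=> a IHa b IHb sg sg' E; rewrite (IHa _ _ E) (IHb _ _ E).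
Qed.

Lemma psub_id sg e : (forall x, sg x = None) -> psub sg e = e.
Proof.
elim: e sg => //=.
- by move=> x sg ->.
- by move=> a IHa b IHb sg E; rewrite IHa ?IHb.
- by move=> c a IHa sg E; rewrite IHa.
- by move=> a IHa b IHb sg E; rewrite IHa ?IHb.
- by move=> y a IHa b IHb sg E; rewrite IHa ?IHb // => z; rewrite /drop1 E if_same.
- by move=> y z a IHa b IHb sg E; rewrite IHa ?IHb // => u; rewrite /drop1 E !if_same.
- by move=> a IHa b IHb sg E; rewrite IHa ?IHb.
Qed.

Definition closed v := forall x u, subst x u v = v.
Definition closing sg := forall x v, sg x = Some v -> closed v.
(** Existing entries win: [sg] acts first, and its closed values are untouched by the later
    substitution of [x]. *)
Definition addsub sg (x : nat) v : nat -> option term :=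
  fun z => if sg z is Some w then Some w else if z == x then Some v else None.

Lemma closing_drop1 x sg : closing sg -> closing (drop1 x sg).
Proof. by move=> c z v; rewrite /drop1; case: ifP => // _ /c. Qed.

Lemma subst_psub sg x v e : closing sg -> subst x v (psub sg e) = psub (addsub sg x v) e.
Proof.
elim: e sg => //=.
- move=> y sg c; rewrite /addsub; case E: (sg y) => [w|]; first exact: c E _ _.
  by rewrite /=; case: ifP.
- by move=> a IHa b IHb sg c; rewrite IHa ?IHb.
- by move=> c' a IHa sg c; rewrite IHa.
- by move=> a IHa b IHb sg c; rewrite IHa ?IHb.
- move=> y a IHa b IHb sg c; rewrite IHa //; congr Let.
  case: eqVneq => [->|yx].
    by apply: psub_ext => z; rewrite /drop1 /addsub; case: eqVneq => // _; case: (sg z).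
  rewrite IHb; last exact: closing_drop1.
  apply: psub_ext => z; rewrite /drop1 /addsub; case: (eqVneq z y) => // ->.
  by rewrite (negPf yx).
- move=> y z a IHa b IHb sg c; rewrite IHa //; congr LetP.
  case: ifP => [|/norP[yx zx]].
    move=> yzx; apply: psub_ext => u; rewrite /drop1 /addsub.
    case: (eqVneq u y) => // uy; case: (eqVneq u z) => // uz; case: (sg u) => //.
    by case: eqP => // ux; move: yzx; rewrite -ux !(eq_sym _ u) (negPf uy) (negPf uz).
  rewrite IHb; last by do 2 apply: closing_drop1.
  apply: psub_ext => u; rewrite /drop1 /addsub.
  case: (eqVneq u y) => [->|uy]; first by rewrite (negPf yx).
  by case: (eqVneq u z) => [->|//]; rewrite (negPf zx).
- by move=> a IHa b IHb sg c; rewrite IHa ?IHb.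
Qed.

Fixpoint envsub (rho : seq (nat * term)) : nat -> option term := fun x =>
  match rho with
  | [::] => None
  | (y, v) :: rho' => if x == y then Some v else envsub rho' x
  end.

(* With this predicate at type [TI], [wt] is ordinary typing of closed values. *)
Definition isUnt v := v = Unt R.

Lemma rval_closed r v : rval r v -> closed v.
Proof.
move=> rv x u; elim: v rv => //= [a IHa b IHb /andP[ra rb]|c a IHa ra].
  by rewrite IHa ?IHb.
by rewrite IHa.
Qed.

Lemma rval_value r v : rval r v -> is_value v.
Proof. by elim: v => //= a IHa b IHb /andP[/IHa-> /IHb->]. Qed.

Lemma wt_closed r t v : wt isUnt r t v -> closed v.
Proof.
elim: t v => [v|v ->|a IHa b IHb v] //=; first exact: rval_closed.
by move=> [-> [ca cb]] x u /=; rewrite IHa ?IHb.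
Qed.

Lemma wt_value r t v : wt isUnt r t v -> is_value v.
Proof.
elim: t v => [v|v ->|a IHa b IHb v] //=; first exact: rval_value.
by move=> [-> [ca cb]] /=; rewrite IHa ?IHb.
Qed.

Lemma closing_env r G rho : wte isUnt r G rho -> closing (envsub rho).
Proof.
elim: G rho => [|[x t] G IH] [|[y v] rho] //= [_ wv wr] z u.
by case: ifP => [_ [<-]|_ /(IH _ wr)]; [apply: wt_closed wv|].
Qed.

Lemma envsub_look r G rho x t : wte isUnt r G rho -> lookup G x = Some t ->
  envsub rho x = Some (elook rho x).
Proof.
elim: G rho => [|[z s] G IH] [|[y v] rho] //= [<- _ wr].
by case: ifP => // _; apply: IH.
Qed.

Lemma steps_trans e p e' p' o :
  steps e p (Some (e', p')) -> steps e' p' o -> steps e p o.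
Proof.
move: {-2}(Some (e', p')) (erefl (Some (e', p'))) => o' E S.
elim: S e' p' E => {e p o'} [e p e' p' [-> ->]|//|e p e1 p1 o' st _ IH e' p' E S] //.
by apply: St_step st _; apply: IH E S.
Qed.

Lemma steps1 e p o : step e p o -> steps e p o.
Proof.
by case: o => [[e' p']|] st; [apply: St_step st (St_refl _ _) | apply: St_bot].
Qed.

Definition evctx (C : term -> term) := forall e p o, step e p o -> step (C e) p (Defs.lift C o).

Lemma steps_evctx C e p o : evctx C -> steps e p o -> steps (C e) p (Defs.lift C o).
Proof.
move=> hC; elim=> {e p o} [e p|e p st|e p e' p' o st _ IH] /=.
- exact: St_refl.
- by apply: St_bot; apply: (hC _ _ _ st).
- by apply: St_step IH; apply: (hC _ _ _ st).
Qed.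

(** [ev] continues past an unsatisfiable observation while the machine stops there; since [condl]
    fails as soon as a prefix does, the full list still decides failure. *)
Definition runs_to e p l (o : term * seq V * nat) :=
  let: (v, ks, r) := o in
  if condl l ks is Some l' then
    exists p', [/\ steps e p (Some (v, p')), gd p' = r & rep p' l']
  else steps e p None.

Lemma runs_to_bind C e p l v k1 r1 w k2 r2 : evctx C ->
  runs_to e p l (v, k1, r1) ->
  (forall p1 l1, gd p1 = r1 -> rep p1 l1 -> runs_to (C v) p1 l1 (w, k2, r2)) ->
  runs_to (C e) p l (w, k1 ++ k2, r2).
Proof.
move=> hC; rewrite /runs_to condl_cat.
case: (condl l k1) => [l1 [p1 [S g1 rp1]] /(_ p1 l1 g1 rp1)|S _].
  have S' := steps_evctx hC S.
  case: (condl l1 k2) => [l2 [p2 [S2 g2 rp2]]|S2]; last exact: steps_trans S' S2.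
  by exists p2; split=> //; apply: steps_trans S' S2.
exact: (steps_evctx hC S).
Qed.

Lemma runs_to_refl v p l r : gd p = r -> rep p l -> runs_to v p l (v, [::], r).
Proof. by move=> g rp; exists p; split=> //; apply: St_refl. Qed.

Lemma runs_to_step e p l e' p' o :
  step e p (Some (e', p')) -> runs_to e' p' l o -> runs_to e p l o.
Proof.
case: o => [[v ks] r] st; rewrite /runs_to; case: (condl l ks) => [l'|].
  by move=> [p1 [S g rp]]; exists p1; split=> //; apply: St_step st S.
exact: St_step st.
Qed.

Lemma ev_wt G e t rho r : has_type G e t -> wte isUnt r G rho ->
  exists v ks s, [/\ ev rho e r = (v, ks, (r + s)%N), wt isUnt (r + s) t v &
    wte isUnt (r + s) G rho].
Proof.
move=> he wr; have [F _ /(_ isUnt rho r erefl wr)] := adequacy he.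
move=> [v [ks [s [E wv _ _]]]]; exists v, ks, s; split=> //.
by apply: wte_le wr; rewrite leq_addr.
Qed.

(** Stated for open terms under an environment so that the induction covers the bodies of lets. Each
    evaluation context costs one [runs_to_bind]. *)
Lemma runs_to_ev G e t : has_type G e t ->
  forall rho r p l, wte isUnt r G rho -> gd p = r -> rep p l ->
  runs_to (psub (envsub rho) e) p l (ev rho e r).
Proof.
elim=> {G e t}.
- move=> G x t lx rho r p l wr g rp /=; rewrite (envsub_look wr lx).
  exact: runs_to_refl.
- move=> G e1 e2 h1 IH1 h2 IH2 rho r p l wr g rp /=.
  have := IH1 rho r p l wr g rp; have [v1 [k1 [s1 [-> w1 wr1]]]] := ev_wt h1 wr => R1.
  have [v2 [k2 [s2 [E2 w2 wr2]]]] := ev_wt h2 wr1; rewrite E2.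
  apply: (runs_to_bind (C := fun e => Plus e _) _ R1) => [? ? ? ?|p1 l1 g1 rp1].
    exact: C_PlusL.
  have := IH2 rho _ p1 l1 wr1 g1 rp1; rewrite E2 => R2.
  rewrite -[k2]cats0; apply: (runs_to_bind (C := Plus _) _ R2).
    by move=> ? ? ?; apply: C_PlusR; apply: rval_value w1.
  by move=> p2 l2 g2 rp2; apply: runs_to_refl.
- move=> G a e h IH rho r p l wr g rp /=.
  have := IH rho r p l wr g rp; have [v [k [s [-> wv wr1]]]] := ev_wt h wr => R1.
  rewrite -[k]cats0; apply: (runs_to_bind (C := Scale _) _ R1) => [? ? ?|p1 l1 g1 rp1].
    exact: C_Scale.
  exact: runs_to_refl.
- by move=> G b rho r p l wr g rp; apply: runs_to_refl.
- move=> G e1 e2 t1 t2 h1 IH1 h2 IH2 rho r p l wr g rp /=.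
  have := IH1 rho r p l wr g rp; have [v1 [k1 [s1 [-> w1 wr1]]]] := ev_wt h1 wr => R1.
  have [v2 [k2 [s2 [E2 w2 wr2]]]] := ev_wt h2 wr1; rewrite E2.
  apply: (runs_to_bind (C := fun e => Pair e _) _ R1) => [? ? ? ?|p1 l1 g1 rp1].
    exact: C_PairL.
  have := IH2 rho _ p1 l1 wr1 g1 rp1; rewrite E2 => R2.
  rewrite -[k2]cats0; apply: (runs_to_bind (C := Pair _) _ R2).
    by move=> ? ? ?; apply: C_PairR; apply: wt_value w1.
  by move=> p2 l2 g2 rp2; apply: runs_to_refl.
- by move=> G rho r p l wr g rp; apply: runs_to_refl.
- move=> G x e1 e2 t1 t2 h1 IH1 h2 IH2 rho r p l wr g rp /=.
  have := IH1 rho r p l wr g rp; have [v1 [k1 [s1 [-> w1 wr1]]]] := ev_wt h1 wr => R1.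
  have wr1' : wte isUnt (r + s1) ((x, t1) :: G) ((x, v1) :: rho) by [].
  have [v2 [k2 [s2 [E2 w2 wr2]]]] := ev_wt h2 wr1'; rewrite E2.
  apply: (runs_to_bind (C := fun e => Let x e _) _ R1) => [? ? ? ?|p1 l1 g1 rp1].
    exact: C_Let.
  have := IH2 _ _ p1 l1 wr1' g1 rp1; rewrite E2; apply: runs_to_step.
  have -> : psub (envsub ((x, v1) :: rho)) e2 = subst x v1 (psub (drop1 x (envsub rho)) e2).
    rewrite subst_psub; last by apply: closing_drop1; apply: closing_env wr.
    apply: psub_ext => z; rewrite /addsub /drop1 /=.
    by case: ifP => // _; case: (envsub rho z).
  by apply: S_Let; apply: wt_value w1.
- move=> G x y e1 e2 t1 t2 t3 h1 IH1 h2 IH2 rho r p l wr g rp /=.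
  have := IH1 rho r p l wr g rp; have [v1 [k1 [s1 [-> w1 wr1]]]] := ev_wt h1 wr => R1.
  case: w1 => v1E [wa wb].
  have wr1' : wte isUnt (r + s1) ((y, t2) :: (x, t1) :: G)
      ((y, psnd v1) :: (x, pfst v1) :: rho) by [].
  have [v2 [k2 [s2 [E2 w2 wr2]]]] := ev_wt h2 wr1'; rewrite E2.
  apply: (runs_to_bind (C := fun e => LetP x y e _) _ R1) => [? ? ? ?|p1 l1 g1 rp1].
    exact: C_LetP.
  have := IH2 _ _ p1 l1 wr1' g1 rp1; rewrite E2; apply: runs_to_step.
  set va := pfst v1 in v1E wa *; set vb := psnd v1 in v1E wb *.
  (* The rule substitutes [y] first, so [y] wins when both names coincide, as it does in the
     environment. *)
  have -> : psub (envsub ((y, vb) :: (x, va) :: rho)) e2 =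
      subst x va (subst y vb (psub (drop1 x (drop1 y (envsub rho))) e2)).
    have c0 : closing (drop1 x (drop1 y (envsub rho))).
      by do 2 apply: closing_drop1; apply: closing_env wr.
    rewrite subst_psub // subst_psub; last first.
      move=> z u; rewrite /addsub; case E: (drop1 _ _ _) => [u'|].
        by move=> [<-]; apply: c0 E.
      by case: ifP => // _ [<-]; apply: wt_closed wb.
    apply: psub_ext => z; rewrite /addsub /drop1 /=.
    case: (eqVneq z y) => [->|zy]; first by rewrite if_same.
    by case: (eqVneq z x) => // _; case: (envsub rho z).
  by rewrite v1E; apply: S_LetP; [apply: wt_value wa | apply: wt_value wb].
- move=> G rho r p l wr g rp; exists (gextend p); split; last exact: rep_extend.
    by rewrite -g; apply: steps1; apply: S_Normal.
  by rewrite /= g addn1.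
- move=> G e1 e2 h1 IH1 h2 IH2 rho r p l wr g rp /=.
  have := IH1 rho r p l wr g rp; have [v1 [k1 [s1 [-> w1 wr1]]]] := ev_wt h1 wr => R1.
  have [v2 [k2 [s2 [E2 w2 wr2]]]] := ev_wt h2 wr1; rewrite E2.
  apply: (runs_to_bind (C := fun e => CondE e _) _ R1) => [? ? ? ?|p1 l1 g1 rp1].
    exact: C_CondL.
  have := IH2 rho _ p1 l1 wr1 g1 rp1; rewrite E2 => R2.
  apply: (runs_to_bind (C := CondE _) _ R2).
    by move=> ? ? ?; apply: C_CondR; apply: rval_value w1.
  move=> p2 l2 g2 rp2; rewrite /= in w1 w2.
  have rv1 : rval (gd p2) v1 by rewrite g2; apply: rval_le w1; rewrite leq_addr.
  have rv2 : rval (gd p2) v2 by rewrite g2.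
  have vv1 := rval_value rv1; have vv2 := rval_value rv2.
  have okE := cond_okE rp2 rv1 rv2.
  rewrite /runs_to /=; case E: (lcond1 _ _) => [l3|]; last first.
    by apply: St_bot; apply: S_CondFail => // /okE; rewrite E.
  have E' : lcond1 l2 (paff v1 - paff v2) = Some (lcond l2 (paff v1 - paff v2)).
    by move: E; rewrite /lcond1; case: ifP.
  move: E; rewrite E' => -[<-].
  exists (cond_post p2 v1 v2); split; last exact: rep_cond.
    by apply: steps1; apply: S_CondOK => //; apply/okE.
  by rewrite gd_cond_post.
Qed.

End Reduction.

(** * Outcomes of closed programs *)

Section Outcomes.
Variable R : realType.
Local Notation V := {poly R}.
Local Notation term := (term R).
Implicit Types (e v w : term) (G : tctx) (t : ty) (r s : nat) (p : gstate R) (l : law R).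

Lemma value_nostep v p o : step v p o -> is_value v = false.
Proof. by elim=> {v p o} //= *; rewrite ?andbF //; apply/andP => -[]; congruence. Qed.

Ltac no_value_step :=
  match goal with
  | V : is_true (is_value ?v), S : step ?v _ _ |- _ =>
      by rewrite (value_nostep S) in V
  end.

Lemma step_det e p o1 o2 : step e p o1 -> step e p o2 -> o1 = o2.
Proof.
move=> S1; elim: S1 o2 => {e p o1}.
- by move=> p o2 S2; inversion S2.
- move=> x v e p vv o2 S2; inversion S2; subst => //; no_value_step.
- move=> x y v w e p vv vw o2 S2; inversion S2; subst => //.
  have V : is_value (Pair v w) by rewrite /= vv vw.
  no_value_step.
- by move=> v w p vv vw ok o2 S2; inversion S2; subst => //; no_value_step.
- by move=> v w p vv vw ok o2 S2; inversion S2; subst => //; no_value_step.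
- move=> e1 e2 p o S1 IH o2 S2; inversion S2; subst; last by no_value_step.
  by rewrite (IH _ H3).
- move=> v e2 p o vv S1 IH o2 S2; inversion S2; subst; first by no_value_step.
  by rewrite (IH _ H4).
- by move=> a e p o S1 IH o2 S2; inversion S2; subst; rewrite (IH _ H3).
- move=> e1 e2 p o S1 IH o2 S2; inversion S2; subst; last by no_value_step.
  by rewrite (IH _ H3).
- move=> v e2 p o vv S1 IH o2 S2; inversion S2; subst; first by no_value_step.
  by rewrite (IH _ H4).
- move=> e1 e2 p o S1 IH o2 S2; inversion S2; subst; try by no_value_step.
  by rewrite (IH _ H3).
- move=> v e2 p o vv S1 IH o2 S2; inversion S2; subst; try by no_value_step.
  by rewrite (IH _ H4).
- move=> x e t p o S1 IH o2 S2; inversion S2; subst; try by no_value_step.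
  by rewrite (IH _ H4).
- move=> x y e t p o S1 IH o2 S2; inversion S2; subst; last by rewrite (IH _ H5).
  have V : is_value (Pair v w) by apply/andP.
  no_value_step.
Qed.

Definition terminal (o : option (term * gstate R)) := if o is Some (v, _) then is_value v else true.

Lemma steps_det e p o1 o2 : steps e p o1 -> steps e p o2 ->
  terminal o1 -> terminal o2 -> o1 = o2.
Proof.
move=> S1; elim: S1 o2 => {e p o1} [e p|e p st|e p e' p' o st _ IH] o2 S2 T1 T2.
- case: S2 T1 T2 => {e p o2} // e p; first by move=> st /=; rewrite (value_nostep st).
  by move=> e' p' o st _ /=; rewrite (value_nostep st).
- case: S2 st T2 => {e p o2} // e p; first by move=> st /=; rewrite (value_nostep st).
  by move=> e' p' o st _ st'; have := step_det st st'.
- case: S2 st IH T2 => {e p o2} [e p|e p st|e p e1 p1 o2 st S2] st' IH T2.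
  + by move: T2; rewrite /= (value_nostep st').
  + by have := step_det st st'.
  + by have := step_det st st'; case=> ? ?; subst; apply: IH.
Qed.

(** The demand [isUnt] matters here: [comps] erases only the literal unit, in agreement with
    dimension 0 at type [TI]. *)
Lemma comps_vflat r t v : wt (@isUnt R) r t v ->
  [seq paff c | c <- comps v] = colseq (vflat t v) /\ all (rval r) (comps v).
Proof.
elim: t v => /= [v rv|v ->|a IHa b IHb v [-> [/IHa[ea ra] /IHb[eb rb]]]] /=.
- by case: v rv => //= *; rewrite colseq1 mxE ?andbT.
- by rewrite colseq0.
- by rewrite map_cat all_cat ea eb ra rb colseq_col_mx.
Qed.

Lemma eq_map_all (T U : Type) (a : pred T) (f g : T -> U) (s : seq T) :
  (forall x, a x -> f x = g x) -> all a s -> map f s = map g s.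
Proof. by move=> E; elim: s => //= x s IH /andP[/E-> /IH->]. Qed.

Lemma pushforwardE r t v p l : wt (@isUnt R) r t v -> gd p = r -> rep p l ->
  pushforward v p =
    ([seq lm l x | x <- colseq (vflat t v)],
     [seq [seq lc l x y | y <- colseq (vflat t v)] | x <- colseq (vflat t v)]).
Proof.
move=> wv g rp; have [<- rc] := comps_vflat wv; subst r.
rewrite /pushforward -!map_comp; congr pair.
  by apply: eq_map_all rc => c rc; rewrite /= -(aff_mean rp).
apply: (eq_map_all _ rc) => c rc' /=; rewrite -!map_comp.
by apply: (eq_map_all _ rc) => c' rc'' /=; rewrite (aff_cov rp).
Qed.

(** [runs_to_ev] exhibits one terminal run, and determinism makes it the only one. *)
Lemma closed_outcome e t : has_type [::] e t ->
  let: (v, ks, r) := ev [::] e 0 in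
  [/\ wt (@isUnt R) r t v,
      fails e <-> condl (stdlaw R) ks = None,
      condl (stdlaw R) ks <> None -> exists v' p', runs e v' p' &
      forall v' p', runs e v' p' -> exists2 l, condl (stdlaw R) ks = Some l &
        pushforward v' p' =
        ([seq lm l x | x <- colseq (vflat t v)],
         [seq [seq lc l x y | y <- colseq (vflat t v)] | x <- colseq (vflat t v)])].
Proof.
move=> he; have := @runs_to_ev R [::] e t he [::] 0 (gempty R) (stdlaw R) I erefl (rep_empty R).
have [v [ks [s [-> wv _]]]] := @ev_wt R [::] e t [::] 0 he I.
rewrite psub_id // /runs_to; case: (condl _ ks) => [l [p' [S g rp]]|S].
  have vv := wt_value wv.
  split=> //.
    by split=> // S'; have := steps_det S S' vv isT.
    by exists v, p'.
  move=> v' p1 [S' vv']; have [E1 E2] : v = v' /\ p' = p1.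
    by have := steps_det S S' vv vv'; case.
  by subst; exists l => //; apply: pushforwardE wv g rp.
split=> // v' p' [S' vv']; by have := steps_det S S' isT vv'.
Qed.

End Outcomes.

(** * Equality of joint laws *)

Section LawEquivalence.
Variable R : realType.
Local Notation V := {poly R}.
Local Notation pm := (map_mx (@polyC R)).
Local Notation term := (term R).
Implicit Types (e v w : term) (G : tctx) (t : ty) (r s : nat) (l : law R).

Definition law_eq l1 l2 n (U W : 'cV[V]_n) :=
  Mm l1 U = Mm l2 W /\ Cm l1 U U = Cm l2 W W.

(** Corresponding variables of two runs: the same coefficients on both sides, so an equality of
    joint laws passes from [U], [W] to [x], [y]. *)
Definition lcomb n (U W : 'cV[V]_n) (x y : V) :=
  exists w : 'rV[R]_n, x = (pm w *m U) 0 0 /\ y = (pm w *m W) 0 0.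

Definition lsub m n (U' W' : 'cV[V]_m) (U W : 'cV[V]_n) :=
  forall i, lcomb U W (U' i 0) (W' i 0).

Lemma lcomb0 n (U W : 'cV[V]_n) : lcomb U W 0 0.
Proof. by exists 0; rewrite pm0 !mul0mx !mxE. Qed.

Lemma lcombD n (U W : 'cV[V]_n) x y x' y' :
  lcomb U W x y -> lcomb U W x' y' -> lcomb U W (x + x') (y + y').
Proof.
move=> [w [-> ->]] [w' [-> ->]]; exists (w + w').
by rewrite pmD !mulmxDl; split; rewrite [RHS]mxE.
Qed.

Lemma lcombZ n (U W : 'cV[V]_n) a x y : lcomb U W x y -> lcomb U W (a *: x) (a *: y).
Proof.
move=> [w [-> ->]]; exists (a *: w); rewrite map_mxZ /= -!scalemxAl.
by split; rewrite [RHS]mxE mul_polyC.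
Qed.

Lemma lcombB n (U W : 'cV[V]_n) x y x' y' :
  lcomb U W x y -> lcomb U W x' y' -> lcomb U W (x - x') (y - y').
Proof. by move=> h h'; rewrite -[x']scale1r -[y']scale1r -!scaleNr; apply/lcombD/lcombZ. Qed.

Lemma lsub_refl n (U W : 'cV[V]_n) : lsub U W U W.
Proof. by move=> i; exists (delta_mx 0 i); rewrite map_delta_mx -!rowE !mxE. Qed.

Lemma lsub_col m1 m2 n (U1 W1 : 'cV[V]_m1) (U2 W2 : 'cV[V]_m2) (U W : 'cV[V]_n) :
  lsub U1 W1 U W -> lsub U2 W2 U W -> lsub (col_mx U1 U2) (col_mx W1 W2) U W.
Proof. by move=> s1 s2 i; rewrite !mxE; case: split => j. Qed.

Lemma lsub_l m n1 n2 (U' W' : 'cV[V]_m) (U W : 'cV[V]_n1) (U2 W2 : 'cV[V]_n2) :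
  lsub U' W' U W -> lsub U' W' (col_mx U U2) (col_mx W W2).
Proof.
move=> s i; have [w [-> ->]] := s i; exists (row_mx w 0).
by rewrite map_row_mx pm0 !mul_row_col !mul0mx !addr0.
Qed.

Lemma lsub_r m n1 n2 (U' W' : 'cV[V]_m) (U W : 'cV[V]_n1) (U2 W2 : 'cV[V]_n2) :
  lsub U' W' U W -> lsub U' W' (col_mx U2 U) (col_mx W2 W).
Proof.
move=> s i; have [w [-> ->]] := s i; exists (row_mx 0 w).
by rewrite map_row_mx pm0 !mul_row_col !mul0mx !add0r.
Qed.

Lemma lm_row l n (w : 'rV[R]_n) (U : 'cV[V]_n) : lm l ((pm w *m U) 0 0) = (w *m Mm l U) 0 0.
Proof. by rewrite -Mm_mul [RHS]mxE. Qed.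

Lemma lc_row l n (w w' : 'rV[R]_n) (U : 'cV[V]_n) :
  lc l ((pm w *m U) 0 0) ((pm w' *m U) 0 0) = (w *m Cm l U U *m w'^T) 0 0.
Proof. by rewrite -Cm_mull -Cm_mulr [RHS]mxE. Qed.

Section Equal.
Variables (l1 l2 : law R) (n : nat) (U W : 'cV[V]_n).
Hypothesis eq : law_eq l1 l2 U W.

Lemma lcomb_mean x y : lcomb U W x y -> lm l1 x = lm l2 y.
Proof. by move=> [w [-> ->]]; rewrite !lm_row eq.1. Qed.

Lemma lcomb_cov x y x' y' : lcomb U W x y -> lcomb U W x' y' -> lc l1 x x' = lc l2 y y'.
Proof. by move=> [w [-> ->]] [w' [-> ->]]; rewrite !lc_row eq.2. Qed.

Lemma law_eq_lsub m (U' W' : 'cV[V]_m) : lsub U' W' U W -> law_eq l1 l2 U' W'.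
Proof.
move=> s; split; first by apply/colP => i; rewrite !mxE; apply: lcomb_mean.
by apply/matrixP => i j; rewrite !mxE; apply: lcomb_cov.
Qed.

End Equal.

Definition lmatch n (U W : 'cV[V]_n) (o1 o2 : option (law R)) : Prop :=
  match o1, o2 with
  | Some l1, Some l2 => law_eq l1 l2 U W
  | None, None => True
  | _, _ => False
  end.

Lemma lmatch_bind m n (U W : 'cV[V]_m) (U' W' : 'cV[V]_n) l1 l2 k1 k2 k1' k2' :
  lmatch U W (condl l1 k1) (condl l2 k2) ->
  (forall l1' l2', condl l1 k1 = Some l1' -> condl l2 k2 = Some l2' ->
     law_eq l1' l2' U W -> lmatch U' W' (condl l1' k1') (condl l2' k2')) ->
  lmatch U' W' (condl l1 (k1 ++ k1')) (condl l2 (k2 ++ k2')).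
Proof.
rewrite !condl_cat; case: (condl l1 k1) => [l1'|]; case: (condl l2 k2) => [l2'|] //=.
by move=> le H; apply: H.
Qed.

Lemma lmatch_lsub m n (U W : 'cV[V]_n) (U' W' : 'cV[V]_m) o1 o2 :
  lsub U' W' U W -> lmatch U W o1 o2 -> lmatch U' W' o1 o2.
Proof. by case: o1 => [l1|]; case: o2 => [l2|] //= s e; apply: law_eq_lsub e _ _ _ s. Qed.

Lemma lmatch_cond n (U W : 'cV[V]_n) l1 l2 x y : law_eq l1 l2 U W -> lcomb U W x y ->
  lmatch U W (condl l1 [:: x]) (condl l2 [:: y]).
Proof.
move=> eq xy; rewrite /= /lcond1 (lcomb_mean eq xy) (lcomb_cov eq xy xy).
case: ifP => //= _; have r i : lcomb U W (U i 0) (W i 0) by apply: lsub_refl.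
split.
  apply/colP => i; rewrite !mxE /= /clm (lcomb_mean eq xy) (lcomb_mean eq (r i)).
  by rewrite (lcomb_cov eq (r i) xy) (lcomb_cov eq xy xy).
apply/matrixP => i j; rewrite !mxE /= /clc (lcomb_cov eq (r i) (r j)).
by rewrite !(lcomb_cov eq (r _) xy) (lcomb_cov eq xy xy).
Qed.

Definition anyI : term -> Prop := fun _ => True.

(* Semantic typing: nothing is required of values of type [TI]. *)
Definition sem_typed G t e := forall rho r, wte anyI r G rho ->
  exists v ks s, [/\ ev rho e r = (v, ks, (r + s)%N), wt anyI (r + s) t v,
    forall k, k \in ks -> old (r + s) k & wte anyI (r + s) G rho].

Lemma has_type_sem_typed G t e : has_type G e t -> sem_typed G t e.
Proof.
move=> he rho r wr; have [F _ /(_ anyI rho r I wr)] := adequacy he.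
move=> [v [ks [s [E wv o _]]]]; exists v, ks, s; split=> //.
by apply: wte_le wr; rewrite leq_addr.
Qed.

(* [e1] and [e2] take environments with equal joint laws (jointly with any frame
   [A1], [A2]) to the same failure or to results with equal joint laws. *)
Definition lequiv G t e1 e2 := [/\ sem_typed G t e1, sem_typed G t e2 &
  forall a (A1 A2 : 'cV[V]_a) l1 l2 r1 r2 rho1 rho2,
    fresh l1 r1 -> fresh l2 r2 ->
    (forall i, old r1 (A1 i 0)) -> (forall i, old r2 (A2 i 0)) ->
    wte anyI r1 G rho1 -> wte anyI r2 G rho2 ->
    law_eq l1 l2 (col_mx A1 (eflat G rho1)) (col_mx A2 (eflat G rho2)) ->
    let: (v1, k1, _) := ev rho1 e1 r1 in
    let: (v2, k2, _) := ev rho2 e2 r2 in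
    lmatch (col_mx A1 (vflat t v1)) (col_mx A2 (vflat t v2)) (condl l1 k1) (condl l2 k2)].

(** The joint law of frame and environment in the middle of a run is turned into a prior without
    observations, to which [cond_equiv] can be applied. *)
Lemma pure_inference l a m n (F : cmor R m n) r s (A : 'cV[V]_a) (X : 'cV[V]_m) (Y : 'cV[V]_n) ks :
  fresh l r -> (forall i, old r (A i 0)) -> (forall i, old r (X i 0)) ->
  creal F r s X Y ks ->
  let: U := col_mx A X in
  let: P := ccomp (ctens (cid R a) F) (J (GMor 0 (Mm l U) (Cm l U U))) in
  if condl l ks is Some l' then
    succeeds P /\ exists2 phi, posterior P phi &
      forall phi', posterior P phi' -> realizes l' phi' (col_mx A Y)
  else ~ succeeds P.
Proof.
move=> f oA oX cF.
apply: (inference (K := 0) f oA oX _ _ cF) => [[]//||].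
  have -> : col_mx (col_mx A X) (0 : 'cV_0) = castmx (esym (addn0 _), erefl) (col_mx A X).
    by apply: colseqP; rewrite colseq_cast colseq_col_mx colseq0 cats0.
  exact: realizes_cast.
by rewrite colseq0 cats0.
Qed.

(** The alternative [F1 = F2] is for reflexivity: [cond_equiv F F] includes uniqueness of
    posteriors, which is obtained here by realizing them in a common law. *)
Lemma lequiv_base G t e1 e2 (F1 F2 : cmor R (dimc G) (dimt t)) :
  has_type G e1 t -> has_type G e2 t -> denotes e1 F1 -> denotes e2 F2 ->
  cond_equiv F1 F2 \/ F1 = F2 -> lequiv G t e1 e2.
Proof.
move=> h1 h2 d1 d2 E; split; [exact: has_type_sem_typed | exact: has_type_sem_typed |].
move=> a A1 A2 l1 l2 r1 r2 rho1 rho2 f1 f2 o1 o2 wr1 wr2 eq.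
have [v1 [k1 [s1 [-> _ _ c1]]]] := d1 anyI rho1 r1 I wr1.
have [v2 [k2 [s2 [-> _ _ c2]]]] := d2 anyI rho2 r2 I wr2.
set X1 := eflat G rho1 in eq c1; set X2 := eflat G rho2 in eq c2.
have := pure_inference f1 o1 (old_eflat wr1) c1.
have := pure_inference f2 o2 (old_eflat wr2) c2.
(* Equality of the joint laws means that both runs pose the same prior. *)
rewrite -/X1 -/X2 -eq.1 -eq.2; set Psi := J _.
set P1 := ccomp (ctens _ F1) _; set P2 := ccomp (ctens _ F2) _.
have [sP pP] : (succeeds P1 <-> succeeds P2) /\
    forall l' phi1 phi2, posterior P1 phi1 -> posterior P2 phi2 ->
      (forall phi', posterior P1 phi' -> realizes l' phi' (col_mx A1 (vflat t v1))) ->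
      phi1 = phi2.
  case: E => [E|E].
    have [] : psd (gS (cf Psi)).
      rewrite /Psi /J /=; case: _ / (esym (addn0 _)); rewrite castmx_id.
      exact: Cm_psd.
    move=> p1 p2; have [sE pE] := E a Psi (conj p1 p2).
    by split=> // l' phi1 phi2 q1 q2 _; apply: pE.
  split=> [|l' phi1 phi2]; rewrite /P1 /P2 E // => q1 q2 H.
  exact: realizes_fun (H _ q1) (H _ q2).
rewrite /lmatch; case: (condl l1 k1) => [l1'|]; case: (condl l2 k2) => [l2'|] //=.
- move=> [_ [phi2 q2 H2]] [_ [phi1 q1 H1]].
  have e : phi1 = phi2 by apply: pP q1 q2 H1.
  have [m1 c1'] := H1 _ q1; have [m2 c2'] := H2 _ q2.
  by split; rewrite -?m1 -?c1' e.
- by move=> n2 [/sP].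
- by move=> [/sP].
Qed.

Lemma lequiv_refl G t e : has_type G e t -> lequiv G t e e.
Proof.
by move=> h; have [F _ d] := adequacy h; apply: (lequiv_base h h d d); right.
Qed.

End LawEquivalence.

(** * Congruence *)

Section Congruence.
Variable R : realType.
Local Notation V := {poly R}.
Local Notation pm := (map_mx (@polyC R)).
Local Notation term := (term R).
Local Notation env := (seq (nat * term)).
Implicit Types (e v w a b : term) (G D : tctx) (t : ty) (r s : nat) (l : law R).

(** Covers the environments in which a second subterm is evaluated: unchanged, extended by a let, or
    by a destructuring let. In each, the new entries depend linearly on the old ones and the value,
    with the same coefficients in both runs. *)
Definition env_ext G t G' (ext : env -> term -> env) :=
  (forall r rho v, wte (@anyI R) r G rho -> wt (@anyI R) r t v -> wte (@anyI R) r G' (ext rho v)) /\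
  (forall rho1 rho2 v1 v2, lsub (eflat G' (ext rho1 v1)) (eflat G' (ext rho2 v2))
     (col_mx (eflat G rho1) (vflat t v1)) (col_mx (eflat G rho2) (vflat t v2))).

Lemma env_ext_id G t : env_ext G t G (fun rho _ => rho).
Proof. by split=> // *; apply/lsub_l/lsub_refl. Qed.

Lemma env_ext_let G t x : env_ext G t ((x, t) :: G) (fun rho v => (x, v) :: rho).
Proof. by split=> //= *; apply: lsub_refl. Qed.

Lemma env_ext_letp G t1 t2 x y : env_ext G (TPair t1 t2) ((y, t2) :: (x, t1) :: G)
  (fun rho v => (y, psnd v) :: (x, pfst v) :: rho).
Proof.
split=> [r rho v wr [_ [w1 w2]] //|rho1 rho2 v1 v2 /=].
apply: lsub_col; last by apply/lsub_r/lsub_r/lsub_refl.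
by apply: lsub_col; [apply/lsub_l | apply/lsub_r/lsub_l]; apply: lsub_refl.
Qed.

Section Sequencing.
Variables (G : tctx) (t1 : ty) (G' : tctx) (t2 : ty) (ext : env -> term -> env).
Hypothesis extP : env_ext G t1 G' ext.

Lemma sem_typed_seq a b : sem_typed G t1 a -> sem_typed G' t2 b -> forall rho r, wte (@anyI R) r G rho ->
  exists v k s w k' s', [/\ ev rho a r = (v, k, (r + s)%N),
    ev (ext rho v) b (r + s) = (w, k', (r + (s + s'))%N),
    wt (@anyI R) (r + (s + s')) t1 v /\ wt (@anyI R) (r + (s + s')) t2 w,
    forall x, x \in k ++ k' -> old (r + (s + s')) x & wte (@anyI R) (r + (s + s')) G rho].
Proof.
move=> ga gb rho r wr; have [v [k [s [E wv ok wr']]]] := ga rho r wr.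
have [w [k' [s' [E' ww ok' _]]]] := gb _ _ (extP.1 _ _ _ wr' wv).
exists v, k, s, w, k', s'; rewrite addnA; split=> //.
- by split=> //; apply: wt_le wv; rewrite leq_addr.
- move=> x; rewrite mem_cat => /orP[/ok|/ok' //].
  by apply: old_le; rewrite leq_addr.
- by apply: wte_le wr'; rewrite leq_addr.
Qed.

(** For the first subterm the environment is added to the frame, so that its correlation with the
    result survives; for the second, the first result is added instead. *)
Lemma lequiv_seq a1 a2 b1 b2 : lequiv G t1 a1 a2 -> lequiv G' t2 b1 b2 ->
  forall n (A1 A2 : 'cV[V]_n) l1 l2 r1 r2 rho1 rho2,
    fresh l1 r1 -> fresh l2 r2 ->
    (forall i, old r1 (A1 i 0)) -> (forall i, old r2 (A2 i 0)) ->
    wte (@anyI R) r1 G rho1 -> wte (@anyI R) r2 G rho2 ->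
    law_eq l1 l2 (col_mx A1 (eflat G rho1)) (col_mx A2 (eflat G rho2)) ->
    let: (v1, k1, r1') := ev rho1 a1 r1 in
    let: (v2, k2, r2') := ev rho2 a2 r2 in
    let: (w1, k1', _) := ev (ext rho1 v1) b1 r1' in
    let: (w2, k2', _) := ev (ext rho2 v2) b2 r2' in
    lmatch (col_mx (col_mx A1 (vflat t1 v1)) (vflat t2 w1))
           (col_mx (col_mx A2 (vflat t1 v2)) (vflat t2 w2))
           (condl l1 (k1 ++ k1')) (condl l2 (k2 ++ k2')).
Proof.
move=> [ga1 ga2 Ha] [gb1 gb2 Hb] n A1 A2 l1 l2 r1 r2 rho1 rho2 f1 f2 o1 o2 wr1 wr2 eq.
have oC r (A : 'cV[V]_n) m (X : 'cV[V]_m) : (forall i, old r (A i 0)) ->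
    (forall i, old r (X i 0)) -> forall i, old r (col_mx A X i 0).
  by move=> oA oX i; rewrite mxE; case: split.
have := Ha _ (col_mx A1 (eflat G rho1)) (col_mx A2 (eflat G rho2)) l1 l2 r1 r2 rho1 rho2 f1 f2
  (oC _ _ _ _ o1 (old_eflat wr1)) (oC _ _ _ _ o2 (old_eflat wr2)) wr1 wr2.
have [v1 [k1 [s1 [-> wv1 ok1 wr1']]]] := ga1 _ _ wr1.
have [v2 [k2 [s2 [-> wv2 ok2 wr2']]]] := ga2 _ _ wr2.
have we1 := extP.1 _ _ _ wr1' wv1; have we2 := extP.1 _ _ _ wr2' wv2.
move=> Ma; have {Ma} := Ma _.
case E1 : (ev (ext rho1 v1) b1 _) => [[w1 k1'] r1']; case E2 : (ev (ext rho2 v2) b2 _) => [[w2 k2'] r2'].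
move=> M; apply: (lmatch_bind (M _)).
  apply: (law_eq_lsub eq); apply: lsub_col; last by apply/lsub_r/lsub_refl.
  exact: lsub_refl.
move=> l1' l2' c1 c2 eq'.
have old1 i : old (r1 + s1) (A1 i 0) by apply: old_le (o1 i); rewrite leq_addr.
have old2 i : old (r2 + s2) (A2 i 0) by apply: old_le (o2 i); rewrite leq_addr.
have fr1 : fresh l1' (r1 + s1).
  by apply: fresh_condl ok1 c1 _; apply: fresh_le f1; rewrite leq_addr.
have fr2 : fresh l2' (r2 + s2).
  by apply: fresh_condl ok2 c2 _; apply: fresh_le f2; rewrite leq_addr.
have := Hb _ (col_mx A1 (vflat t1 v1)) (col_mx A2 (vflat t1 v2)) l1' l2' _ _ _ _ fr1 fr2
  (oC _ _ _ _ old1 (old_vflat wv1)) (oC _ _ _ _ old2 (old_vflat wv2)) we1 we2.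
rewrite E1 E2; apply.
apply: (law_eq_lsub eq'); apply: lsub_col.
  apply: lsub_col; last exact/lsub_r/lsub_refl.
  by apply/lsub_l/lsub_l/lsub_refl.
(* Transitivity of [lsub]: the combination is expanded and each term expressed through [S]. *)
move=> i; have [w [-> ->]] := extP.2 rho1 rho2 v1 v2 i.
have S : lsub (col_mx (eflat G rho1) (vflat t1 v1)) (col_mx (eflat G rho2) (vflat t1 v2))
   (col_mx (col_mx A1 (eflat G rho1)) (vflat t1 v1)) (col_mx (col_mx A2 (eflat G rho2)) (vflat t1 v2)).
  by apply: lsub_col; [apply/lsub_l/lsub_r/lsub_refl | apply/lsub_r/lsub_refl].
rewrite mxE [X in lcomb _ _ _ X]mxE.
elim/big_ind2: _ => [|x y x' y' h h'|j _]; [exact: lcomb0 | exact: lcombD |].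
have -> : pm w 0 j = (w 0 j)%:P by rewrite mxE.
by rewrite !mul_polyC; apply: lcombZ; apply: S.
Qed.

End Sequencing.

Lemma lequiv_plus G a1 a2 b1 b2 :
  lequiv G TR a1 a2 -> lequiv G TR b1 b2 -> lequiv G TR (Plus a1 b1) (Plus a2 b2).
Proof.
have gP a b : sem_typed G TR a -> sem_typed G TR b -> sem_typed G TR (Plus a b).
  move=> ga gb rho r /(sem_typed_seq (env_ext_id G TR) ga gb).
  move=> [v [k [s [w [k' [s' [/= -> -> [wv ww] o wr]]]]]]].
  by exists (Plus v w), (k ++ k'), (s + s')%N; split=> //=; rewrite wv.
move=> la lb; case: (la) (lb) => ga1 ga2 _ [gb1 gb2 _].
split; [exact: gP | exact: gP |].
move=> n A1 A2 l1 l2 r1 r2 rho1 rho2 f1 f2 o1 o2 wr1 wr2 eq.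
have := lequiv_seq (env_ext_id G TR) la lb f1 f2 o1 o2 wr1 wr2 eq => /=.
case: (ev rho1 a1 r1) => [[v1 k1] r1']; case: (ev rho2 a2 r2) => [[v2 k2] r2'].
case: (ev rho1 b1 r1') => [[w1 k1'] r1'']; case: (ev rho2 b2 r2') => [[w2 k2'] r2''].
apply: lmatch_lsub; apply: lsub_col; first exact/lsub_l/lsub_l/lsub_refl.
move=> i; rewrite !mxE; apply: lcombD.
  have := lsub_l (const_mx (paff w1)) (const_mx (paff w2)) (lsub_r A1 A2
     (@lsub_refl R _ (const_mx (paff v1) : 'cV_1) (const_mx (paff v2)))) 0.
  by rewrite !mxE.
have := lsub_r (col_mx A1 (const_mx (paff v1))) (col_mx A2 (const_mx (paff v2)))
     (@lsub_refl R _ (const_mx (paff w1) : 'cV_1) (const_mx (paff w2))) 0.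
by rewrite !mxE.
Qed.

Lemma lequiv_pair G t1 t2 a1 a2 b1 b2 :
  lequiv G t1 a1 a2 -> lequiv G t2 b1 b2 -> lequiv G (TPair t1 t2) (Pair a1 b1) (Pair a2 b2).
Proof.
have gP a b : sem_typed G t1 a -> sem_typed G t2 b -> sem_typed G (TPair t1 t2) (Pair a b).
  move=> ga gb rho r /(sem_typed_seq (env_ext_id G t1) ga gb).
  move=> [v [k [s [w [k' [s' [/= -> -> [wv ww] o wr]]]]]]].
  by exists (Pair v w), (k ++ k'), (s + s')%N; split=> //=; rewrite wv.
move=> la lb; case: (la) (lb) => ga1 ga2 _ [gb1 gb2 _].
split; [exact: gP | exact: gP |].
move=> n A1 A2 l1 l2 r1 r2 rho1 rho2 f1 f2 o1 o2 wr1 wr2 eq.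
have := lequiv_seq (env_ext_id G t1) la lb f1 f2 o1 o2 wr1 wr2 eq => /=.
case: (ev rho1 a1 r1) => [[v1 k1] r1']; case: (ev rho2 a2 r2) => [[v2 k2] r2'].
case: (ev rho1 b1 r1') => [[w1 k1'] r1'']; case: (ev rho2 b2 r2') => [[w2 k2'] r2''].
apply: lmatch_lsub; apply: lsub_col; first exact/lsub_l/lsub_l/lsub_refl.
by apply: lsub_col; [apply/lsub_l/lsub_r/lsub_refl | apply/lsub_r/lsub_refl].
Qed.

Lemma lequiv_cond G a1 a2 b1 b2 :
  lequiv G TR a1 a2 -> lequiv G TR b1 b2 -> lequiv G TI (CondE a1 b1) (CondE a2 b2).
Proof.
have gP a b : sem_typed G TR a -> sem_typed G TR b -> sem_typed G TI (CondE a b).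
  move=> ga gb rho r /(sem_typed_seq (env_ext_id G TR) ga gb).
  move=> [v [k [s [w [k' [s' [/= -> -> [wv ww] o wr]]]]]]].
  exists (Unt R), (k ++ k' ++ [:: paff v - paff w]), (s + s')%N; split=> //= x.
  rewrite catA mem_cat inE => /orP[/o //|/eqP->].
  by apply: oldB; apply: paff_old.
move=> la lb; case: (la) (lb) => ga1 ga2 _ [gb1 gb2 _].
split; [exact: gP | exact: gP |].
move=> n A1 A2 l1 l2 r1 r2 rho1 rho2 f1 f2 o1 o2 wr1 wr2 eq.
have := lequiv_seq (env_ext_id G TR) la lb f1 f2 o1 o2 wr1 wr2 eq => /=.
case: (ev rho1 a1 r1) => [[v1 k1] r1']; case: (ev rho2 a2 r2) => [[v2 k2] r2'].
case: (ev rho1 b1 r1') => [[w1 k1'] r1'']; case: (ev rho2 b2 r2') => [[w2 k2'] r2''].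
rewrite !catA => M; apply: (lmatch_bind M) => l1' l2' _ _ eq'.
have c : lcomb (col_mx (col_mx A1 (vflat TR v1)) (vflat TR w1))
   (col_mx (col_mx A2 (vflat TR v2)) (vflat TR w2)) (paff v1 - paff w1) (paff v2 - paff w2).
  apply: lcombB.
    have := lsub_l (vflat TR w1) (vflat TR w2) (lsub_r A1 A2
       (lsub_refl (vflat TR v1) (vflat TR v2))) 0.
    by rewrite !mxE.
  have := lsub_r (col_mx A1 (vflat TR v1)) (col_mx A2 (vflat TR v2))
       (lsub_refl (vflat TR w1) (vflat TR w2)) 0.
  by rewrite !mxE.
apply: lmatch_lsub (lmatch_cond eq' c); apply: lsub_col; first exact/lsub_l/lsub_l/lsub_refl.
by case.
Qed.

Lemma lequiv_scale G c a1 a2 :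
  lequiv G TR a1 a2 -> lequiv G TR (Scale c a1) (Scale c a2).
Proof.
have gP a : sem_typed G TR a -> sem_typed G TR (Scale c a).
  move=> ga rho r /ga[v [k [s [/= -> wv o wr]]]].
  by exists (Scale c v), k, s.
move=> [ga1 ga2 H]; split; [exact: gP | exact: gP |].
move=> n A1 A2 l1 l2 r1 r2 rho1 rho2 f1 f2 o1 o2 wr1 wr2 eq.
have := H n A1 A2 l1 l2 r1 r2 rho1 rho2 f1 f2 o1 o2 wr1 wr2 eq => /=.
case: (ev rho1 a1 r1) => [[v1 k1] r1']; case: (ev rho2 a2 r2) => [[v2 k2] r2'].
apply: lmatch_lsub; apply: lsub_col; first exact/lsub_l/lsub_refl.
move=> i; rewrite !mxE; apply: lcombZ.
have := lsub_r A1 A2 (@lsub_refl R _ (const_mx (paff v1) : 'cV_1) (const_mx (paff v2))) 0.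
by rewrite !mxE.
Qed.

Lemma lequiv_let G x t1 t2 a1 a2 b1 b2 :
  lequiv G t1 a1 a2 -> lequiv ((x, t1) :: G) t2 b1 b2 ->
  lequiv G t2 (Let x a1 b1) (Let x a2 b2).
Proof.
have X := env_ext_let G t1 x.
have gP a b : sem_typed G t1 a -> sem_typed ((x, t1) :: G) t2 b -> sem_typed G t2 (Let x a b).
  move=> ga gb rho r /(sem_typed_seq X ga gb).
  move=> [v [k [s [w [k' [s' [/= -> -> [wv ww] o wr]]]]]]].
  by exists w, (k ++ k'), (s + s')%N.
move=> la lb; case: (la) (lb) => ga1 ga2 _ [gb1 gb2 _].
split; [exact: gP | exact: gP |].
move=> n A1 A2 l1 l2 r1 r2 rho1 rho2 f1 f2 o1 o2 wr1 wr2 eq.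
have := lequiv_seq X la lb f1 f2 o1 o2 wr1 wr2 eq => /=.
case: (ev rho1 a1 r1) => [[v1 k1] r1']; case: (ev rho2 a2 r2) => [[v2 k2] r2'].
case: (ev _ b1 r1') => [[w1 k1'] r1'']; case: (ev _ b2 r2') => [[w2 k2'] r2''].
apply: lmatch_lsub; apply: lsub_col; first exact/lsub_l/lsub_l/lsub_refl.
exact/lsub_r/lsub_refl.
Qed.

Lemma lequiv_letp G x y t1 t2 t3 a1 a2 b1 b2 :
  lequiv G (TPair t1 t2) a1 a2 -> lequiv ((y, t2) :: (x, t1) :: G) t3 b1 b2 ->
  lequiv G t3 (LetP x y a1 b1) (LetP x y a2 b2).
Proof.
have X := env_ext_letp G t1 t2 x y.
have gP a b : sem_typed G (TPair t1 t2) a -> sem_typed ((y, t2) :: (x, t1) :: G) t3 b ->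
    sem_typed G t3 (LetP x y a b).
  move=> ga gb rho r /(sem_typed_seq X ga gb).
  move=> [v [k [s [w [k' [s' [/= -> -> [wv ww] o wr]]]]]]].
  by exists w, (k ++ k'), (s + s')%N.
move=> la lb; case: (la) (lb) => ga1 ga2 _ [gb1 gb2 _].
split; [exact: gP | exact: gP |].
move=> n A1 A2 l1 l2 r1 r2 rho1 rho2 f1 f2 o1 o2 wr1 wr2 eq.
have := lequiv_seq X la lb f1 f2 o1 o2 wr1 wr2 eq => /=.
case: (ev rho1 a1 r1) => [[v1 k1] r1']; case: (ev rho2 a2 r2) => [[v2 k2] r2'].
case: (ev _ b1 r1') => [[w1 k1'] r1'']; case: (ev _ b2 r2') => [[w2 k2'] r2''].
apply: lmatch_lsub; apply: lsub_col; first exact/lsub_l/lsub_l/lsub_refl.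
exact/lsub_r/lsub_refl.
Qed.

End Congruence.

(** * Soundness *)

Section Soundness.
Variable R : realType.
Local Notation V := {poly R}.
Local Notation term := (term R).
Local Notation env := (seq (nat * term)).
Implicit Types (e v w a b : term) (G D : tctx) (s t : ty) (r : nat) (l : law R) (K : ctx R).

Lemma has_type_fun G e t t' : has_type G e t -> has_type G e t' -> t = t'.
Proof.
move=> h; elim: h t' => {G e t}.
- by move=> G x t lx t' h; inversion h; subst; move: H1; rewrite lx => -[].
- by move=> G e1 e2 _ _ _ _ t' h; inversion h.
- by move=> G a e _ _ t' h; inversion h.
- by move=> G b t' h; inversion h.
- by move=> G e1 e2 t1 t2 _ IH1 _ IH2 t' h; inversion h; subst; rewrite (IH1 _ H2) (IH2 _ H4).
- by move=> G t' h; inversion h.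
- move=> G x e1 e2 t1 t2 _ IH1 _ IH2 t' h; inversion h; subst.
  by have e := IH1 _ H4; subst; apply: IH2.
- move=> G x y e1 e2 t1 t2 t3 _ IH1 _ IH2 t' h; inversion h; subst.
  by have [e e'] := IH1 _ H5; subst; apply: IH2.
- by move=> G t' h; inversion h.
- by move=> G e1 e2 _ _ _ _ t' h; inversion h.
Qed.

(* [kty G K t' D t]: filling [K] with a term of type [t] in context [D] gives a
   term of type [t'] in context [G]. *)
Inductive kty : tctx -> ctx R -> ty -> tctx -> ty -> Prop :=
| K_Hole G t : kty G (Hole R) t G t
| K_PlusL G K a D t : kty G K TR D t -> has_type G a TR -> kty G (CPlusL K a) TR D t
| K_PlusR G K a D t : kty G K TR D t -> has_type G a TR -> kty G (CPlusR a K) TR D t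
| K_Scale G K c D t : kty G K TR D t -> kty G (CScale c K) TR D t
| K_PairL G K a D t t1 t2 : kty G K t1 D t -> has_type G a t2 ->
    kty G (CPairL K a) (TPair t1 t2) D t
| K_PairR G K a D t t1 t2 : kty G K t2 D t -> has_type G a t1 ->
    kty G (CPairR a K) (TPair t1 t2) D t
| K_Let1 G x K a D t t1 t2 : kty G K t1 D t -> has_type ((x, t1) :: G) a t2 ->
    kty G (CLet1 x K a) t2 D t
| K_Let2 G x K a D t t1 t2 : has_type G a t1 -> kty ((x, t1) :: G) K t2 D t ->
    kty G (CLet2 x a K) t2 D t
| K_LetP1 G x y K a D t t1 t2 t3 : kty G K (TPair t1 t2) D t ->
    has_type ((y, t2) :: (x, t1) :: G) a t3 -> kty G (CLetP1 x y K a) t3 D t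
| K_LetP2 G x y K a D t t1 t2 t3 : has_type G a (TPair t1 t2) ->
    kty ((y, t2) :: (x, t1) :: G) K t3 D t -> kty G (CLetP2 x y a K) t3 D t
| K_CondL G K a D t : kty G K TR D t -> has_type G a TR -> kty G (CCondL K a) TI D t
| K_CondR G K a D t : kty G K TR D t -> has_type G a TR -> kty G (CCondR a K) TI D t.

Lemma plug_kty K G e t' : has_type G (plug K e) t' ->
  exists D t, kty G K t' D t /\ has_type D e t.
Proof.
elim: K G t' => [|K IH a|a K IH|c K IH|K IH a|a K IH|x K IH a|x a K IH|x y K IH a|x y a K IH
  |K IH a|a K IH] G t' /= h.
1: by exists G, t'; split=> //; apply: K_Hole.
all: inversion h; subst.
all: match goal with H : has_type _ (plug _ _) _ |- _ =>
  have [D [t [k he]]] := IH _ _ H; exists D, t; split=> // end.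
all: econstructor; eassumption.
Qed.

(** The type of the hole may vary, but binders above it take their types from terms without a hole,
    where types are unique. *)
Lemma kty_ctx_fun K G t1' D1 t1 t2' D2 t2 : kty G K t1' D1 t1 -> kty G K t2' D2 t2 -> D1 = D2.
Proof.
move=> h; elim: h t2' D2 t2 => {K G t1' D1 t1}.
all: try by move=> *; match goal with H : kty _ _ _ _ _ |- _ => inversion H; subst; eauto end.
- move=> G x K a D t u1 u2 ha _ IH t2' D2 t2 h; inversion h; subst.
  match goal with H : has_type G a _ |- _ => have e := has_type_fun ha H end.
  by subst; eauto.
- move=> G x y K a D t u1 u2 u3 ha _ IH t2' D2 t2 h; inversion h; subst.
  match goal with H : has_type G a _ |- _ => have [e e'] := has_type_fun ha H end.
  by subst; eauto.
Qed.

Lemma lequiv_plug K G D t t' e1 e2 : kty G K t' D t -> lequiv D t e1 e2 ->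
  lequiv G t' (plug K e1) (plug K e2).
Proof.
move=> k le; elim: k le => {K G t' D t} //=.
- by move=> G K a D t k IH ha le; apply: lequiv_plus; [apply: IH | apply: lequiv_refl].
- by move=> G K a D t k IH ha le; apply: lequiv_plus; [apply: lequiv_refl | apply: IH].
- by move=> G K c D t k IH le; apply: lequiv_scale; apply: IH.
- by move=> G K a D t t1 t2 k IH ha le; apply: lequiv_pair; [apply: IH | apply: lequiv_refl].
- by move=> G K a D t t1 t2 k IH ha le; apply: lequiv_pair; [apply: lequiv_refl | apply: IH].
- by move=> G x K a D t t1 t2 k IH ha le; apply: lequiv_let (IH le) (lequiv_refl ha).
- by move=> G x K a D t t1 t2 ha k IH le; apply: lequiv_let (lequiv_refl ha) (IH le).
- by move=> G x y K a D t t1 t2 t3 k IH ha le; apply: lequiv_letp (IH le) (lequiv_refl ha).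
- by move=> G x y K a D t t1 t2 t3 ha k IH le; apply: lequiv_letp (lequiv_refl ha) (IH le).
- by move=> G K a D t k IH ha le; apply: lequiv_cond; [apply: IH | apply: lequiv_refl].
- by move=> G K a D t k IH ha le; apply: lequiv_cond; [apply: lequiv_refl | apply: IH].
Qed.

(* A variable of type [TI] cannot be used, so a context accepting all terms typed in
   [G] may still bind it at another type: [tle] replaces occurrences of [TI]. *)
Fixpoint tle (t t' : ty) : Prop :=
  match t, t' with
  | TI, _ => True
  | TR, TR => True
  | TPair a b, TPair a' b' => tle a a' /\ tle b b'
  | _, _ => False
  end.

Definition ctx_le G D := forall x s, lookup G x = Some s ->
  exists2 s', lookup D x = Some s' & tle s s'.

Fixpoint inhab t : term :=
  match t with
  | TR => Const 0
  | TI => Unt R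
  | TPair a b => Pair (inhab a) (inhab b)
  end.

Lemma inhab_typed G t : has_type G (inhab t) t.
Proof. by elim: t => [||a IHa b IHb] /=; constructor. Qed.

(* Uses the variable [x] as fully as the type [s] permits. *)
Fixpoint probe s (x : nat) : term :=
  match s with
  | TR => Scale 1 (Var R x)
  | TI => Let 0 (Var R x) (Unt R)
  | TPair a b => LetP 0 1 (Var R x) (Pair (probe a 0) (probe b 1))
  end.

Lemma probe_typed s G x : lookup G x = Some s -> has_type G (probe s x) s.
Proof.
elim: s G x => [||a IHa b IHb] G x lx /=.
- by do 2 constructor.
- by apply: T_Let; [apply: T_Var lx | constructor].
- apply: T_LetP; first by apply: T_Var lx.
  by constructor; [apply: IHa | apply: IHb].
Qed.

Lemma probe_inv s D t x : has_type D (probe s x) t ->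
  exists2 s', lookup D x = Some s' & tle s s'.
Proof.
elim: s D t x => [||a IHa b IHb] D t x h; inversion h; subst.
- by match goal with H : has_type D _ _ |- _ => inversion H; subst end; exists TR.
- match goal with H : has_type D _ _ |- _ => inversion H; subst end.
  by eexists; [eassumption|].
- match goal with H : has_type D _ _ |- _ => inversion H; subst end.
  match goal with H : has_type (_ :: _) _ _ |- _ => inversion H; subst end.
  eexists; first eassumption.
  match goal with H : has_type _ (probe a _) _ |- _ => have [_ [<-] ta] := IHa _ _ _ H end.
  by match goal with H : has_type _ (probe b _) _ |- _ => have [_ [<-] tb] := IHb _ _ _ H end.
Qed.

(** Filling the hole with [inhab t] reveals [D] and the type of the hole; probing terms then reveal
    how [D] types each variable of [G]. *)
Lemma ctx_typed_kty K G t t' : ctx_typed K G t t' ->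
  exists2 D, kty [::] K t' D t & ctx_le G D.
Proof.
move=> ct; have [D [t1 [k h]]] := plug_kty (ct _ (inhab_typed G t)).
have e := has_type_fun h (inhab_typed D t); subst t1; exists D => // x s lx.
(* The let discards the probe, so the filler has type [t] again. *)
have hp : has_type G (Let 0 (probe s x) (inhab t)) t.
  by apply: T_Let (inhab_typed _ _); apply: probe_typed.
have [D' [t1 [k' h']]] := plug_kty (ct _ hp).
have e := kty_ctx_fun k k'; subst D'.
by inversion h'; subst; apply: probe_inv; eassumption.
Qed.

Lemma ev_ext G e t : has_type G e t -> forall rho rho' r,
  (forall x s, lookup G x = Some s -> elook rho x = elook rho' x) ->
  ev rho e r = ev rho' e r.
Proof.
elim=> {G e t} //=.
- by move=> G x t lx rho rho' r E; rewrite (E _ _ lx).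
- move=> G e1 e2 _ IH1 _ IH2 rho rho' r E; rewrite (IH1 _ _ _ E).
  by case: (ev rho' e1 r) => [[v k] r1]; rewrite (IH2 _ _ _ E).
- by move=> G a e _ IH rho rho' r E; rewrite (IH _ _ _ E).
- move=> G e1 e2 t1 t2 _ IH1 _ IH2 rho rho' r E; rewrite (IH1 _ _ _ E).
  by case: (ev rho' e1 r) => [[v k] r1]; rewrite (IH2 _ _ _ E).
- move=> G x e1 e2 t1 t2 _ IH1 _ IH2 rho rho' r E; rewrite (IH1 _ _ _ E).
  case: (ev rho' e1 r) => [[v k] r1]; rewrite (IH2 _ ((x, v) :: rho')) // => z s /=.
  by case: ifP => // _ /E.
- move=> G x y e1 e2 t1 t2 t3 _ IH1 _ IH2 rho rho' r E; rewrite (IH1 _ _ _ E).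
  case: (ev rho' e1 r) => [[v k] r1].
  rewrite (IH2 _ ((y, psnd v) :: (x, pfst v) :: rho')) // => z s /=.
  by case: ifP => // _; case: ifP => // _ /E.
- move=> G e1 e2 _ IH1 _ IH2 rho rho' r E; rewrite (IH1 _ _ _ E).
  by case: (ev rho' e1 r) => [[v k] r1]; rewrite (IH2 _ _ _ E).
Qed.

(* Shadowed entries of [G], whose types [rho] need not respect, get a dummy value. *)
Fixpoint restr G (seen : seq nat) (rho : env) : env :=
  match G with
  | [::] => [::]
  | (x, s) :: G' =>
      (x, if x \in seen then inhab s else elook rho x) :: restr G' (x :: seen) rho
  end.

Lemma restr_look G seen rho x s : x \notin seen -> lookup G x = Some s ->
  elook (restr G seen rho) x = elook rho x.
Proof.
elim: G seen => //= -[y u] G IH seen xs /=.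
case: eqVneq => [<- _|xy lx]; first by rewrite (negPf xs).
by apply: IH => //; rewrite inE negb_or xy.
Qed.

Lemma wt_inhab r t : wt (@anyI R) r t (inhab t).
Proof. by elim: t. Qed.

Lemma wt_tle s s' r v : tle s s' -> wt (@anyI R) r s' v -> wt (@anyI R) r s v.
Proof.
elim: s s' v => [[]|//|a IHa b IHb [||a' b'] v] //=.
by move=> [la lb] [ev [wa wb]]; split=> //; split; [apply: IHa wa | apply: IHb wb].
Qed.

Lemma lookup_wte D r rho x s : wte (@anyI R) r D rho -> lookup D x = Some s ->
  wt (@anyI R) r s (elook rho x).
Proof. by move=> wr /(projP R)[M _ /(_ _ _ _ wr)[]]. Qed.

(** The second alternative is what the induction maintains: shadowed names are exempt. *)
Lemma wte_restr G D seen r rho : ctx_le G D \/ (forall x s, x \notin seen ->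
    lookup G x = Some s -> exists2 s', lookup D x = Some s' & tle s s') ->
  wte (@anyI R) r D rho -> wte (@anyI R) r G (restr G seen rho).
Proof.
move=> H wr; have {H} : forall x s, x \notin seen ->
    lookup G x = Some s -> exists2 s', lookup D x = Some s' & tle s s'.
  by case: H => // H x s _; apply: H.
elim: G seen => //= -[x s] G IH seen H; split=> //.
  case: ifP => [_|/negbT xs]; first exact: wt_inhab.
  have := H x s xs; rewrite eqxx => /(_ erefl)[s' ls' ss'].
  exact: wt_tle ss' (lookup_wte wr ls').
apply: IH => y u; rewrite inE negb_or => /andP[yx ys] ly.
by apply: H => //; rewrite (negPf yx).
Qed.

Lemma lsub_refl0 s n (U W : 'cV[V]_n) : lsub (vflat s (inhab s)) (vflat s (inhab s)) U W.
Proof.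
elim: s => [||a IHa b IHb] /=; [|by case|exact: lsub_col].
by move=> i; rewrite !mxE; apply: lcomb0.
Qed.

Lemma lsub_tle s s' v1 v2 n (U W : 'cV[V]_n) : tle s s' ->
  lsub (vflat s' v1) (vflat s' v2) U W -> lsub (vflat s v1) (vflat s v2) U W.
Proof.
elim: s s' v1 v2 => [[] //|s' v1 v2 _ _ []//|a IHa b IHb [||a' b'] v1 v2] //= [la lb] h.
apply: lsub_col; [apply: IHa la _ | apply: IHb lb _] => i.
  by have := h (lshift _ i); rewrite !col_mxEu.
by have := h (rshift _ i); rewrite !col_mxEd.
Qed.

Lemma lsub_look D rho1 rho2 x s : (exists r, wte (@anyI R) r D rho1) ->
  (exists r, wte (@anyI R) r D rho2) -> lookup D x = Some s ->
  lsub (vflat s (elook rho1 x)) (vflat s (elook rho2 x)) (eflat D rho1) (eflat D rho2).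
Proof.
move=> [r1 w1] [r2 w2] /(projP R)[M _ MP] i.
have [<- _] := MP _ _ _ w1; have [<- _] := MP _ _ _ w2.
by exists (row i M); rewrite map_row -!row_mul !mxE.
Qed.

Lemma lsub_restr G D seen rho1 rho2 : (exists r, wte (@anyI R) r D rho1) ->
  (exists r, wte (@anyI R) r D rho2) ->
  (forall x s, x \notin seen -> lookup G x = Some s ->
     exists2 s', lookup D x = Some s' & tle s s') ->
  lsub (eflat G (restr G seen rho1)) (eflat G (restr G seen rho2)) (eflat D rho1) (eflat D rho2).
Proof.
move=> w1 w2; elim: G seen => [|[x s] G IH] seen H /=; first by case.
apply: lsub_col.
  apply: IH => y u; rewrite inE negb_or => /andP[yx ys] ly.
  by apply: H => //=; rewrite (negPf yx).
case: ifP => [_|/negbT xs]; first exact: lsub_refl0.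
have := H x s xs; rewrite /= eqxx => /(_ erefl)[s' ls' ss'].
exact: lsub_tle ss' (lsub_look w1 w2 ls').
Qed.

(** An environment for [D] restricts to one for [G] on which evaluation is the same, and the
    restricted entries are linear in the original ones. *)
Lemma lequiv_coarsen G D t e1 e2 : ctx_le G D -> has_type G e1 t -> has_type G e2 t ->
  lequiv G t e1 e2 -> lequiv D t e1 e2.
Proof.
move=> GD h1 h2 [g1 g2 H].
have GD' x s : x \notin [::] -> lookup G x = Some s ->
    exists2 s', lookup D x = Some s' & tle s s' by move=> _; apply: GD.
have evE e rho r : has_type G e t -> ev rho e r = ev (restr G [::] rho) e r.
  by move=> h; apply: (ev_ext h) => x s lx; rewrite (restr_look _ _ lx).
have gD e : has_type G e t -> sem_typed G t e -> sem_typed D t e.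
  move=> h g rho r wr.
  have [v [k [s [E wv ok _]]]] := g (restr G [::] rho) r (wte_restr (or_introl GD) wr).
  exists v, k, s; split=> //; first by rewrite evE.
  by apply: wte_le wr; rewrite leq_addr.
split; [exact: gD | exact: gD |].
move=> n A1 A2 l1 l2 r1 r2 rho1 rho2 f1 f2 o1 o2 wr1 wr2 eq.
rewrite (evE _ _ _ h1) (evE _ _ _ h2).
apply: H => //; [exact: wte_restr (or_introl GD) wr1 | exact: wte_restr (or_introl GD) wr2 |].
apply: (law_eq_lsub eq); apply: lsub_col; first exact/lsub_l/lsub_refl.
by apply: lsub_r; apply: lsub_restr => //; [exists r1 | exists r2].
Qed.

Lemma map_colseq (T U : pzRingType) (f : T -> U) n (X : 'cV[T]_n) :
  [seq f x | x <- colseq X] = colseq (map_mx f X).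
Proof. by rewrite /colseq -map_comp; apply: eq_map => i; rewrite /= mxE. Qed.

Lemma soundness G t e1 e2 (F1 F2 : cmor R (dimc G) (dimt t)) :
  has_type G e1 t -> has_type G e2 t -> denotes e1 F1 -> denotes e2 F2 ->
  cond_equiv F1 F2 -> ctx_equiv G t e1 e2.
Proof.
move=> h1 h2 d1 d2 E K t' ct; have [D k GD] := ctx_typed_kty ct.
have le := lequiv_base h1 h2 d1 d2 (or_introl E).
have [_ _ H] := lequiv_plug k (lequiv_coarsen GD h1 h2 le).
(* Closed programs: empty frame, empty environment, no latents in use. *)
have := H 0%N 0 0 (stdlaw R) (stdlaw R) 0%N 0%N [::] [::] (@fresh_stdlaw R) (@fresh_stdlaw R).
have := closed_outcome (ct _ h1); have := closed_outcome (ct _ h2).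
case: (ev _ (plug K e1) _) => [[v1 k1] r1]; case: (ev _ (plug K e2) _) => [[v2 k2] r2].
move=> [w2 f2 _ p2] [w1 f1 _ p1] M.
have {M} : lmatch (col_mx (0 : 'cV_0) (vflat t' v1)) (col_mx (0 : 'cV_0) (vflat t' v2))
   (condl (stdlaw R) k1) (condl (stdlaw R) k2).
  by apply: M => // [[]|[]].
move=> M; split.
  by rewrite f1 f2; case: (condl _ k1) (condl _ k2) M => [?|] [?|].
move=> u1 q1 u2 q2 /p1[l1 c1 ->] /p2[l2 c2 ->].
move: M; rewrite c1 c2 /= => eq.
have [m c] : law_eq l1 l2 (vflat t' v1) (vflat t' v2).
  by apply: (law_eq_lsub eq); apply/lsub_r/lsub_refl.
rewrite !map_colseq; congr pair; first by congr colseq.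
apply: (@eq_from_nth _ [::]) => [|i]; first by rewrite !size_map.
rewrite size_map => lti; have lti' : (i < dimt t')%N by rewrite size_colseq in lti.
pose j := Ordinal lti'.
rewrite !(nth_map 0) ?size_colseq // -[i]/(nat_of_ord j) !nth_colseq.
rewrite !map_colseq; congr colseq; apply/colP => i'; rewrite !mxE.
by have /matrixP/(_ j i') := c; rewrite !mxE.
Qed.

End Soundness.

(** * Completeness *)

Section Completeness.
Variable R : realType.
Local Notation V := {poly R}.
Local Notation pm := (map_mx (@polyC R)).
Local Notation term := (term R).
Local Notation env := (seq (nat * term)).
Implicit Types (e v : term) (G D : tctx) (t : ty) (r : nat) (l : law R) (K : ctx R) (rho : env).

Lemma has_type_weaken G e t : has_type G e t -> forall D,
  (forall x s, lookup G x = Some s -> lookup D x = Some s) -> has_type D e t.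
Proof.
elim=> {G e t}; try by move=> *; econstructor; eauto.
- move=> G x e1 e2 t1 t2 _ IH1 _ IH2 D E; apply: T_Let (IH1 _ E) (IH2 _ _) => z s /=.
  by case: ifP => // _; apply: E.
- move=> G x y e1 e2 t1 t2 t3 _ IH1 _ IH2 D E; apply: T_LetP (IH1 _ E) (IH2 _ _) => z s /=.
  by case: ifP => // _; case: ifP => // _; apply: E.
Qed.

Lemma lookup_cat G D x s : lookup G x = Some s -> lookup (G ++ D) x = Some s.
Proof. by elim: G => //= -[y u] G IH; case: ifP. Qed.

Lemma elook_cat Q r G rho rho' x s : wte Q r G rho -> lookup G x = Some s ->
  elook (rho ++ rho') x = elook rho x.
Proof.
elim: G rho => //= -[y u] G IH [|[z v] rho] //= [<- _ wr].
by case: ifP => // _; apply: IH.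
Qed.

Fixpoint build t : ('I_(dimt t) -> term) -> term :=
  match t return ('I_(dimt t) -> term) -> term with
  | TR => fun f => f ord0
  | TI => fun _ => Unt R
  | TPair a b => fun f => Pair (build (fun i => f (lshift _ i))) (build (fun i => f (rshift _ i)))
  end.

Lemma vflat_build t (g : 'I_(dimt t) -> term) : vflat t (build g) = \col_i paff (g i).
Proof.
elim: t g => [g|g|a IHa b IHb g] /=; apply/colP => i.
- by rewrite !mxE (ord1 i).
- by case: i.
- by rewrite !mxE; case: split_ordP => j ->; rewrite ?IHa ?IHb mxE.
Qed.

Lemma wt_build Q r t (g : 'I_(dimt t) -> term) : Q (Unt R) ->
  (forall i, rval r (g i)) -> wt Q r t (build g).
Proof.
move=> QU; elim: t g => [g H|g _|a IHa b IHb g H] //=.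
by split=> //; split; [apply: IHa | apply: IHb].
Qed.

Lemma build_typed D t (f : 'I_(dimt t) -> term) :
  (forall i, has_type D (f i) TR) -> has_type D (build f) t.
Proof.
elim: t f => [f H|f _|a IHa b IHb f H] /=; [exact: H | by constructor |].
by constructor; [apply: IHa | apply: IHb].
Qed.

Lemma ev_build rho r t (f g : 'I_(dimt t) -> term) :
  (forall i, ev rho (f i) r = (g i, [::], r)) -> ev rho (build f) r = (build g, [::], r).
Proof.
elim: t f g => [f g H|f g _|a IHa b IHb f g H] //=.
rewrite (IHa _ (fun i => g (lshift _ i))) => [|i]; last exact: H.
by rewrite (IHb _ (fun i => g (rshift _ i))) // => i; apply: H.
Qed.

(** The type at which a test returns its frame; ending in [TI] admits an empty frame. *)
Fixpoint tyvec n : ty := if n is n'.+1 then TPair TR (tyvec n') else TI.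
Lemma dim_tyvec n : dimt (tyvec n) = n.
Proof. by elim: n => //= n ->. Qed.

(** * Contexts that sample, observe and bind *)

Section Program.
(* The latents [0, ..., N - 1] are bound to the variables [n0, ..., n0 + N - 1]. *)
Variables (n0 N : nat).

Definition rowt (w : 'rV[R]_N) (c : R) : term :=
  foldr (fun (j : 'I_N) b => Plus (Scale (w 0 j) (Var R (n0 + j))) b) (Const c) (enum 'I_N).
Definition rowv (w : 'rV[R]_N) (c : R) : term :=
  foldr (fun (j : 'I_N) b => Plus (Scale (w 0 j) (Lat R j)) b) (Const c) (enum 'I_N).

Definition latenv rho := forall j, (j < N)%N -> elook rho (n0 + j) = Lat R j.
Definition latctx D := forall j, (j < N)%N -> lookup D (n0 + j) = Some TR.

Lemma ev_rowt rho r w c : latenv rho -> ev rho (rowt w c) r = (rowv w c, [::], r).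
Proof.
move=> H; rewrite /rowt /rowv; elim: (enum 'I_N) => //= j s IH.
by rewrite IH H.
Qed.

Lemma rowt_typed D w c : latctx D -> has_type D (rowt w c) TR.
Proof.
move=> H; rewrite /rowt; elim: (enum 'I_N) => [|j s IH] /=; first by constructor.
by do 3 constructor=> //; rewrite H.
Qed.

Lemma rowv_rval w c : rval N (rowv w c).
Proof. by rewrite /rowv; elim: (enum 'I_N) => //= j s ->; rewrite ltn_ord. Qed.

Lemma paff_rowv w c : paff (rowv w c) = (pm w *m lats R 0 N) 0 0 + c%:P.
Proof.
rewrite mxE -big_enum /= /rowv; elim: (enum 'I_N) => [|j s IH] /=.
  by rewrite big_nil add0r.
by rewrite IH big_cons -addrA !mxE mul_polyC.
Qed.

Fixpoint sample j m K : ctx R :=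
  if m is m'.+1 then CLet2 (n0 + j) (Normal R) (sample j.+1 m' K) else K.
Fixpoint lenv j m rho : env :=
  if m is m'.+1 then lenv j.+1 m' ((n0 + j, Lat R j)%N :: rho) else rho.
Fixpoint lctx j m D : tctx :=
  if m is m'.+1 then lctx j.+1 m' ((n0 + j, TR)%N :: D) else D.

Lemma ev_sample j m K e rho :
  ev rho (plug (sample j m K) e) j = ev (lenv j m rho) (plug K e) (j + m)%N.
Proof.
elim: m j rho => [|m IH] j rho /=; first by rewrite addn0.
by rewrite IH addnS addSn; case: (ev _ _ _) => [[]].
Qed.

Lemma sample_typed j m K e D t : has_type (lctx j m D) (plug K e) t ->
  has_type D (plug (sample j m K) e) t.
Proof. by elim: m j D => //= m IH j D /IH; apply: T_Let; constructor. Qed.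

Lemma lenv_look j m rho i : elook (lenv j m rho) (n0 + i) =
  if (j <= i < j + m)%N then Lat R i else elook rho (n0 + i).
Proof.
elim: m j rho => [|m IH] j rho /=; first by rewrite addn0; case: ltngtP.
rewrite IH /= eqn_add2l addSnnS.
by case: (ltngtP j i) => // ->; rewrite addnS ltnS leq_addr.
Qed.

Lemma lctx_look j m D i : lookup (lctx j m D) (n0 + i) =
  if (j <= i < j + m)%N then Some TR else lookup D (n0 + i).
Proof.
elim: m j D => [|m IH] j D /=; first by rewrite addn0; case: ltngtP.
rewrite IH /= eqn_add2l addSnnS.
by case: (ltngtP j i) => // ->; rewrite addnS ltnS leq_addr.
Qed.

(** Observations are sequenced by lets on the dummy name [n0 + N], distinct from all names of
    latents. *)
Fixpoint observe (fs : seq term) K : ctx R :=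
  if fs is f :: fs' then CLet2 (n0 + N) (CondE f (Const 0)) (observe fs' K) else K.

Lemma latenv_cons x v rho : (forall j, (j < N)%N -> x <> n0 + j)%N -> latenv rho ->
  latenv ((x, v) :: rho).
Proof. by move=> nx H j ltj /=; case: eqP => [e|_]; [case: (nx _ ltj) | apply: H]. Qed.

Lemma latctx_cons x s D : (forall j, (j < N)%N -> x <> n0 + j)%N -> latctx D ->
  latctx ((x, s) :: D).
Proof. by move=> nx H j ltj /=; case: eqP => [e|_]; [case: (nx _ ltj) | apply: H]. Qed.

Lemma neq_top j : (j < N)%N -> (n0 + N <> n0 + j)%N.
Proof. by move=> ltj /addnI e; rewrite e ltnn in ltj. Qed.

Lemma ev_observe (I : Type) (s : seq I) (w : I -> 'rV_N) (c : I -> R) K e rho r :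
  latenv rho -> exists rho', [/\ latenv rho' &
    ev rho (plug (observe [seq rowt (w i) (c i) | i <- s] K) e) r =
      let: (v, k, r') := ev rho' (plug K e) r in
      (v, [seq paff (rowv (w i) (c i)) | i <- s] ++ k, r')].
Proof.
elim: s rho => [|i s IH] rho H /=.
  by exists rho; split=> //; case: (ev _ _ _) => [[]].
have [|rho' [H' E]] := IH ((n0 + N, Unt R)%N :: rho); first exact: latenv_cons neq_top H.
exists rho'; split=> //; rewrite (ev_rowt _ _ _ H) E.
by case: (ev rho' _ _) => [[v k] r']; rewrite subr0.
Qed.

Lemma observe_typed (I : Type) (s : seq I) (w : I -> 'rV_N) (c : I -> R) K e D t : latctx D ->
  (forall D', latctx D' -> has_type D' (plug K e) t) ->
  has_type D (plug (observe [seq rowt (w i) (c i) | i <- s] K) e) t.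
Proof.
move=> H HK; elim: s D H => [|i s IH] D H /=; first exact: HK.
apply: (T_Let (t1 := TI)); first by constructor; [apply: rowt_typed | constructor].
by apply: IH; apply: latctx_cons neq_top H.
Qed.

(** The newest variable must be bound innermost, so its let is put around [K] before recursing. With
    the names of [G] below [n0], no latent gets shadowed. *)
Fixpoint bind_ctx G : ('I_(dimc G) -> term) -> ctx R -> ctx R :=
  match G return ('I_(dimc G) -> term) -> ctx R -> ctx R with
  | [::] => fun _ K => K
  | (x, t) :: G' => fun f K =>
      bind_ctx (fun i => f (lshift _ i)) (CLet2 x (build (fun i => f (rshift _ i))) K)
  end.

Fixpoint bind_env G : ('I_(dimc G) -> term) -> env :=
  match G return ('I_(dimc G) -> term) -> env with
  | [::] => fun _ => [::]
  | (x, t) :: G' => fun f =>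
      (x, build (fun i => f (rshift _ i))) :: bind_env (fun i => f (lshift _ i))
  end.

Lemma eflat_bind G (g : 'I_(dimc G) -> term) : eflat G (bind_env g) = \col_i paff (g i).
Proof.
elim: G g => [g|[x t] G IH g] /=; apply/colP => i; first by case: i.
by rewrite !mxE; case: split_ordP => j ->; rewrite ?IH ?vflat_build mxE.
Qed.

Lemma wte_bind Q r G (g : 'I_(dimc G) -> term) : Q (Unt R) ->
  (forall i, rval r (g i)) -> wte Q r G (bind_env g).
Proof.
move=> QU; elim: G g => [//|[x t] G IH] g H /=.
by split=> //; [apply: wt_build | apply: IH].
Qed.

Lemma latenv_bind G (g : 'I_(dimc G) -> term) rho :
  all (fun z => z.1 < n0)%N G -> latenv rho -> latenv (bind_env g ++ rho).
Proof.
elim: G g => [//|[x t] G IH] g /= /andP[xn nG] H.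
apply: latenv_cons; last exact: IH.
by move=> j _ e; rewrite e ltnNge leq_addr in xn.
Qed.

Lemma latctx_bind G D : all (fun z => z.1 < n0)%N G -> latctx D -> latctx (G ++ D).
Proof.
elim: G => [//|[x t] G IH] /= /andP[xn nG] H.
apply: latctx_cons; last exact: IH.
by move=> j _ e; rewrite e ltnNge leq_addr in xn.
Qed.

Lemma ev_bind G (f g : 'I_(dimc G) -> term) K e rho r :
  all (fun z => z.1 < n0)%N G ->
  (forall i rho' r', latenv rho' -> ev rho' (f i) r' = (g i, [::], r')) -> latenv rho ->
  ev rho (plug (bind_ctx f K) e) r = ev (bind_env g ++ rho) (plug K e) r.
Proof.
elim: G f g K => [//|[x t] G IH] f g K /= /andP[xn nG] fg H.
rewrite (IH _ (fun i => g (lshift _ i))) //=; last by move=> *; apply: fg.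
rewrite (ev_build (g := fun i => g (rshift _ i))) => [|i]; last first.
  by apply: fg; apply: latenv_bind.
by case: (ev _ _ _) => [[]].
Qed.

Lemma bind_typed G (f : 'I_(dimc G) -> term) K e D t :
  all (fun z => z.1 < n0)%N G ->
  (forall i D', latctx D' -> has_type D' (f i) TR) -> latctx D ->
  has_type (G ++ D) (plug K e) t -> has_type D (plug (bind_ctx f K) e) t.
Proof.
elim: G f K => [//|[x s] G IH] f K /= /andP[xn nG] fT H h.
apply: IH => //= [i D'|]; first exact: fT.
apply: T_Let h; apply: build_typed => i.
by apply: fT; apply: latctx_bind.
Qed.

End Program.

Lemma name_bound G : exists n0, all (fun z => z.1 < n0)%N G.
Proof.
elim: G => [|[x t] G [n0 H]]; first by exists 0%N.
exists (maxn x.+1 n0) => /=; rewrite leq_maxl /=.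
by apply: sub_all H => z /= zn; rewrite leq_max zn orbT.
Qed.

Lemma psd_realizes n (f : gmor R 0 n) : psd (gS f) ->
  exists L, realizes (stdlaw R) f (pm L *m lats R 0 n + pm (gb f)).
Proof.
move=> /cholesky[L SL]; exists L; split.
  by rewrite MmD Mm_mul MmC Mm_lats ?mulmx0 ?add0r //; apply: fresh_stdlaw.
rewrite !(CmDl, CmDr, CmCl, CmCr, Cm_mull, Cm_mulr) Cm_lats2; last exact: fresh_stdlaw.
by rewrite !addr0 mul1mx.
Qed.

Definition mxrows n (S : 'M[R]_n) := [seq [seq S i j | j <- enum 'I_n] | i <- enum 'I_n].

Lemma mxrows_inj n : injective (@mxrows n).
Proof.
move=> S S' /eq_in_map E; apply/matrixP => i j.
by have /eq_in_map := E i (mem_enum _ i); apply; rewrite mem_enum.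
Qed.

Lemma mxrows_Cm l n (U : 'cV[V]_n) :
  [seq [seq lc l x y | y <- colseq U] | x <- colseq U] = mxrows (Cm l U U).
Proof.
rewrite /mxrows /colseq -map_comp; apply: eq_map => i /=.
by rewrite -map_comp; apply: eq_map => j; rewrite /= mxE.
Qed.

(** * The context posing an inference problem *)

Section Test.
Variables (G : tctx) (t : ty) (a : nat) (Psi : cmor R 0 (a + dimc G)).
Local Notation N := (a + dimc G + ck Psi)%N.
Variables (n0 : nat) (L : 'M[R]_N).
Hypothesis nG : all (fun z => z.1 < n0)%N G.
Hypothesis rPsi : realizes (stdlaw R) (cf Psi) (pm L *m lats R 0 N + pm (gb (cf Psi))).

Let U : 'cV[V]_N := pm L *m lats R 0 N + pm (gb (cf Psi)).
Let ft (i : 'I_N) := rowt n0 (row i L) (gb (cf Psi) i 0).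
Let gt (i : 'I_N) := rowv (row i L) (gb (cf Psi) i 0).
Let iA (i : 'I_(dimt (tyvec a))) : 'I_N := lshift _ (lshift _ (cast_ord (dim_tyvec a) i)).
Let iX (i : 'I_(dimc G)) : 'I_N := lshift _ (rshift _ i).
Let obs (i : 'I_(ck Psi)) := row (rshift (a + dimc G) i) L.
(** The observed point is moved into the constant, since [observe] compares with 0. *)
Let obsc (i : 'I_(ck Psi)) := gb (cf Psi) (rshift (a + dimc G) i) 0 - co Psi i 0.

Definition test_ctx : ctx R :=
  sample n0 0 N (observe n0 N [seq rowt n0 (obs i) (obsc i) | i <- enum 'I_(ck Psi)]
    (CPairR (build (fun i => ft (iA i))) (bind_ctx (fun i => ft (iX i)) (Hole R)))).

Lemma test_ctx_typed : ctx_typed test_ctx G t (TPair (tyvec a) t).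
Proof.
move=> e he; apply: sample_typed; apply: observe_typed.
  by move=> j ltj; rewrite lctx_look add0n ltj.
move=> D HD /=; constructor; first by apply: build_typed => i; apply: rowt_typed HD.
apply: (bind_typed nG _ HD) => [i D' HD'|]; first exact: rowt_typed HD'.
by apply: (has_type_weaken he) => x s; apply: lookup_cat.
Qed.

Lemma paff_gt i : paff (gt i) = U i 0.
Proof. by rewrite paff_rowv /U map_row -row_mul !mxE. Qed.

Lemma old_U i : old N (U i 0).
Proof. by rewrite -paff_gt; apply/paff_old/rowv_rval. Qed.

Let rhoG : env := bind_env (fun i => gt (iX i)).
Let vA : term := build (fun i => gt (iA i)).
Let A := usubmx (usubmx U).
Let X := dsubmx (usubmx U).
Let K := dsubmx U.

Lemma ev_test e : has_type G e t -> ev [::] (plug test_ctx e) 0 =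
  let: (v, k, r) := ev rhoG e N in (Pair vA v, colseq (K - pm (co Psi)) ++ k, r).
Proof.
move=> he; rewrite ev_sample add0n.
have [|rho' [H ->]] := @ev_observe n0 N _ (enum 'I_(ck Psi)) obs obsc
  (CPairR (build (fun i => ft (iA i))) (bind_ctx (fun i => ft (iX i)) (Hole R))) e
  (lenv n0 0 N [::]) N.
  by move=> j ltj; rewrite lenv_look add0n ltj.
rewrite /= (ev_build (g := fun i => gt (iA i))); last by move=> i; apply: ev_rowt H.
rewrite (@ev_bind n0 N G _ (fun i => gt (iX i)) _ _ _ _ nG _ H) => [|i rho'' r' H']; last exact: ev_rowt H'.
rewrite /= (@ev_ext _ _ _ _ he _ rhoG) => [|x s lx].
  case: (ev _ _ _) => [[v k] r]; congr (_, _ ++ _, _).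
  apply: eq_map => i; rewrite paff_rowv /obs /obsc !mxE.
  by rewrite polyCB addrA; congr (_ + _ - _); apply: eq_bigr => j _; rewrite !mxE.
have wr : wte (@anyI R) N G rhoG by apply: wte_bind => // i; apply: rowv_rval.
exact: elook_cat wr lx.
Qed.

(** Up to order, the program and the composite condition the standard law on the same equations, so
    [closed_outcome] and [inference] describe one and the same law. *)
Lemma test_outcome e (F : cmor R (dimc G) (dimt t)) : has_type G e t -> denotes e F ->
  let P := ccomp (ctens (cid R a) F) Psi in
  (succeeds P <-> ~ fails (plug test_ctx e)) /\
  forall phi, posterior P phi -> exists v p, runs (plug test_ctx e) v p /\
    pushforward v p = (colseq (gb phi), mxrows (gS phi)).
Proof.
move=> he d P.
have wr : wte (@anyI R) N G rhoG by apply: wte_bind => // i; apply: rowv_rval.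
have XE : eflat G rhoG = X.
  by rewrite eflat_bind; apply/colP => i; rewrite [LHS]mxE paff_gt [RHS]mxE [RHS]mxE.
have := closed_outcome (test_ctx_typed he); rewrite ev_test //.
have [v [k [s [-> wv ok]]]] := d (@anyI R) rhoG N I wr; rewrite XE => c [wvv fE ex pE].
have oA i : old N (A i 0) by rewrite mxE mxE; apply: old_U.
have oX i : old N (X i 0) by rewrite mxE mxE; apply: old_U.
have oK i : old N (K i 0) by rewrite mxE; apply: old_U.
have rP : realizes (stdlaw R) (cf Psi) (col_mx (col_mx A X) K) by rewrite !vsubmxK.
have fr : fresh (stdlaw R) N by apply: fresh_le (fresh_stdlaw R).
have pk : perm_eq (colseq (K - pm (co Psi)) ++ k) (k ++ colseq (K - pm (co Psi))).
  by rewrite perm_catC.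
have := inference fr oA oX oK rP c pk; rewrite -/P.
have AE : colseq (vflat (TPair (tyvec a) t) (Pair vA v)) = colseq (col_mx A (vflat t v)).
  rewrite /= !colseq_col_mx; congr (_ ++ _); rewrite vflat_build.
  have -> : \col_i paff (gt (iA i)) = castmx (esym (dim_tyvec a), erefl) A.
    apply/colP => i; rewrite castmxE [LHS]mxE paff_gt [RHS]mxE [RHS]mxE; congr (U _ _); last exact: val_inj.
    by apply: val_inj.
  by rewrite colseq_cast.
case E : (condl _ _) fE ex pE => [l'|] fE ex pE; last first.
  by move=> nP; split=> [|phi [/nP]//]; split=> [/nP//|[]]; apply/fE.
move=> [sP [phi0 _ rphi]]; split; first by split=> // _ /fE.
move=> phi /rphi[m0 c0]; have [//|v' [p' r']] := ex; exists v', p'; split=> //.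
have [l [<-] ->] := pE _ _ r'.
by rewrite AE map_colseq m0 c0 mxrows_Cm.
Qed.

End Test.

(** The test depends on [G] and the prior but not on the filling term, so a single context compares
    both posteriors. *)
Lemma completeness G t e1 e2 (F1 F2 : cmor R (dimc G) (dimt t)) :
  has_type G e1 t -> has_type G e2 t -> denotes e1 F1 -> denotes e2 F2 ->
  ctx_equiv G t e1 e2 -> cond_equiv F1 F2.
Proof.
move=> h1 h2 d1 d2 E a Psi pPsi P1 P2.
have [L rPsi] := psd_realizes pPsi; have [n0 nG] := name_bound G.
have [fE pE] := E _ _ (@test_ctx_typed G t a Psi n0 L nG).
have [s1 q1] := test_outcome nG rPsi h1 d1; have [s2 q2] := test_outcome nG rPsi h2 d2.
split; first by rewrite /P1 /P2 s1 s2 fE.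
move=> phi1 phi2 /q1[v1 [p1 [r1 e1']]] /q2[v2 [p2 [r2 e2']]].
have := pE _ _ _ _ r1 r2; rewrite e1' e2' => -[/colseqP mE /mxrows_inj cE].
exact: gmor0_eq.
Qed.

End Completeness.

Theorem theorem6p2 (R : realType) (G : tctx) (t : ty) (e1 e2 : term R) :
  has_type G e1 t -> has_type G e2 t ->
  exists F1 F2 : cmor R (dimc G) (dimt t),
    den G e1 = Some (existT _ t F1) /\ den G e2 = Some (existT _ t F2) /\
    (cond_equiv F1 F2 <-> ctx_equiv G t e1 e2).
Proof.
move=> h1 h2; have [F1 D1 d1] := adequacy h1; have [F2 D2 d2] := adequacy h2.
exists F1, F2; split=> //; split=> //.
by split; [apply: soundness | apply: completeness].
Qed.
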